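(* If an analytic surface in $\mathbb{R}^3\subset\mathbb{R}^4$ is a Möbius transformation of a surface in $\mathbb{R}^4=\mathbb{H}$ of the form $$\Phi(u,v)=\overline{A}(u,v)^{-1}B(u,v)\,\overline{C}(u,v)^{-1},\quad\text{where } A,B,C\in\mathbb{H}_{11}\text{ satisfy } AC\in\mathbb{H}_{11}-\{0\},$$ then the former surface is a Möbius transformation of a subset of one of the following sets: (E) the set $\{\,p+q : p\in\alpha,\ q\in\beta\,\}$, where $\alpha,\beta$ are two circles in $\mathbb{R}^3$; (C) the set $\left\{\,2\frac{p\times q}{|p+q|^2} : p\in\alpha,\ q\in\beta,\ p+q\neq 0\,\right\}$, where $\alpha,\beta$ are two circles in the unit sphere $S^2\subset\mathbb{R}^3$; (D) the set $\{\,(x,y,z)\in\mathbb{R}^3 : Q(x,y,z,x^2+y^2+z^2)=0\,\}$, where $Q\in\mathbb{R}[x,y,z,t]$ has degree $2$ or $1$.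
   Context: $\mathbb{R}^4$ is identified with the quaternions $\mathbb{H}$ and $\mathbb{R}^3$ with the purely imaginary quaternions $\mathrm{Im}\,\mathbb{H}$. $\mathbb{H}[u,v]$ is the ring of polynomials with quaternionic coefficients (the variables commute with each other and with the coefficients); $\mathbb{H}_{mn}\subset\mathbb{H}[u,v]$ is the set of polynomials of degree at most $m$ in $u$ and at most $n$ in $v$; $\overline{A}$ is obtained by conjugating all coefficients of $A$. For real $\hat u,\hat v$ the value $A(\hat u,\hat v)\in\mathbb{H}$ is well defined, so a rational expression in such polynomials defines a (possibly degenerate) surface in $\mathbb{R}^4$, namely a real analytic map of a planar domain in which the denominators do not vanish (or the image of this map). An analytic surface in $\mathbb{R}^3$ is the image of an injective real analytic map of a planar domain into $\mathbb{R}^3$ with nondegenerate differential at each point. A Möbius transformation is a composition of inversions; a set is called a Möbius transformation of another set if it is the image of it under such a map.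
   Formalization: In (C) the pairs with p+q=0 are not dropped but contribute the point at infinity, since a large surface may pass through its Möbius image; in (D) the polynomials Q whose set is all of R^3 (multiples of x^2+y^2+z^2-t) are excluded, as they would make the claim vacuous. *)

(* Defs.v *)
From HB Require Import structures.
From mathcomp Require Import all_boot all_order all_algebra.
From mathcomp Require Import all_classical all_reals all_analysis.
From mathcomp Require Import -(notations) mpoly.
From mathcomp Require Import ring.

Set Implicit Arguments.
Unset Strict Implicit.
Unset Printing Implicit Defensive.

Import Order.TTheory GRing.Theory Num.Theory.
Import numFieldNormedType.Exports.

Local Open Scope classical_set_scope.
Local Open Scope ring_scope.

(** Quaternions: [quat R] is ['rV[R]_4] itself, the row [(w, x, y, z)] standing
    for w + xi + yj + zk, equipped with Hamilton's product. *)

Definition quat (R : Type) : Type := 'rV[R]_4.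

Definition mkquat (R : Type) (x0 w x y z : R) : quat R :=
  \row_(i < 4) nth x0 [:: w; x; y; z] i.

Section QuaternionRing.
Variable R : comNzRingType.

HB.instance Definition _ := GRing.Lmodule.copy (quat R) 'rV[R]_4.

Implicit Types a b c : quat R.

Local Notation mk := (mkquat (0 : R)).
Local Notation i0 := (inord 0 : 'I_4).
Local Notation i1 := (inord 1 : 'I_4).
Local Notation i2 := (inord 2 : 'I_4).
Local Notation i3 := (inord 3 : 'I_4).

Definition qone : quat R := mk 1 0 0 0.

Definition qmul a b : quat R :=
  let a_ k := (a : 'rV[R]_4) 0 (inord k) in
  let b_ k := (b : 'rV[R]_4) 0 (inord k) in
  mk (a_ 0 * b_ 0 - a_ 1 * b_ 1 - a_ 2 * b_ 2 - a_ 3 * b_ 3)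
     (a_ 0 * b_ 1 + a_ 1 * b_ 0 + a_ 2 * b_ 3 - a_ 3 * b_ 2)
     (a_ 0 * b_ 2 - a_ 1 * b_ 3 + a_ 2 * b_ 0 + a_ 3 * b_ 1)
     (a_ 0 * b_ 3 + a_ 1 * b_ 2 - a_ 2 * b_ 1 + a_ 3 * b_ 0).

Definition qconj a : quat R :=
  let a_ k := (a : 'rV[R]_4) 0 (inord k) in
  mk (a_ 0) (- a_ 1) (- a_ 2) (- a_ 3).

Definition qreal (t : R) : quat R := mk t 0 0 0.

Definition qnormsq a : R := \sum_i (a : 'rV[R]_4) 0 i ^+ 2.

Lemma mkquatE (w x y z : R) : ((mk w x y z : 'rV_4) 0 i0 = w)
  * ((mk w x y z : 'rV_4) 0 i1 = x) * ((mk w x y z : 'rV_4) 0 i2 = y)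
  * ((mk w x y z : 'rV_4) 0 i3 = z).
Proof. by do !split; rewrite mxE inordK. Qed.

Lemma quatP (a b : 'rV[R]_4) : a 0 i0 = b 0 i0 -> a 0 i1 = b 0 i1 ->
  a 0 i2 = b 0 i2 -> a 0 i3 = b 0 i3 -> a = b.
Proof.
move=> e0 e1 e2 e3; apply/rowP => i.
have -> : i = inord i by rewrite inord_val.
by case: i => -[|[|[|[|//]]]] /= _.
Qed.

Lemma qnormsqE a : qnormsq a = (a : 'rV_4) 0 i0 ^+ 2 + (a : 'rV_4) 0 i1 ^+ 2
  + (a : 'rV_4) 0 i2 ^+ 2 + (a : 'rV_4) 0 i3 ^+ 2.
Proof.
rewrite /qnormsq !big_ord_recr big_ord0 /= add0r.
by do !congr (_ + _); congr (_ 0 _ ^+ 2); apply: val_inj; rewrite /= inordK.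
Qed.

Lemma qmulA : associative qmul.
Proof. by move=> a b c; apply: quatP; rewrite !mkquatE; ring. Qed.

Lemma qmul1 : left_id qone qmul.
Proof. by move=> a; apply: quatP; rewrite !mkquatE; ring. Qed.

Lemma qmulr1 : right_id qone qmul.
Proof. by move=> a; apply: quatP; rewrite !mkquatE; ring. Qed.

Lemma qmulDl : left_distributive qmul +%R.
Proof. by move=> a b c; apply: quatP; rewrite !(mkquatE, mxE); ring. Qed.

Lemma qmulDr : right_distributive qmul +%R.
Proof. by move=> a b c; apply: quatP; rewrite !(mkquatE, mxE); ring. Qed.

Lemma qone_neq0 : qone != 0.
Proof.
apply/eqP => /rowP /(_ i0); rewrite mkquatE mxE => /eqP.
by rewrite oner_eq0.
Qed.

HB.instance Definition _ := GRing.Zmodule_isNzRing.Build (quat R)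
  qmulA qmul1 qmulr1 qmulDl qmulDr qone_neq0.

End QuaternionRing.

Section QuaternionInverse.
Variable R : realFieldType.

Implicit Types a b : quat R.

Definition qinv a : quat R := (qnormsq a)^-1 *: qconj a.

Lemma qnormsq_eq0 a : (qnormsq a == 0) = (a == 0).
Proof.
apply/eqP/eqP => [|->]; last first.
  by rewrite /qnormsq big1 // => i _; rewrite mxE expr0n.
move=> /psumr_eq0P h; apply/rowP => i; rewrite mxE.
by apply/eqP; rewrite -sqrf_eq0 h // => j _; exact: sqr_ge0.
Qed.

Lemma qmulVq : {in [pred a | a != 0], left_inverse 1 qinv *%R}.
Proof.
move=> a; rewrite inE -qnormsq_eq0 /qinv qnormsqE => a0.
by apply: quatP; rewrite !(mkquatE, mxE); field.
Qed.

Lemma qmulqV : {in [pred a | a != 0], right_inverse 1 qinv *%R}.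
Proof.
move=> a; rewrite inE -qnormsq_eq0 /qinv qnormsqE => a0.
by apply: quatP; rewrite !(mkquatE, mxE); field.
Qed.

Lemma qunitP a b : b * a = 1 /\ a * b = 1 -> a != 0.
Proof. by case=> _; apply: contra_eq_neq => ->; rewrite mul0r eq_sym oner_eq0. Qed.

Lemma qinv_out : {in [predC [pred a | a != 0]], qinv =1 id}.
Proof.
move=> a; rewrite !inE negbK => /eqP ->; rewrite /qinv.
have -> : qnormsq (0 : quat R) = 0 by apply/eqP; rewrite qnormsq_eq0.
by rewrite invr0 scale0r.
Qed.

HB.instance Definition _ := GRing.NzRing_hasMulInverse.Build (quat R)
  qmulVq qmulqV qunitP qinv_out.

End QuaternionInverse.

(** H[u, v] is [{poly {poly quat R}}], with u the outer variable and v the inner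
    one; polynomial variables commute with noncommuting coefficients in
    MathComp.  [p.[x, y]] evaluates at u = x, v = y. *)

Definition in_Hmn (R : comNzRingType) (m n : nat) (A : {poly {poly quat R}}) :
  Prop := (size A <= m.+1)%N /\ (sizeY A <= n.+1)%N.

Definition pconj (R : comNzRingType) (A : {poly {poly quat R}}) :
  {poly {poly quat R}} := map_poly (map_poly (@qconj R)) A.

Definition qeval (R : comNzRingType) (A : {poly {poly quat R}}) (w : 'rV[R]_2) :
  quat R := A.[qreal (w 0 0), qreal (w 0 1)].

Definition Phi (R : realFieldType) (A B C : {poly {poly quat R}})
  (w : 'rV[R]_2) : quat R :=
  (qeval (pconj A) w)^-1 * qeval B w * (qeval (pconj C) w)^-1.

(** The norm [`|x|] of a matrix is the sup norm, so the
    Euclidean structure is given by [dot]. *)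

Definition dot (R : pzRingType) (n : nat) (x y : 'rV[R]_n) : R :=
  \sum_i x 0 i * y 0 i.

Definition cross (R : pzRingType) (x y : 'rV[R]_3) : 'rV[R]_3 :=
  \row_(k < 3) (x 0 (ordS k) * y 0 (ordS (ordS k))
                - x 0 (ordS (ordS k)) * y 0 (ordS k)).

Definition imq (R : pzRingType) (x : 'rV[R]_3) : quat R :=
  row_mx (0 : 'rV[R]_1) x.

Definition is_circle (R : numDomainType) (al : set 'rV[R]_3) : Prop :=
  exists (c n : 'rV[R]_3) (r : R), [/\ n != 0, 0 < r &
    al = [set x | dot n (x - c) = 0 /\ dot (x - c) (x - c) = r ^+ 2]].

Definition unit_sphere (R : pzRingType) : set 'rV[R]_3 :=
  [set x | dot x x = 1].

(** Möbius transformations act on R^n together with the point [None] at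
    infinity.  Isometries and similarities are compositions of inversions in
    spheres there. *)

Notation Rinf R n := (one_point_compactification 'rV[R]_n).

Definition inversion (R : fieldType) (n : nat) (c : 'rV[R]_n) (r : R)
  (x : Rinf R n) : Rinf R n :=
  match x with
  | None => Some c
  | Some y => if y == c then None
              else Some (c + (r ^+ 2 / dot (y - c) (y - c)) *: (y - c))
  end.

Inductive mobius (R : realFieldType) (n : nat) : (Rinf R n -> Rinf R n) -> Prop :=
| mobius_inversion c r : 0 < r -> mobius (@inversion R n c r)
| mobius_comp f g : mobius f -> mobius g -> mobius (f \o g).

Definition mobius_of_subset (R : realFieldType) (n : nat)
  (S X : set (Rinf R n)) : Prop :=
  exists (N : Rinf R n -> Rinf R n) (T : set (Rinf R n)),
    [/\ mobius N, T `<=` X & S = N @` T].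

Definition planar_domain (R : realType) (U : set 'rV[R]_2) : Prop :=
  [/\ open U, connected U & U !=set0].

(** [g] is, on a neighbourhood of [w], the sum of an absolutely convergent power
    series in two variables, the terms being grouped by total degree. *)
Definition analytic_at (R : realType) (g : 'rV[R]_2 -> R) (w : 'rV[R]_2) : Prop :=
  exists (c : nat -> nat -> R) (r : R), 0 < r /\
    forall h : 'rV[R]_2, `|h| < r ->
      let t i j := c i j * h 0 0 ^+ i * h 0 1 ^+ j in
      cvgn (series (fun n => \sum_(i < n.+1) `|t i (n - i)%N|)) /\
      series (fun n => \sum_(i < n.+1) t i (n - i)%N) @ \oo --> g (w + h).

Definition analytic_surface (R : realType) (S : set 'rV[R]_3) : Prop :=
  exists (U : set 'rV[R]_2) (f : 'rV[R]_2 -> 'rV[R]_3),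
    [/\ planar_domain U, set_inj U f,
        forall w, U w -> forall k, analytic_at (fun x => f x 0 k) w,
        forall w, U w -> injective ('d f w) &
        S = f @` U].

Definition sum_set (R : pzRingType) (al be : set 'rV[R]_3) : set 'rV[R]_3 :=
  [set x | exists p q, [/\ al p, be q & x = p + q]].

(** The value 2 (p x q) / |p + q|^2 is taken to be the point at infinity when
    p + q = 0.  A Möbius transformation may send that point into R^3, and the
    surface may pass through its image, so it cannot just be left out. *)
Definition cross_quotient (R : fieldType) (p q : 'rV[R]_3) : Rinf R 3 :=
  if p + q == 0 then None
  else Some ((2 / dot (p + q) (p + q)) *: cross p q).

Definition cross_set (R : fieldType) (al be : set 'rV[R]_3) : set (Rinf R 3) :=
  [set x | exists p q, [/\ al p, be q & x = cross_quotient p q]].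

(** The degree of [Q] is one less than [mmeasure (@mdeg 4) Q], which is what
    the notation [msize Q] of mpoly stands for; the notations of mpoly clash with
    those of the analysis library.  When [Q] is a multiple of x^2 + y^2 + z^2 - t
    this set is all of R^3, which has to be excluded by hand. *)
Definition cyclide (R : comNzRingType) (Q : mpoly 4 R) : set 'rV[R]_3 :=
  [set x : 'rV[R]_3 | meval
             (fun i : 'I_4 => [:: x 0 0; x 0 1; x 0 (inord 2); dot x x]`_i) Q = 0].

(* Main.v *)
Require Import Defs.
From mathcomp Require Import all_boot all_order all_algebra.
From mathcomp Require Import all_classical all_reals all_analysis.
From mathcomp Require Import -(notations) mpoly.
From mathcomp Require Import ring lra.

Set Implicit Arguments.
Unset Strict Implicit.
Unset Printing Implicit Defensive.

Import Order.TTheory GRing.Theory Num.Theory.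
Import numFieldNormedType.Exports.

Local Open Scope classical_set_scope.
Local Open Scope ring_scope.

(** A Möbius transformation M of the quaternions is, up to conjugation, a
    fraction: the points y = M(x) of R^3 satisfy y = (a x + b) (c x + d)^-1,
    and at will the same with the conjugate of x in place of x ([mobius_imq]).
    That the surface lies in R^3 means that these values are imaginary, and
    since everything is polynomial in u and v, an open set of parameters is as
    good as the whole plane.

    As there are no zero divisors, AC being of degree at most 1 in u forces A
    or C not to involve u, and the same for v ([mul_bilinear]). If A or C is
    constant, then x or its conjugate is a right fraction N D^-1 with N and D
    bilinear in (u, v), and so is y = P1 P2^-1, with P1 orthogonal to P2
    everywhere. Send a point of the surface to infinity and translate the
    parameters so that it sits at (0, 0): the images z satisfy a relation 1 +
    u V1 + v V2 + u v V3 = 0 with V_i = b_i - z a_i. Hence the imaginary parts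
    of the V_i are linearly dependent. Their determinant is a cubic polynomial
    in z, but orthogonality gives it the form of a quadratic form in z, |z|^2
    and 1, or else leads to a simpler such form: this is (D)
    ([bilinear_fraction_cyclide]).

    Otherwise, up to exchanging u and v, x = (u + s)^-1 N(u, v) (v + t)^-1. If
    s is real, 1/(u + s) is a new real parameter that turns x into a right
    fraction; if t is real, conjugation exchanges the two factors. If neither
    is real, (u + s)^-1 and (v + t)^-1 run through circles, so that x = b + E
    p + q F + E r F with E and F on the unit circles of two complex subfields
    ([linear_quotient_bicirc]). This form is stable under x |-> al x be + ga,
    so that either y has it, or y = b1 + x^-1 where x has it
    ([bicirc_mobius]). With e = 0, respectively e = Re b1, y is imaginary if
    and only if e |x|^2 + Re x = 0.

    If r = 0 and e = 0, the surface of all x is a sum of two circles, or else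
    lies in a hyperplane: (E) or (D). If r = 0 and e <> 0, the coefficients of
    E in e |x|^2 + Re x = 0 show p and m p orthogonal to q F, so the
    projection of x to their plane runs through a circle: (D). If r <> 0, then
    x = o + (E + c) (p + r F) ([bicirc_factor]). The coefficients of E give
    two relations between T = p + r F and |T|^2. They imply a quadratic
    relation between x and |x|^2 independent of the one already known
    ([product_quadric]), hence (D), with one exception: when o is the centre
    of the sphere e |x|^2 + Re x = 0, both factors have constant norm, x - o
    is up to a factor a product P g Q with P and Q on circles of imaginary
    unit quaternions, and a stereographic projection of the products of two
    such circles is (C) ([clifford_cross_surface]).

    All surfaces (D) come from one principle ([cyclide_intro]): lift a point x
    to (|x|^2, x, 1). A quadratic form that vanishes on the lifts of the
    surface, but not on all lifts of R^3 and of infinity, gives (D); and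
    Möbius transformations act on lifts linearly. *)

(** * Quaternions as vectors of a Euclidean space *)

Notation q0 a := (@fun_of_matrix _ 1 4 a%R 0 (inord 0 : 'I_4)).
Notation q1 a := (@fun_of_matrix _ 1 4 a%R 0 (inord 1 : 'I_4)).
Notation q2 a := (@fun_of_matrix _ 1 4 a%R 0 (inord 2 : 'I_4)).
Notation q3 a := (@fun_of_matrix _ 1 4 a%R 0 (inord 3 : 'I_4)).

Section Quaternions.
Variable R : realType.
Implicit Types (a b c x y : quat R) (k : R).

Definition qdot a b : R := q0 a * q0 b + q1 a * q1 b + q2 a * q2 b + q3 a * q3 b.

Lemma qD a b (i : 'I_4) : @fun_of_matrix _ 1 4 (a + b)%R 0 i = a 0 i + b 0 i.
Proof. by rewrite mxE. Qed.
Lemma qN a (i : 'I_4) : @fun_of_matrix _ 1 4 (- a)%R 0 i = - a 0 i.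
Proof. by rewrite mxE. Qed.
Lemma qZ k a (i : 'I_4) : @fun_of_matrix _ 1 4 (k *: a)%R 0 i = k * a 0 i.
Proof. by rewrite mxE. Qed.
Lemma qO (i : 'I_4) : @fun_of_matrix _ 1 4 (0%R : quat R) 0 i = 0.
Proof. by rewrite mxE. Qed.
Lemma qM a b : ((q0 (a * b) = q0 a * q0 b - q1 a * q1 b - q2 a * q2 b - q3 a * q3 b)
  * (q1 (a * b) = q0 a * q1 b + q1 a * q0 b + q2 a * q3 b - q3 a * q2 b)
  * (q2 (a * b) = q0 a * q2 b - q1 a * q3 b + q2 a * q0 b + q3 a * q1 b)
  * (q3 (a * b) = q0 a * q3 b + q1 a * q2 b - q2 a * q1 b + q3 a * q0 b)).
Proof. by do !split; rewrite mkquatE. Qed.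
Lemma q1E : ((q0 (1%R : quat R) = 1) * (q1 (1%R : quat R) = 0)
  * (q2 (1%R : quat R) = 0) * (q3 (1%R : quat R) = 0)).
Proof. by do !split; rewrite mkquatE. Qed.
Lemma qconjE a : ((q0 (qconj a) = q0 a) * (q1 (qconj a) = - q1 a)
  * (q2 (qconj a) = - q2 a) * (q3 (qconj a) = - q3 a)).
Proof. by do !split; rewrite mkquatE. Qed.
Lemma qrealE k : ((q0 (qreal k) = k) * (q1 (qreal k) = 0)
  * (q2 (qreal k) = 0) * (q3 (qreal k) = 0)).
Proof. by do !split; rewrite mkquatE. Qed.
Lemma imqE (y : 'rV[R]_3) : ((q0 (imq y) = 0) * (q1 (imq y) = y 0 0)
  * (q2 (imq y) = y 0 1) * (q3 (imq y) = y 0 (inord 2))).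
Proof.
have e0 : (inord 0 : 'I_4) = lshift 3 (0 : 'I_1) by apply: val_inj; rewrite /= inordK.
have e1 : (inord 1 : 'I_4) = rshift 1 (0 : 'I_3) by apply: val_inj; rewrite /= inordK.
have e2 : (inord 2 : 'I_4) = rshift 1 (1 : 'I_3) by apply: val_inj; rewrite /= inordK.
have e3 : (inord 3 : 'I_4) = rshift 1 (inord 2 : 'I_3).
  by apply: val_inj; rewrite /= !inordK.
rewrite /imq e0 e1 e2 e3.
by do !split; [rewrite (@row_mxEl R 1 1 3) mxE|rewrite (@row_mxEr R 1 1 3)
  |rewrite (@row_mxEr R 1 1 3)|rewrite (@row_mxEr R 1 1 3)].
Qed.

Definition qE := (qD, qN, qZ, qO, qM, q1E, qconjE, qrealE, imqE, @mkquatE R).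

Lemma imqZ k (y : 'rV[R]_3) : imq (k *: y) = k *: imq y.
Proof.
have zE i : (k *: y) 0 i = k * y 0 i by rewrite mxE.
by apply: quatP; rewrite !qE ?zE ?mulr0.
Qed.
Lemma imqD (x y : 'rV[R]_3) : imq (x + y) = imq x + imq y.
Proof.
have DE i : (x + y) 0 i = x 0 i + y 0 i by rewrite mxE.
by apply: quatP; rewrite !qE ?DE ?addr0.
Qed.
Lemma imqN (y : 'rV[R]_3) : imq (- y) = - imq y.
Proof.
have NE i : (- y) 0 i = - y 0 i by rewrite mxE.
by apply: quatP; rewrite !qE ?NE ?oppr0.
Qed.
Lemma imq_inj : injective (@imq R).
Proof.
move=> x y e; have := imqE x; rewrite e !qE => -[[[_ e1] e2] e3].
apply/rowP => i; have -> : i = inord i by rewrite inord_val.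
have ez : (inord 0 : 'I_3) = 0 by apply: val_inj; rewrite /= inordK.
have eo : (inord 1 : 'I_3) = 1 by apply: val_inj; rewrite /= inordK.
by case: i => -[|[|[|//]]] /= _; rewrite ?ez ?eo.
Qed.
Lemma imq_surj a : q0 a = 0 -> exists y : 'rV[R]_3, a = imq y.
Proof.
move=> Y0; exists (\row_(i < 3) nth 0 [:: q1 a; q2 a; q3 a] i).
by apply: quatP; rewrite !qE // !mxE //= inordK.
Qed.

Lemma dot3E (x y : 'rV[R]_3) :
  dot x y = x 0 0 * y 0 0 + x 0 1 * y 0 1 + x 0 (inord 2) * y 0 (inord 2).
Proof.
rewrite /dot !big_ord_recr big_ord0 /= add0r.
congr (_ + _ + _); congr (x 0 _ * y 0 _); apply: val_inj => //=; by rewrite inordK.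
Qed.

Lemma dot4E (x y : 'rV[R]_4) : dot x y = qdot x y.
Proof.
rewrite /dot !big_ord_recr big_ord0 /= add0r /qdot.
by congr (_ + _ + _ + _); congr (x 0 _ * y 0 _); apply: val_inj; rewrite /= inordK.
Qed.

Lemma qdot_imq (x y : 'rV[R]_3) : qdot (imq x) (imq y) = dot x y.
Proof. by rewrite /qdot !qE dot3E; ring. Qed.

Lemma qnormsq_dot a : qnormsq a = qdot a a.
Proof. by rewrite qnormsqE /qdot; ring. Qed.

Lemma qdot_eq0 a : (qdot a a == 0) = (a == 0).
Proof. by rewrite -qnormsq_dot qnormsq_eq0. Qed.

Lemma qdot_gt0 a : a != 0 -> 0 < qdot a a.
Proof.
rewrite -qdot_eq0 => h; rewrite lt_def h /qdot -!expr2.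
by rewrite !addr_ge0 ?sqr_ge0.
Qed.

Lemma qnormsqM a b : qnormsq (a * b) = qnormsq a * qnormsq b.
Proof. by rewrite !qnormsqE !qE; ring. Qed.

Lemma qconjM a b : qconj (a * b) = qconj b * qconj a.
Proof. by apply: quatP; rewrite !qE; ring. Qed.
Lemma qconjK a : qconj (qconj a) = a.
Proof. by apply: quatP; rewrite !qE; ring. Qed.
Lemma qnormsq_conj a : qnormsq (qconj a) = qnormsq a.
Proof. by rewrite !qnormsqE !qE; ring. Qed.

Lemma qinvE a : a^-1 = (qnormsq a)^-1 *: qconj a.
Proof. by []. Qed.

Lemma qmulV a : a != 0 -> a * a^-1 = 1.
Proof. exact: qmulqV. Qed.
Lemma qVmul a : a != 0 -> a^-1 * a = 1.
Proof. exact: qmulVq. Qed.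

Lemma qmul_eq0 a b : (a * b == 0) = (a == 0) || (b == 0).
Proof. by rewrite -!qnormsq_eq0 qnormsqM mulf_eq0. Qed.

Lemma qinv_eq0 a : (a^-1 == 0) = (a == 0).
Proof.
apply/eqP/eqP => [h|->]; last by rewrite qinvE -[X in X^-1]/(qnormsq 0) qnormsq_dot /qdot !qE !mul0r !addr0 invr0 scale0r.
apply/eqP; apply: contraT => a0; move: (qmulV a0).
by rewrite h mulr0 => /eqP; rewrite eq_sym oner_eq0.
Qed.

Lemma qinv_uniq a b : a * b = 1 -> a^-1 = b.
Proof.
move=> ab; have a0 : a != 0.
  by apply/eqP => a0; move/eqP: ab; rewrite a0 mul0r eq_sym oner_eq0.
by rewrite -[LHS]mulr1 -ab mulrA qVmul // mul1r.
Qed.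

Lemma qinvM a b : a != 0 -> b != 0 -> (a * b)^-1 = b^-1 * a^-1.
Proof.
by move=> a0 b0; apply: qinv_uniq; rewrite mulrA -[a * b * _]mulrA qmulV // mulr1 qmulV.
Qed.
Lemma qscaleAl k a b : (k *: a) * b = k *: (a * b).
Proof. by apply: quatP; rewrite !qE; ring. Qed.
Lemma qscaleAr k a b : a * (k *: b) = k *: (a * b).
Proof. by apply: quatP; rewrite !qE; ring. Qed.
Lemma qmul_conj a : a * qconj a = qreal (qdot a a).
Proof. by apply: quatP; rewrite /qdot !qE; ring. Qed.
Lemma qmul_real a (k : R) : a * qreal k = k *: a.
Proof. by apply: quatP; rewrite !qE; ring. Qed.
Lemma qreal_mul a (k : R) : qreal k * a = k *: a.
Proof. by apply: quatP; rewrite !qE; ring. Qed.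
Lemma qconj_im a : q0 a = 0 -> qconj a = - a.
Proof. by move=> a0; apply: quatP; rewrite !qE ?a0 ?oppr0. Qed.
Lemma qdotC a b : qdot a b = qdot b a.
Proof. by rewrite /qdot; ring. Qed.
Lemma q0_cycle a b : q0 (a * b) = q0 (b * a).
Proof. by rewrite !qE; ring. Qed.
Lemma qdot_unitM a b : qdot a a = 1 -> qdot b b = 1 -> qdot (a * b) (a * b) = 1.
Proof. by move=> ha hb; rewrite -qnormsq_dot qnormsqM !qnormsq_dot ha hb mul1r. Qed.
Lemma qdotDl a b c : qdot (a + b) c = qdot a c + qdot b c.
Proof. by rewrite /qdot !qE; ring. Qed.
Lemma qdotDr a b c : qdot c (a + b) = qdot c a + qdot c b.
Proof. by rewrite /qdot !qE; ring. Qed.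
Lemma qdotZl k a b : qdot (k *: a) b = k * qdot a b.
Proof. by rewrite /qdot !qE; ring. Qed.
Lemma qdotZr k a b : qdot a (k *: b) = k * qdot a b.
Proof. by rewrite /qdot !qE; ring. Qed.
Lemma qconj_shift k a : qconj (qreal k + a) = qreal k + qconj a.
Proof. by apply: quatP; rewrite !qE; ring. Qed.
Lemma qconj0 : qconj 0 = 0 :> quat R.
Proof. by apply: quatP; rewrite !qE ?oppr0. Qed.
Lemma qconjV a : a != 0 -> qconj a^-1 = (qconj a)^-1.
Proof.
move=> an; symmetry; apply: qinv_uniq; rewrite -qconjM qVmul //.
by apply: quatP; rewrite !qE ?oppr0.
Qed.
Lemma axis_points : [/\ (1 : R) ^+ 2 + 0 ^+ 2 = 1, (-1 : R) ^+ 2 + 0 ^+ 2 = 1,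
  (0 : R) ^+ 2 + 1 ^+ 2 = 1 & (0 : R) ^+ 2 + (-1) ^+ 2 = 1].
Proof. by split; ring. Qed.
End Quaternions.

(** * Quadrics through lifts to the light cone *)

Section Quadrics.
Variable R : realType.

Definition lifted : Type := (R * quat R * R)%type.
Definition qlift (x : quat R) : lifted := (qnormsq x, x, 1).
(** The cone T W = |Y|^2; up to scaling its nonzero points are the lifts of
    points of H and of infinity, (1, 0, 0). *)
Definition null_lift (v : lifted) : Prop := v.1.1 * v.2 = qnormsq v.1.2.

Definition ladd (v w : lifted) : lifted :=
  (v.1.1 + w.1.1, v.1.2 + w.1.2, v.2 + w.2).
Definition lscale (k : R) (v : lifted) : lifted :=
  (k * v.1.1, k *: v.1.2, k * v.2).

Definition lin_form (f : lifted -> R) : Prop :=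
  (forall v w, f (ladd v w) = f v + f w) /\ (forall k v, f (lscale k v) = k * f v).
Definition lin_map (L : lifted -> lifted) : Prop :=
  (forall v w, L (ladd v w) = ladd (L v) (L w)) /\
  (forall k v, L (lscale k v) = lscale k (L v)).

(** Quadratic forms are generated from products of linear ones rather than
    given by matrices: every form below arises as a short sum of products. *)
Inductive quad_form : (lifted -> R) -> Prop :=
| quad_mul f g : lin_form f -> lin_form g -> quad_form (fun v => f v * g v)
| quad_add F G : quad_form F -> quad_form G -> quad_form (fun v => F v + G v).

Lemma quad_ext F G : quad_form G -> F =1 G -> quad_form F.
Proof. by move=> qG /funext ->. Qed.

Lemma quad_comp L F : lin_map L -> quad_form F -> quad_form (F \o L).
Proof.
move=> [LD LZ]; elim=> [f g [fD fZ] [gD gZ]|F1 F2 _ h1 _ h2].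
  by apply: (@quad_mul (f \o L) (g \o L)); split=> *; rewrite /= ?LD ?LZ // ?fD ?gD ?fZ ?gZ.
exact: (@quad_add (F1 \o L) (F2 \o L)).
Qed.

Lemma quad_opp F : quad_form F -> quad_form (fun v => - F v).
Proof.
elim=> [f g [fD fZ] fg|F1 F2 _ h1 _ h2].
  apply: (@quad_ext _ (fun v => (- f v) * g v)) => [|v]; last by rewrite mulNr.
  by apply: quad_mul => //; split=> *; rewrite ?fD ?fZ ?opprD ?mulrN.
by apply: quad_ext (quad_add h1 h2) _ => v; rewrite opprD.
Qed.

Lemma quad_sub F G : quad_form F -> quad_form G -> quad_form (fun v => F v - G v).
Proof. by move=> qF qG; apply: quad_add => //; exact: quad_opp. Qed.

Lemma quad_scale F k v : quad_form F -> F (lscale k v) = k ^+ 2 * F v.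
Proof.
elim=> [f g [_ fZ] [_ gZ]|F1 F2 _ h1 _ h2]; last by rewrite h1 h2 mulrDr.
by rewrite fZ gZ; ring.
Qed.

Definition lcoord (k : R) (a : quat R) (h : R) (v : lifted) : R :=
  k * v.1.1 + qdot a v.1.2 + h * v.2.

Lemma lin_lcoord k a h : lin_form (lcoord k a h).
Proof.
by split=> [[[T Y] W] [[T' Y'] W']|c [[T Y] W]];
  rewrite /lcoord /qdot /= !qE; ring.
Qed.

Lemma lin_lcoordE f : lin_form f -> exists k a h, f = lcoord k a h.
Proof.
move=> [fD fZ].
pose u i : lifted := (0, mkquat 0 (i == 0%N)%:R (i == 1%N)%:R (i == 2%N)%:R (i == 3%N)%:R, 0).
exists (f (1, 0, 0)), (mkquat 0 (f (u 0%N)) (f (u 1%N)) (f (u 2%N)) (f (u 3%N))), (f (0, 0, 1)).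
apply/funext => -[[T Y] W]; rewrite /lcoord /qdot /= !qE.
have -> : ((T, Y, W) : lifted) = ladd (lscale T (1, 0, 0)) (ladd (ladd (ladd (ladd
   (lscale (q0 Y) (u 0%N)) (lscale (q1 Y) (u 1%N))) (lscale (q2 Y) (u 2%N)))
   (lscale (q3 Y) (u 3%N))) (lscale W (0, 0, 1))).
  rewrite /ladd /lscale /=; congr (_, _, _); first by ring.
    by apply: quatP; rewrite !qE; ring.
  by ring.
by rewrite !fD !fZ; ring.
Qed.

Definition cyclide_surface (S : set 'rV[R]_3) : Prop := exists Q : mpoly 4 R,
     [/\ mmeasure (@mdeg 4) Q = 2%N \/ mmeasure (@mdeg 4) Q = 3%N,
         cyclide Q <> [set: 'rV[R]_3] &
         mobius_of_subset (Some @` S) (Some @` cyclide Q)].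

Definition cyc_env (y : 'rV[R]_3) (i : 'I_4) : R :=
  [:: y 0 0; y 0 1; y 0 (inord 2); dot y y]`_i.

Lemma lin_mpoly f : lin_form f -> exists Q : mpoly 4 R,
  (mmeasure (@mdeg 4) Q <= 2)%N /\
  forall y, meval (cyc_env y) Q = f (qlift (imq y)).
Proof.
move=> /lin_lcoordE[k [a [h ->]]].
pose X j : mpoly 4 R := mpolyX R (mnm1 (inord j : 'I_4)).
pose P := q1 a *: X 0%N + q2 a *: X 1%N + q3 a *: X 2%N + k *: X 3%N + mpolyC 4 h.
have Xle (c : R) j : (mmeasure (@mdeg 4) (c *: X j) <= 2)%N.
  by apply: leq_trans (msizeZ_le _ _) _; rewrite msizeX mdeg1.
have Dle (p q : mpoly 4 R) : (mmeasure (@mdeg 4) p <= 2)%N ->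
    (mmeasure (@mdeg 4) q <= 2)%N -> (mmeasure (@mdeg 4) (p + q) <= 2)%N.
  by move=> hp hq; apply: leq_trans (msizeD_le _ _) _; rewrite geq_max hp.
exists P; split.
  rewrite /P; apply: (Dle); last by rewrite msizeC; case: (h != 0).
  by do 3![apply: (Dle) => //].
move=> y; rewrite !mevalD !mevalZ !mevalXU mevalC /cyc_env !inordK //=.
by rewrite /lcoord /qlift /= qnormsq_dot qdot_imq /qdot !qE; ring.
Qed.

Lemma quad_mpoly F : quad_form F -> exists Q : mpoly 4 R,
  (mmeasure (@mdeg 4) Q <= 3)%N /\
  forall y, meval (cyc_env y) Q = F (qlift (imq y)).
Proof.
elim=> [f g /lin_mpoly[P [hP eP]] /lin_mpoly[Q [hQ eQ]]|F1 F2 _ [P [hP eP]] _ [Q [hQ eQ]]].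
  exists (P * Q); split=> [|y]; last by rewrite mevalM eP eQ.
  have [->|P0] := eqVneq P 0; first by rewrite mul0r msize0.
  have [->|Q0] := eqVneq Q 0; first by rewrite mulr0 msize0.
  rewrite msizeM // -subn1 leq_subLR; exact: (leq_add hP hQ).
exists (P + Q); split=> [|y]; last by rewrite mevalD eP eQ.
by apply: leq_trans (msizeD_le _ _) _; rewrite geq_max hP.
Qed.

Lemma dot3_eq0 (x : 'rV[R]_3) : dot x x = 0 -> x = 0.
Proof.
rewrite -qdot_imq => /eqP; rewrite qdot_eq0 => /eqP h.
have i0 : imq (0 : 'rV[R]_3) = 0 by apply: quatP; rewrite !qE ?mxE.
by apply: imq_inj; rewrite h i0.
Qed.

(** Two concentric inversions compose to a homothety. *)
Lemma inversion2 (c : 'rV[R]_3) (r r' : R) (x : Rinf R 3) : r' != 0 -> r != 0 ->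
  inversion c r (inversion c r' x) = omap (fun z => c + (r ^+ 2 / r' ^+ 2) *: (z - c)) x.
Proof.
move=> r0' r0; case: x => [x|] /=; last by rewrite eqxx.
have [->|xc] := eqVneq x c; first by rewrite /= subrr scaler0 addr0.
have d0 : dot (x - c) (x - c) != 0.
  by apply: contra_neq xc => /dot3_eq0 /eqP; rewrite subr_eq0 => /eqP.
set k := r' ^+ 2 / _.
have k0 : k != 0 by rewrite mulf_neq0 ?invr_eq0 // expf_neq0.
have ew : c + k *: (x - c) - c = k *: (x - c) by rewrite addrC addKr.
rewrite /= -subr_eq0 ew scaler_eq0 (negbTE k0) subr_eq0 (negbTE xc) /=.
have dZ (a : R) (w : 'rV[R]_3) : dot (a *: w) (a *: w) = a ^+ 2 * dot w w.
  by rewrite /dot mulr_sumr; apply: eq_bigr => i _; rewrite !mxE; ring.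
rewrite dZ scalerA; congr (Some (_ + _ *: _)).
by rewrite /k; field; rewrite d0 r0'.
Qed.

Lemma mobius_id3 : mobius (@id (Rinf R 3)).
Proof.
have n1 : (1 : R) != 0 by rewrite oner_neq0.
have -> : @id (Rinf R 3) = @inversion R 3 0 1 \o @inversion R 3 0 1.
  apply/funext => x; rewrite /= inversion2 // expr1n divr1.
  by case: x => //= x; rewrite scale1r subr0 add0r.
by apply: mobius_comp; apply: mobius_inversion.
Qed.

Lemma mobius_of_subset_intro (S : set 'rV[R]_3) (X : set (Rinf R 3)) N :
  mobius N -> (forall y, S y -> exists2 z, X z & N z = Some y) ->
  mobius_of_subset (Some @` S) X.
Proof.
move=> mN h; exists N, (X `&` [set z | exists2 y, S y & N z = Some y]).
split; [exact: mN|by move=> z []|apply/seteqP].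
split=> [_ [y Sy <-]|_ [z [Xz [y Sy ->]] <-]].
  by have [z Xz e] := h _ Sy; exists z => //; split=> //; exists y.
by exists y.
Qed.

(** Along the curve (T, s Y, s^2), which joins lifts of finite points to that
    of infinity, a quadratic form is polynomial in s. *)
Lemma quad_poly F (Y : quat R) (T : R) : quad_form F ->
  exists p : {poly R}, forall s, p.[s] = F (T, s *: Y, s ^+ 2).
Proof.
elim=> [f g /lin_lcoordE[k [a [h ->]]] /lin_lcoordE[k' [a' [h' ->]]]|F1 F2 _ [p ep] _ [q eq]].
  exists (((k * T)%:P + qdot a Y *: 'X + h *: 'X^2) *
          ((k' * T)%:P + qdot a' Y *: 'X + h' *: 'X^2)) => s.
  by rewrite !hornerE /lcoord /qdot /= !qE; ring.
by exists (p + q) => s; rewrite hornerD ep eq.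
Qed.

Lemma poly_zero_off (p : {poly R}) : (forall s, s != 0 -> p.[s] = 0) -> p = 0.
Proof.
move=> h; apply/eqP; apply: contraT => p0.
pose s := [seq (i.+1%:R : R) | i <- iota 0 (size p)].
have := @max_poly_roots R p s p0; rewrite size_map size_iota ltnn.
apply; last by rewrite map_inj_uniq ?iota_uniq // => i j /eqP; rewrite eqr_nat => /eqP [].
by apply/allP => _ /mapP[i _ ->]; rewrite /root h // pnatr_eq0.
Qed.

(** Non-vanishing at a single null vector is enough: were the form zero on all
    lifts of R^3, it would also vanish at infinity, by continuity along the
    curves of [quad_poly]. As the surface is not empty, the polynomial is then
    not constant either. *)
Lemma cyclide_intro (S : set 'rV[R]_3) F : quad_form F -> S !=set0 ->
  (forall y, S y -> F (qlift (imq y)) = 0) ->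
  (exists v, [/\ q0 v.1.2 = 0, null_lift v & F v != 0]) -> cyclide_surface S.
Proof.
move=> qF [y0 Sy0] FS [[[T Y] W] [/= Y0 nv Fv]].
have [y1 Fy1] : exists y, F (qlift (imq y)) != 0.
  apply: contrapT => hF.
  have {}hF y : F (qlift (imq y)) = 0.
    by apply/eqP; apply: contraT => hy; case: hF; exists y.
  have [W0|W0] := eqVneq W 0; last first.
    have [y Ey] : exists y, W^-1 *: Y = imq y.
      by apply: imq_surj; rewrite !qE Y0 mulr0.
    move/negP: Fv; apply; apply/eqP.
    have -> : (T, Y, W) = lscale W (qlift (imq y)).
      rewrite /lscale /qlift /= -Ey; congr (_, _, _).
      - move: nv; rewrite /null_lift /= => nv.
        have -> : T = qnormsq Y / W by rewrite -nv mulfK.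
        by rewrite !qnormsqE !qE; field.
      - by rewrite scalerA mulfV // scale1r.
      - by rewrite mulr1.
    by rewrite quad_scale // hF mulr0.
  move: nv; rewrite /null_lift /= W0 mulr0 => /esym/eqP; rewrite qnormsq_eq0 => /eqP Y00.
  have [e ee] : exists e : 'rV[R]_3, mkquat 0 0 1 0 0 = imq e.
    by apply: imq_surj; rewrite !qE.
  have ne : qnormsq (imq e) = 1 by rewrite -ee qnormsqE !qE; ring.
  have [p ep] := quad_poly (imq e) 1 qF.
  have p0 : p = 0.
    apply: poly_zero_off => s s0; rewrite ep.
    have -> : (1, s *: imq e, s ^+ 2) = lscale (s ^+ 2) (qlift (imq (s^-1 *: e))).
      have -> : imq (s^-1 *: e) = s^-1 *: imq e by rewrite imqZ.
      rewrite /lscale /qlift /=; congr (_, _, _).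
      - move: ne; rewrite !qnormsqE !qE => ne.
        by rewrite -[LHS]ne; field.
      - by rewrite scalerA; congr (_ *: _); field.
      - by rewrite mulr1.
    by rewrite quad_scale // hF mulr0.
  move/negP: Fv; apply; apply/eqP.
  have -> : (T, Y, W) = lscale T (1, 0 *: imq e, 0 ^+ 2).
    by rewrite /lscale /= scale0r scaler0 Y00 W0 mulr1 expr0n /= mulr0.
  by rewrite quad_scale // -ep p0 horner0 mulr0.
have [Q [hQ eQ]] := quad_mpoly qF.
exists Q; split.
- have : (1 < mmeasure (@mdeg 4) Q)%N.
    rewrite ltnNge; apply/negP => /msize1_polyC EQ.
    move: (eQ y0) (eQ y1); rewrite EQ !mevalC => ->; rewrite FS // => e.
    by rewrite -e eqxx in Fy1.
  by case: (mmeasure _ _) hQ => [|[|[|[|]]]] //; [left|right].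
- move=> /seteqP[_ /(_ y1 I)]; rewrite /cyclide /= -/(cyc_env y1) eQ => /eqP.
  by rewrite (negbTE Fy1).
- apply: mobius_of_subset_intro mobius_id3 _ => y Sy; exists (Some y) => //.
  by exists y => //; rewrite /cyclide /= -/(cyc_env y) eQ FS.
Qed.
End Quadrics.

(** * Bilinear families over a point sent to infinity *)

Section CircleFamilies.
Variable R : realType.
Implicit Types (a b c x y z n t d Y : quat R).

(** The determinant of the imaginary parts. *)
Definition det3 a b c : R :=
  q1 a * (q2 b * q3 c - q3 b * q2 c) - q2 a * (q1 b * q3 c - q3 b * q1 c)
  + q3 a * (q1 b * q2 c - q2 b * q1 c).
Definition im a : quat R := mkquat 0 0 (q1 a) (q2 a) (q3 a).
(** The cross product of the imaginary parts. *)
Definition qcross a b : quat R := im (im a * im b).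

Lemma imE a : (q0 (im a) = 0) * (q1 (im a) = q1 a) * (q2 (im a) = q2 a) * (q3 (im a) = q3 a).
Proof. by do !split; rewrite mkquatE. Qed.

Lemma qcrossE a b : (q0 (qcross a b) = 0) * (q1 (qcross a b) = q2 a * q3 b - q3 a * q2 b)
  * (q2 (qcross a b) = q3 a * q1 b - q1 a * q3 b)
  * (q3 (qcross a b) = q1 a * q2 b - q2 a * q1 b).
Proof. by rewrite /qcross; do !split; rewrite !imE ?qM ?imE; ring. Qed.
Definition qX := (@qE R, imE, qcrossE).

(** Three linear equations in four unknowns. *)
Lemma perp_exists a b c : exists v : quat R,
  [/\ v != 0, qdot v a = 0, qdot v b = 0 & qdot v c = 0].
Proof.
pose M : 'M[R]_(4, 3) := \matrix_(i < 4, j < 3) @fun_of_matrix _ 1 4 (nth 0 [:: a; b; c] j) 0 i.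
have : kermx M != 0.
  rewrite -mxrank_eq0 mxrank_ker subn_eq0 -ltnNge.
  exact: (leq_ltn_trans (rank_leq_col M)).
move=> /rowV0Pn[v /sub_kermxP vM v0]; exists v.
have h (j : 'I_3) : qdot v (nth 0 [:: a; b; c] j) = 0.
  have := congr1 (fun N : 'M[R]_(1, 3) => N 0 j) vM; rewrite !mxE => <-.
  by rewrite -dot4E /dot; apply: eq_bigr => i _; rewrite !mxE.
have h0 := h (inord 0); have h1 := h (inord 1); have h2 := h (inord 2).
by rewrite !inordK in h0 h1 h2.
Qed.

Lemma det3Zl k a b c : det3 (k *: a) b c = k * det3 a b c.
Proof. by rewrite /det3 !qE; ring. Qed.
Lemma det3ZZ k a b c : det3 a (k *: b) (k *: c) = k ^+ 2 * det3 a b c.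
Proof. by rewrite /det3 !qE; ring. Qed.
Lemma det3_sub a1 a2 a3 b1 b2 b3 : det3 (b1 - a1) (b2 - a2) (b3 - a3) =
  det3 b1 b2 b3 - (det3 a1 b2 b3 + det3 a2 b3 b1 + det3 a3 b1 b2)
  + (det3 b1 a2 a3 + det3 b2 a3 a1 + det3 b3 a1 a2) - det3 a1 a2 a3.
Proof. by rewrite /det3 !qE; ring. Qed.
(** For imaginary z, a1, a2 the cubic part of the determinant is |z|^2 times a
    linear form, and it vanishes with Re a3. *)
Lemma det3_mul z a1 a2 a3 : q0 z = 0 -> q0 a1 = 0 -> q0 a2 = 0 ->
  det3 (z * a1) (z * a2) (z * a3) = qdot z z * (q0 a3 * det3 z a1 a2).
Proof. by move=> z0 a10 a20; rewrite /det3 /qdot !qE z0 a10 a20; ring. Qed.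

(** The quadratic part of the cubic determinant below takes such values, which
    shows it to be nonzero. *)
Lemma mixed_det Y b a c : q0 Y = 0 -> q0 a = 0 -> qdot Y b = 0 ->
  q0 c * (qdot b a * qdot Y Y) = det3 b (Y * a) (Y * c).
Proof.
move=> Y0 a0 h; have {}h : q1 b * q1 Y + q2 b * q2 Y + q3 b * q3 Y = 0.
  by rewrite -h /qdot Y0; ring.
apply/eqP; rewrite -subr_eq0; apply/eqP.
pose g : R := det3 Y a c - q0 c * (q1 Y * q1 a + q2 Y * q2 a + q3 Y * q3 a).
transitivity (- g * (q1 b * q1 Y + q2 b * q2 Y + q3 b * q3 Y)); last by rewrite h mulr0.
by rewrite /g /det3 /qdot !qE Y0 a0; ring.
Qed.

Definition bl (a0 a1 a2 a3 : quat R) (u v : R) : quat R :=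
  a0 + u *: a1 + v *: a2 + (u * v) *: a3.

Lemma bl_mull y x0 x1 x2 x3 (u v : R) :
  y * bl x0 x1 x2 x3 u v = bl (y * x0) (y * x1) (y * x2) (y * x3) u v.
Proof. by rewrite /bl !mulrDr !qscaleAr. Qed.
Lemma bl_mulr y x0 x1 x2 x3 (u v : R) :
  bl x0 x1 x2 x3 u v * y = bl (x0 * y) (x1 * y) (x2 * y) (x3 * y) u v.
Proof. by rewrite /bl !mulrDl !qscaleAl. Qed.
Lemma bl_sub y0 y1 y2 y3 x0 x1 x2 x3 (u v : R) :
  bl y0 y1 y2 y3 u v - bl x0 x1 x2 x3 u v = bl (y0 - x0) (y1 - x1) (y2 - x2) (y3 - x3) u v.
Proof. by rewrite /bl; apply: quatP; rewrite !qE; ring. Qed.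
Lemma bl_add y0 y1 y2 y3 x0 x1 x2 x3 (u v : R) :
  bl y0 y1 y2 y3 u v + bl x0 x1 x2 x3 u v = bl (y0 + x0) (y1 + x1) (y2 + x2) (y3 + x3) u v.
Proof. by rewrite /bl; apply: quatP; rewrite !qE; ring. Qed.

(** The imaginary parts of V1, V2, V3 are dependent with coefficients u, v, u
    v. *)
Lemma det3_dependent (u v : R) V1 V2 V3 : bl 1 V1 V2 V3 u v = 0 ->
  u * det3 V1 V2 V3 = 0 /\ v * det3 V1 V2 V3 = 0.
Proof.
move=> S.
have S1 := congr1 (fun x : quat R => q1 x) S.
have S2 := congr1 (fun x : quat R => q2 x) S.
have S3 := congr1 (fun x : quat R => q3 x) S.
move: S1 S2 S3; rewrite /bl !qE !add0r => S1 S2 S3; split.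
- transitivity (det3 (u *: V1 + v *: V2 + (u * v) *: V3) V2 V3).
    by rewrite /det3 !qE; ring.
  by rewrite /det3 !qE S1 S2 S3; ring.
- transitivity (det3 V1 (u *: V1 + v *: V2 + (u * v) *: V3) V3).
    by rewrite /det3 !qE; ring.
  by rewrite /det3 !qE S1 S2 S3; ring.
Qed.

(** Z is the image of a surface under the inversion z = (y - y0)^-1, where y0
    is one of its points. As y0 itself goes to infinity, the form has to
    vanish at (T, 0, 0), the lift of infinity. *)
Definition inverted_cyclide (Z : quat R -> Prop) : Prop := exists F : lifted R -> R,
  [/\ quad_form F, forall T, F (T, 0, 0) = 0,
     exists v, [/\ q0 v.1.2 = 0, null_lift v & F v != 0] &
     forall z, q0 z = 0 -> Z z -> F (qlift z) = 0].

Lemma inverted_cyclide_intro F Z : quad_form F -> (forall T, F (T, 0, 0) = 0) ->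
  ((forall Y, q0 Y = 0 -> F (qnormsq Y, Y, 1) = 0) -> False) ->
  (forall z, q0 z = 0 -> Z z -> F (qlift z) = 0) -> inverted_cyclide Z.
Proof.
move=> qF F0 Fn FZ; exists F; split=> //; apply: contrapT => h; apply: Fn => Y Y0.
apply/eqP; apply: contraT => FY; case: h; exists (qnormsq Y, Y, 1); split=> //.
by rewrite /null_lift /= mulr1.
Qed.

(** After y0 is sent to infinity, the denominator vanishes at (0, 0) and the
    numerator can be normalised to 1 there, whence the constant terms 0 and 1. *)
Definition bl_values a1 a2 a3 b1 b2 b3 (z : quat R) : Prop := exists u v : R,
  bl 0 a1 a2 a3 u v != 0 /\ z * bl 0 a1 a2 a3 u v = bl 1 b1 b2 b3 u v.

End CircleFamilies.

Ltac lin_tac := split=> [[[? ?] ?] [[? ?] ?]|? [[? ?] ?]];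
  rewrite /det3 /qdot /=; (try rewrite !qX); ring.

Section LinearForms.
Variable R : realType.
Implicit Types (a b c x y z n t d Y : quat R).

Lemma lin_T : lin_form (fun v : lifted R => v.1.1). Proof. by split. Qed.
Lemma lin_W : lin_form (fun v : lifted R => v.2). Proof. by split. Qed.

Lemma lin_add f g : lin_form f -> lin_form g -> lin_form (fun v : lifted R => f v + g v).
Proof.
by move=> [fD fZ] [gD gZ]; split=> *; rewrite ?fD ?gD ?fZ ?gZ; ring.
Qed.
Lemma lin_det3 a b c : lin_form (fun v : lifted R => det3 (v.1.2 * a) b c).
Proof. lin_tac. Qed.

(** Expanding the determinant in 2 by 2 minors exhibits the products of linear
    forms. *)
Lemma quad_det3 b a c : quad_form (fun v : lifted R => det3 b (v.1.2 * a) (v.1.2 * c)).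
Proof.
pose f i v := @fun_of_matrix R 1 4 ((v : lifted R).1.2 * a) 0 (inord i).
pose g i v := @fun_of_matrix R 1 4 ((v : lifted R).1.2 * c) 0 (inord i).
have lf : forall k, [/\ lin_form (fun v => k * f 1%N v), lin_form (fun v => k * f 2%N v)
    & lin_form (fun v => k * f 3%N v)] by move=> k; rewrite /f; split; lin_tac.
have lg : [/\ lin_form (g 1%N), lin_form (g 2%N) & lin_form (g 3%N)].
  by rewrite /g; split; lin_tac.
have [lg1 lg2 lg3] := lg.
apply: (@quad_ext _ _ (fun v => ((q1 b * f 2%N v) * g 3%N v - (q1 b * f 3%N v) * g 2%N v)
  + (((- q2 b) * f 1%N v) * g 3%N v - ((- q2 b) * f 3%N v) * g 1%N v)
  + ((q3 b * f 1%N v) * g 2%N v - (q3 b * f 2%N v) * g 1%N v))); last first.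
  by move=> v; rewrite /det3 /f /g; ring.
by do !apply: quad_add; try (apply: quad_opp); apply: quad_mul => //;
  first [by have [] := lf (q1 b)|by have [] := lf (- q2 b)|by have [] := lf (q3 b)].
Qed.

(** The form is det(b_i - z a_i) itself, with |z|^2 substituted in its cubic
    part -(Re a3) |z|^2 det(z, a1, a2). It vanishes by [det3_dependent]. If it
    were zero identically, a1 and a2 would be parallel; the orthogonality
    relations then force one of them to be 0, and [mixed_det] contradicts Re
    a3 <> 0. *)
Lemma inverted_cyclide_skew a1 a2 a3 b1 b2 b3 : q0 a1 = 0 -> q0 a2 = 0 -> q0 a3 != 0 ->
  qdot b1 a1 = 0 -> qdot b2 a2 = 0 ->
  q0 a3 + qdot b1 a2 + qdot b2 a1 = 0 ->
  inverted_cyclide (bl_values a1 a2 a3 b1 b2 b3).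
Proof.
move=> a10 a20 l0 h11 h22 h12; set l := q0 a3 in l0 *.
pose F2 Y := det3 b1 (Y * a2) (Y * a3) + det3 b2 (Y * a3) (Y * a1)
   + det3 b3 (Y * a1) (Y * a2).
pose F1 Y := det3 (Y * a1) b2 b3 + det3 (Y * a2) b3 b1 + det3 (Y * a3) b1 b2.
pose F (v : lifted R) : R := F2 v.1.2 - v.1.1 * (l * det3 v.1.2 a1 a2)
   - v.2 * F1 v.1.2 + v.2 * (v.2 * det3 b1 b2 b3).
apply: (@inverted_cyclide_intro _ F).
- rewrite /F; apply: quad_add.
    apply: quad_sub; first apply: quad_sub.
    + by rewrite /F2; apply: quad_add; [apply: quad_add|]; exact: quad_det3.
    + by apply: quad_mul; [exact: lin_T|lin_tac].
    + apply: quad_mul; [exact: lin_W|].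
      by rewrite /F1; apply: lin_add; [apply: lin_add|]; exact: lin_det3.
  by apply: quad_mul; [exact: lin_W|lin_tac].
- move=> T; rewrite /F /F1 /F2 /= !mul0r /det3. rewrite !qE; ring.
- move=> FY.
  have c3 Y : q0 Y = 0 -> qdot Y Y * (l * det3 Y a1 a2) = 0 /\ F2 Y = 0.
    move=> Y0.
    have E s : s ^+ 2 * F2 Y - s ^+ 3 * (qdot Y Y * (l * det3 Y a1 a2)) - s * F1 Y
        + det3 b1 b2 b3 = 0.
      rewrite -(FY (s *: Y)); last by rewrite !qE Y0 mulr0.
      rewrite /F /= qnormsq_dot /F1 /F2 !qscaleAl !det3Zl !det3ZZ.
      have -> : qdot (s *: Y) (s *: Y) = s ^+ 2 * qdot Y Y by rewrite /qdot !qE; ring.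
      by move: (det3 _ _ _) (det3 _ _ _) (det3 _ _ _) (det3 _ _ _) (det3 _ _ _)
        (det3 _ _ _) (det3 _ _ _) (det3 _ _ _) => *; ring.
    (* a cubic polynomial in s vanishing at five points is zero *)
    by move: (E 0) (E 1) (E (-1)) (E 2) (E (-2)); lra.
  have dz Y : q0 Y = 0 -> Y != 0 -> det3 Y a1 a2 = 0.
    move=> Y0 Yn; have [/eqP + _] := c3 _ Y0.
    by rewrite !mulf_eq0 qdot_eq0 (negbTE Yn) (negbTE l0) /= => /eqP.
  have d1 : det3 (mkquat 0 0 1 0 0) a1 a2 = 0.
    by apply: dz; rewrite ?qE // -qdot_eq0 /qdot !qE ?mul0r ?mulr1 ?addr0 ?add0r oner_eq0.
  have d2 : det3 (mkquat 0 0 0 1 0) a1 a2 = 0.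
    by apply: dz; rewrite ?qE // -qdot_eq0 /qdot !qE ?mul0r ?mulr1 ?addr0 ?add0r oner_eq0.
  have d3 : det3 (mkquat 0 0 0 0 1) a1 a2 = 0.
    by apply: dz; rewrite ?qE // -qdot_eq0 /qdot !qE ?mul0r ?mulr1 ?addr0 ?add0r oner_eq0.
  have e1 : q2 a1 * q3 a2 - q3 a1 * q2 a2 = 0 by rewrite -d1 /det3 !qE; ring.
  have e2 : q1 a1 * q3 a2 - q3 a1 * q1 a2 = 0.
    by apply: oppr_inj; rewrite oppr0 -d2 /det3 !qE; ring.
  have e3 : q1 a1 * q2 a2 - q2 a1 * q1 a2 = 0 by rewrite -d3 /det3 !qE; ring.
  have a12 : a1 = 0 \/ a2 = 0.
    have [->|a1n] := eqVneq a1 0; [by left|right].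
    have n1 : qdot a1 a1 != 0 by rewrite qdot_eq0.
    have E : qdot a1 a1 *: a2 = qdot a1 a2 *: a1.
      apply: quatP; rewrite !qE /qdot a10 a20; apply/eqP; rewrite -subr_eq0; apply/eqP.
      - by ring.
      - by transitivity (- q2 a1 * (q1 a1 * q2 a2 - q2 a1 * q1 a2)
          - q3 a1 * (q1 a1 * q3 a2 - q3 a1 * q1 a2)); [ring|rewrite e2 e3; ring].
      - by transitivity (q1 a1 * (q1 a1 * q2 a2 - q2 a1 * q1 a2)
          - q3 a1 * (q2 a1 * q3 a2 - q3 a1 * q2 a2)); [ring|rewrite e1 e3; ring].
      - by transitivity (q1 a1 * (q1 a1 * q3 a2 - q3 a1 * q1 a2)
          + q2 a1 * (q2 a1 * q3 a2 - q3 a1 * q2 a2)); [ring|rewrite e1 e2; ring].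
    have Ea2 : a2 = (qdot a1 a2 / qdot a1 a1) *: a1.
      by rewrite mulrC -scalerA -E scalerA mulVf // scale1r.
    set k := _ / _ in Ea2; have [k0|k0] := eqVneq k 0; first by rewrite Ea2 k0 scale0r.
    have dk b : qdot b a2 = k * qdot b a1 by rewrite Ea2 /qdot !qE; ring.
    exfalso; move/eqP: l0; apply.
    have h21 : qdot b2 a1 = 0 by apply/eqP; move/eqP: h22; rewrite dk mulf_eq0 (negbTE k0).
    by move: h12; rewrite dk h11 h21 mulr0 !addr0.
  case: a12 => a0.
  + have [Y [Yn Yo Yb _]] := perp_exists 1 b1 0.
    have Y0 : q0 Y = 0 by rewrite -Yo /qdot !qE; ring.
    have [_ FY2] := c3 _ Y0.
    have hb : qdot b1 a2 = - l.
      have : qdot b2 a1 = 0 by rewrite a0 /qdot !qE; ring.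
      by move: h12; rewrite -/l; lra.
    have : l ^+ 2 * qdot Y Y = 0.
      have -> : l ^+ 2 * qdot Y Y = - (l * (qdot b1 a2 * qdot Y Y)) by rewrite hb; ring.
      rewrite (mixed_det a3 Y0 a20 Yb).
      by apply/eqP; rewrite oppr_eq0; apply/eqP; rewrite -FY2 /F2 a0 mulr0 /det3 !qE; ring.
    by move/eqP; rewrite mulf_eq0 qdot_eq0 expf_eq0 /= (negbTE l0) (negbTE Yn).
  + have [Y [Yn Yo Yb _]] := perp_exists 1 b2 0.
    have Y0 : q0 Y = 0 by rewrite -Yo /qdot !qE; ring.
    have [_ FY2] := c3 _ Y0.
    have hb : qdot b2 a1 = - l.
      have : qdot b1 a2 = 0 by rewrite a0 /qdot !qE; ring.
      by move: h12; rewrite -/l; lra.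
    have : l ^+ 2 * qdot Y Y = 0.
      have -> : l ^+ 2 * qdot Y Y = - (l * (qdot b2 a1 * qdot Y Y)) by rewrite hb; ring.
      rewrite (mixed_det a3 Y0 a10 Yb).
      by rewrite -FY2 /F2 a0 mulr0 /det3 !qE; ring.
    by move/eqP; rewrite mulf_eq0 qdot_eq0 expf_eq0 /= (negbTE l0) (negbTE Yn).
- move=> z z0 [u [v [An zA]]].
  have E : F (qlift z) = det3 (b1 - z * a1) (b2 - z * a2) (b3 - z * a3).
    rewrite det3_sub det3_mul // /F /F1 /F2 /qlift /= qnormsq_dot -/l.
    by ring.
  rewrite E; have [|ud vd] := @det3_dependent _ u v (b1 - z * a1) (b2 - z * a2) (b3 - z * a3).
    have -> : bl 1 (b1 - z * a1) (b2 - z * a2) (b3 - z * a3) u v =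
        bl 1 b1 b2 b3 u v - z * bl 0 a1 a2 a3 u v by rewrite bl_mull bl_sub mulr0 subr0.
    by rewrite zA subrr.
  apply/eqP; apply: contraT => d0; move/eqP: ud; move/eqP: vd.
  rewrite !mulf_eq0 (negbTE d0) !orbF => /eqP v0 /eqP u0.
  by move: An; rewrite u0 v0 /bl mul0r !scale0r !addr0 eqxx.
Qed.
End LinearForms.

Section Isotropic.
Variable R : realType.
Implicit Types (a b c x y z n t d Y w : quat R).

(** The dual basis of a1, a2, a3 consists of their cross products, up to the
    determinant. *)
Lemma dual_vector a1 a2 a3 (x1 x2 x3 : R) : det3 a1 a2 a3 != 0 ->
  exists d, [/\ q0 d = 0, qdot d a1 = x1, qdot d a2 = x2 & qdot d a3 = x3].
Proof.
move=> h; pose k := (det3 a1 a2 a3)^-1.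
exists (k *: (x1 *: qcross a2 a3 + x2 *: qcross a3 a1 + x3 *: qcross a1 a2)).
have e : k * det3 a1 a2 a3 = 1 by rewrite /k mulVf.
split.
- by rewrite !qX; ring.
- rewrite -[RHS]mul1r -e /qdot /det3 !qX; ring.
- rewrite -[RHS]mul1r -e /qdot /det3 !qX; ring.
- rewrite -[RHS]mul1r -e /qdot /det3 !qX; ring.
Qed.

Lemma det3_ortho0 a1 a2 a3 w : det3 a1 a2 a3 != 0 -> q0 w = 0 ->
  qdot w a1 = 0 -> qdot w a2 = 0 -> qdot w a3 = 0 -> w = 0.
Proof.
move=> h w0 w1 w2 w3.
have key : det3 a1 a2 a3 *: w = qdot w a1 *: qcross a2 a3 + qdot w a2 *: qcross a3 a1
   + qdot w a3 *: qcross a1 a2.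
  by apply: quatP; rewrite /qdot /det3 !qX w0; ring.
move: key; rewrite w1 w2 w3 !scale0r !addr0 => /eqP.
by rewrite scaler_eq0 (negbTE h) => /eqP.
Qed.

Lemma qdot_im a b : q0 b = 0 -> qdot (im a) b = qdot a b.
Proof. by move=> b0; rewrite /qdot !imE b0; ring. Qed.

(** The orthogonality relations say that <b_i, a_j> is skew, so the imaginary
    part of b_i is t x a_i for one vector t, and b_i - t a_i is a real number
    <d, a_i>. So (z - t) A = 1 + <d, A> where A = u a1 + v a2 + u v a3: the
    vector z - t is a multiple k A of A, with k = - |z - t|^2 - <d, z - t>.
    The coordinates of k A in the basis of the a_i are k u, k v, k u v, and (k
    u) (k v) = k (k u v). *)
Lemma inverted_cyclide_rank3 a1 a2 a3 b1 b2 b3 : q0 a1 = 0 -> q0 a2 = 0 -> q0 a3 = 0 ->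
  qdot b1 a1 = 0 -> qdot b2 a2 = 0 -> qdot b3 a3 = 0 ->
  qdot b1 a2 + qdot b2 a1 = 0 -> qdot b1 a3 + qdot b3 a1 = 0 ->
  qdot b2 a3 + qdot b3 a2 = 0 -> det3 a1 a2 a3 != 0 ->
  inverted_cyclide (bl_values a1 a2 a3 b1 b2 b3).
Proof.
move=> a10 a20 a30 h11 h22 h33 h12 h13 h23 dn0; set D := det3 _ _ _ in dn0.
have cD : det3 (qcross a2 a3) (qcross a3 a1) (qcross a1 a2) = D ^+ 2.
  by rewrite /D /det3 !qX; ring.
have [t [t0 t1 t2 t3]] : exists t, [/\ q0 t = 0, qdot t (qcross a2 a3) = qdot b2 a3,
    qdot t (qcross a3 a1) = qdot b3 a1 & qdot t (qcross a1 a2) = qdot b1 a2].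
  by apply: dual_vector; rewrite cD expf_neq0.
have tx a b : q0 a = 0 -> q0 b = 0 -> qdot (t * a) b = qdot t (qcross a b).
  by move=> a0 b0; rewrite /qdot !qX t0 a0 b0; ring.
have crossN a b : qdot t (qcross b a) = - qdot t (qcross a b).
  by rewrite /qdot !qX; ring.
have crossaa a : qdot t (qcross a a) = 0.
  by rewrite /qdot !qX; ring.
have sB a b c : qdot (a - b) c = qdot a c - qdot b c by rewrite /qdot !qE; ring.
have imz w : qdot w a1 = 0 -> qdot w a2 = 0 -> qdot w a3 = 0 -> im w = 0.
  by move=> w1 w2 w3; apply: (det3_ortho0 dn0); rewrite ?imE ?qdot_im.
have e1 : im (b1 - t * a1) = 0.
  by apply: imz; rewrite sB ?tx // ?crossaa ?h11 ?[qcross a1 a3]crossN; rewrite ?(crossN a3 a1) ?t2 ?t3; lra.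
have e2 : im (b2 - t * a2) = 0.
  by apply: imz; rewrite sB ?tx // ?crossaa ?h22 ?(crossN a1 a2) ?t1 ?t3; lra.
have e3 : im (b3 - t * a3) = 0.
  by apply: imz; rewrite sB ?tx // ?crossaa ?h33 ?(crossN a2 a3) ?t1 ?t2; lra.
have [d [d0 d1 d2 d3]] := dual_vector (q0 (b1 - t * a1)) (q0 (b2 - t * a2))
  (q0 (b3 - t * a3)) dn0.
have im0 w (k : R) : im w = 0 -> k = q0 w -> w = qreal k.
  move=> h ->; apply: quatP; rewrite ?qE //.
  - by move: (congr1 (fun x : quat R => q1 x) h); rewrite imE qE.
  - by move: (congr1 (fun x : quat R => q2 x) h); rewrite imE qE.
  - by move: (congr1 (fun x : quat R => q3 x) h); rewrite imE qE.
have {}e1 := im0 _ _ e1 d1; have {}e2 := im0 _ _ e2 d2; have {}e3 := im0 _ _ e3 d3.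
pose sh (v : lifted R) : quat R := v.1.2 - v.2 *: t.
(* the linear form |z - t|^2 + <d, z - t>, equal to - k on the surface *)
pose Dl : lifted R -> R := lcoord 1 (d - 2 *: t) (qdot t t - qdot d t).
pose F (v : lifted R) : R := det3 (sh v) a2 a3 * det3 a1 (sh v) a3
  + Dl v * (D * det3 a1 a2 (sh v)).
apply: (@inverted_cyclide_intro _ F).
- have l1 : lin_form (fun v => det3 (sh v) a2 a3) by rewrite /sh /det3; lin_tac.
  have l2 : lin_form (fun v => det3 a1 (sh v) a3) by rewrite /sh /det3; lin_tac.
  have l3 : lin_form (fun v => D * det3 a1 a2 (sh v)).
    by rewrite /sh /det3; move: (D) => ?; lin_tac.
  by apply: quad_add; apply: quad_mul => //; exact: lin_lcoord.
- by move=> T; rewrite /F /sh /det3 /= scale0r subr0 !qE; ring.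
- move=> FY.
  have E s : D ^+ 2 * (s ^+ 3 * qdot a3 a3 + s ^+ 2 * qdot d a3) = 0.
    rewrite -(FY (t + s *: a3)); last by rewrite !qE t0 a30; ring.
    have ets : t + s *: a3 - t = s *: a3 by rewrite addrC addKr.
    rewrite /F /sh /= scale1r ets /Dl /lcoord /= qnormsq_dot.
    have -> : det3 (s *: a3) a2 a3 = 0 by rewrite /det3 !qE; ring.
    have -> : det3 a1 a2 (s *: a3) = s * D by rewrite /D /det3 !qE; ring.
    by rewrite mul0r add0r /qdot !qE; ring.
  have a3n : a3 != 0.
    by apply: contra_neq dn0 => a30'; rewrite /D a30' /det3 !qE; ring.
  have : D ^+ 2 * qdot a3 a3 = 0 by move: (E 1) (E (-1)); lra.
  by move/eqP; rewrite mulf_eq0 expf_eq0 /= qdot_eq0 (negbTE dn0) (negbTE a3n).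
- move=> z z0 [u [v [An zA]]].
  set A := bl 0 a1 a2 a3 u v in An zA.
  have A0 : q0 A = 0 by rewrite /A /bl !qE a10 a20 a30; ring.
  have BA : bl 1 b1 b2 b3 u v = qreal (1 + qdot d A) + t * A.
    have -> : b1 = qreal (qdot d a1) + t * a1 by rewrite -e1 subrK.
    have -> : b2 = qreal (qdot d a2) + t * a2 by rewrite -e2 subrK.
    have -> : b3 = qreal (qdot d a3) + t * a3 by rewrite -e3 subrK.
    have -> (x1 x2 x3 : R) : bl 1 (qreal x1 + t * a1) (qreal x2 + t * a2) (qreal x3 + t * a3) u v
        = bl 1 (qreal x1) (qreal x2) (qreal x3) u v + t * A.
      by rewrite /A bl_mull bl_add mulr0 addr0.
    congr (_ + _); have -> : qdot d A = u * qdot d a1 + v * qdot d a2 + u * v * qdot d a3.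
      by rewrite /A /bl /qdot !qE; ring.
    by rewrite /bl; apply: quatP; rewrite !qE; ring.
  have zt : (z - t) * A = qreal (1 + qdot d A) by rewrite mulrBl zA BA addrK.
  have nA : qdot A A != 0 by rewrite qdot_eq0.
  pose k := - (1 + qdot d A) / qdot A A.
  have ek : z - t = k *: A.
    have : (z - t) * A * qconj A = qreal (1 + qdot d A) * qconj A by rewrite zt.
    rewrite -mulrA qmul_conj qmul_real qreal_mul qconj_im // scalerN -scaleNr.
    by move=> E; rewrite /k mulrC -scalerA -E scalerA mulVf // scale1r.
  have Ek : k * qdot A A = - (1 + qdot d A) by rewrite /k divfK.
  have zE : z = t + k *: A by rewrite -ek addrC subrK.
  have DE : Dl (qlift z) = - k.
    rewrite /Dl /lcoord /qlift /= qnormsq_dot zE.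
    transitivity (k * (k * qdot A A) + k * qdot d A); last by rewrite Ek; ring.
    by rewrite /qdot !qE; ring.
  rewrite /F DE /sh /qlift /= scale1r ek.
  have -> : det3 (k *: A) a2 a3 = k * u * D by rewrite /A /bl /D /det3 !qE; ring.
  have -> : det3 a1 (k *: A) a3 = k * v * D by rewrite /A /bl /D /det3 !qE; ring.
  have -> : det3 a1 a2 (k *: A) = k * (u * v) * D by rewrite /A /bl /D /det3 !qE; ring.
  by ring.
Qed.
End Isotropic.

Section LowRank.
Variable R : realType.
Implicit Types (a b c x y z n t d Y w B : quat R).

(** When the a_i span a plane with normal n = a1 x a2, a3 is a combination of
    a1 and a2, and the orthogonality relations determine <B, a1> and <B, a2>
    up to the factor <b1, a2>; as z = - B A / |A|^2, <n, z> is constant. *)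
Lemma rank2_affine a1 a2 a3 b1 b2 b3 B (m1 m2 m3 : R) z :
  q0 a1 = 0 -> q0 a2 = 0 -> q0 a3 = 0 ->
  qdot b1 a1 = 0 -> qdot b2 a2 = 0 -> qdot b3 a3 = 0 ->
  qdot b1 a2 + qdot b2 a1 = 0 -> qdot b1 a3 + qdot b3 a1 = 0 ->
  qdot b2 a3 + qdot b3 a2 = 0 -> det3 a1 a2 a3 = 0 -> qcross a1 a2 != 0 ->
  B = 1 + m1 *: b1 + m2 *: b2 + m3 *: b3 ->
  m1 *: a1 + m2 *: a2 + m3 *: a3 != 0 ->
  z * (m1 *: a1 + m2 *: a2 + m3 *: a3) = B ->
  qdot (qcross a1 a2) z = qdot b1 a2.
Proof.
move=> a10 a20 a30 h11 h22 h33 h12 h13 h23 d0 nn BE.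
set n := qcross a1 a2 in nn *; set k := qdot b1 a2 in h12 *.
have Nn : qdot n n != 0 by rewrite qdot_eq0.
pose x := det3 a3 a2 n / qdot n n; pose y := det3 a1 a3 n / qdot n n.
have ea3 : a3 = x *: a1 + y *: a2.
  have E : qdot n n *: a3 = det3 a3 a2 n *: a1 + det3 a1 a3 n *: a2 + det3 a1 a2 a3 *: n.
    by rewrite /n; apply: quatP; rewrite /det3 /qdot !qX ?a10 ?a20 ?a30; ring.
  rewrite d0 scale0r addr0 in E.
  by rewrite /x /y ![_ / _]mulrC -!scalerA -scalerDr -E scalerA mulVf // scale1r.
have hb21 : qdot b2 a1 = - k by move: h12; lra.
have hb31 : qdot b3 a1 = - y * k by move: h13; rewrite {1}ea3 qdotDr !qdotZr h11 -/k; lra.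
have hb32 : qdot b3 a2 = x * k by move: h23; rewrite {1}ea3 qdotDr !qdotZr h22 hb21; lra.
pose s := m1 + m3 * x; pose r := m2 + m3 * y.
have AE : m1 *: a1 + m2 *: a2 + m3 *: a3 = s *: a1 + r *: a2.
  rewrite ea3 /s /r; move: (x) (y) => x' y'; by apply: quatP; rewrite !qE; ring.
rewrite AE; set A := s *: a1 + r *: a2 => An zA.
have B1 : qdot B a1 = - k * r.
  transitivity (q0 a1 + m1 * qdot b1 a1 + m2 * qdot b2 a1 + m3 * qdot b3 a1).
    by rewrite BE /qdot !qE; ring.
  by rewrite a10 h11 hb21 hb31 /r; ring.
have B2 : qdot B a2 = k * s.
  transitivity (q0 a2 + m1 * qdot b1 a2 + m2 * qdot b2 a2 + m3 * qdot b3 a2).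
    by rewrite BE /qdot !qE; ring.
  by rewrite a20 -/k h22 hb32 /s; ring.
have nB1 : qdot n (B * a1) = - (qdot a1 a1 * qdot B a2 - qdot a1 a2 * qdot B a1).
  by rewrite /n /qdot !qX a10 a20; ring.
have nB2 : qdot n (B * a2) = - (qdot a1 a2 * qdot B a2 - qdot a2 a2 * qdot B a1).
  by rewrite /n /qdot !qX a10 a20; ring.
have A0 : q0 A = 0 by rewrite !qE a10 a20; ring.
have E : qdot A A * qdot n z = - qdot n (B * A).
  have -> : B * A = - (qdot A A *: z).
    by rewrite -zA -mulrA -[X in z * (A * X)]opprK -(qconj_im A0) mulrN qmul_conj mulrN qmul_real.
  by rewrite /qdot !qE; ring.
have AAn : qdot A A != 0 by rewrite qdot_eq0.
apply: (mulfI AAn); rewrite E.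
have -> : qdot n (B * A) = s * qdot n (B * a1) + r * qdot n (B * a2).
  rewrite /A mulrDr !qscaleAr; move: (B * a1) (B * a2) (n) => *; by rewrite /qdot !qE; ring.
have -> : qdot A A = s ^+ 2 * qdot a1 a1 + s * r * (2 * qdot a1 a2) + r ^+ 2 * qdot a2 a2.
  by rewrite /A; move: (s) (r) => *; rewrite /qdot !qE; ring.
by rewrite nB1 nB2 B1 B2; ring.
Qed.

Lemma inverted_cyclide_plane n (k : R) (Z : quat R -> Prop) : n != 0 -> q0 n = 0 ->
  (forall z, q0 z = 0 -> Z z -> qdot n z = k) -> inverted_cyclide Z.
Proof.
move=> nn n0 hZ.
apply: (@inverted_cyclide_intro _ (fun v => v.2 * lcoord 0 n (- k) v)).
- by apply: quad_mul; [exact: lin_W|exact: lin_lcoord].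
- by move=> T; rewrite /= mul0r.
- move=> FY; have := FY (((1 + k) / qdot n n) *: n); rewrite !qE n0 mulr0 => /(_ erefl).
  have Nn : qdot n n != 0 by rewrite qdot_eq0.
  rewrite /lcoord /=; have -> : qdot n (((1 + k) / qdot n n) *: n) = 1 + k.
    transitivity ((1 + k) / qdot n n * qdot n n); last by rewrite divfK.
    by move: (_ / _) => ?; rewrite /qdot !qE; ring.
  move/eqP; rewrite mul0r add0r mul1r mulr1 addrK.
  by rewrite oner_eq0.
- by move=> z z0 Zz; rewrite /lcoord /= hZ //; ring.
Qed.

Lemma det3_cycle a b c : det3 a b c = det3 b c a.
Proof. by rewrite /det3; ring. Qed.

(** The coefficients m_i of [rank2_affine] need not be u, v, u v in this
    order, so the three cases follow by cyclic permutation. *)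
Lemma inverted_cyclide_rank2 a1 a2 a3 b1 b2 b3 : q0 a1 = 0 -> q0 a2 = 0 -> q0 a3 = 0 ->
  qdot b1 a1 = 0 -> qdot b2 a2 = 0 -> qdot b3 a3 = 0 ->
  qdot b1 a2 + qdot b2 a1 = 0 -> qdot b1 a3 + qdot b3 a1 = 0 ->
  qdot b2 a3 + qdot b3 a2 = 0 -> det3 a1 a2 a3 = 0 ->
  qcross a1 a2 != 0 \/ qcross a2 a3 != 0 \/ qcross a3 a1 != 0 ->
  inverted_cyclide (bl_values a1 a2 a3 b1 b2 b3).
Proof.
move=> a10 a20 a30 h11 h22 h33 h12 h13 h23 d0 [nn|[nn|nn]];
  apply: (inverted_cyclide_plane nn (qcrossE _ _).1.1.1) => z z0 [u [v]];
  rewrite /bl add0r => -[An zA].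
- exact: (rank2_affine a10 a20 a30 h11 h22 h33 h12 h13 h23 d0 nn _ An zA).
- have e a b c : b + c + a = a + b + c by rewrite addrC addrA.
  rewrite -(e (u *: a1)) in An zA.
  apply: (rank2_affine (m1 := v) (m2 := u * v) (m3 := u) a20 a30 a10 h22 h33 h11 h23 _ _ _ nn _ An zA).
  + by rewrite addrC. + by rewrite addrC. + by rewrite -det3_cycle.
  + by apply: quatP; rewrite !qE; ring.
- have e a b c : c + a + b = a + b + c by rewrite -addrA addrC.
  rewrite -(e (u *: a1)) in An zA.
  apply: (rank2_affine (m1 := u * v) (m2 := u) (m3 := v) a30 a10 a20 h33 h11 h22 _ _ h12 _ nn _ An zA).
  + by rewrite addrC. + by rewrite addrC. + by rewrite det3_cycle.
  + by apply: quatP; rewrite !qE; ring.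
Qed.

(** If a_i = c_i a, then with z_i = b_i a^-1 the relation reads (u c1 + v c2 +
    u v c3) (1, z) = (0, z_0) + u (c1, z_1) + v (c2, z_2) + u v (c3, z_3). If
    the four vectors on the right are dependent, (1, z) satisfies a linear
    equation. If not, the coordinates of (1, z) in their basis are
    proportional to 1, u, v, u v, and the equation is mu0 mu3 = mu1 mu2. *)
Lemma inverted_cyclide_rank1 a b1 b2 b3 (c1 c2 c3 : R) : a != 0 -> q0 a = 0 ->
  inverted_cyclide (bl_values (c1 *: a) (c2 *: a) (c3 *: a) b1 b2 b3).
Proof.
move=> an a0.
have Ea u v : bl 0 (c1 *: a) (c2 *: a) (c3 *: a) u v = (u * c1 + v * c2 + u * v * c3) *: a.
  by rewrite /bl; apply: quatP; rewrite !qE; ring.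
have [c0|cn] := eqVneq (c1, c2, c3) (0, 0, 0).
  apply: (@inverted_cyclide_intro _ (fun v => v.2 * v.2)).
  - by apply: quad_mul; exact: lin_W.
  - by move=> T; rewrite /= mul0r.
  - by move=> /(_ 0); rewrite qE => /(_ erefl) /=; move/eqP; rewrite mulf_eq0 oner_eq0.
  - move=> z _ [u [v [+ _]]]; rewrite Ea; case: c0 => -> -> ->.
    by rewrite !mulr0 !addr0 scale0r eqxx.
have [ai aiE] : exists ai : quat R, a * ai = 1 by exists a^-1; exact: qmulV.
pose zs b := b * ai.
pose row (c : R) (b : quat R) := [:: c; q1 (zs b); q2 (zs b); q3 (zs b)].
(* the first row is (0, z_0) with z_0 = a^-1 = zs 1 *)
pose rows := [:: row 0 1; row c1 b1; row c2 b2; row c3 b3].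
pose N : 'M[R]_4 := \matrix_(i < 4, j < 4) nth 0 (nth [::] rows i) j.
pose mu (u v : R) : 'rV[R]_4 := \row_(i < 4) nth 0 [:: 1; u; v; u * v] i.
pose pt (w : R) (Y : quat R) : 'rV[R]_4 := \row_(i < 4) nth 0 [:: w; q1 Y; q2 Y; q3 Y] i.
have muN z u v : z * bl 0 (c1 *: a) (c2 *: a) (c3 *: a) u v = bl 1 b1 b2 b3 u v ->
    mu u v *m N = (u * c1 + v * c2 + u * v * c3) *: pt 1 z.
  rewrite Ea => zA; set c := u * c1 + v * c2 + u * v * c3 in zA *.
  have cz : c *: z = zs 1 + u *: zs b1 + v *: zs b2 + (u * v) *: zs b3.
    have -> : c *: z = bl 1 b1 b2 b3 u v * ai.
      by rewrite -zA qscaleAr qscaleAl -mulrA aiE mulr1.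
    by rewrite /bl /zs !mulrDl !qscaleAl.
  apply/rowP => j; rewrite !mxE.
  have S : \sum_(i < 4) mu u v 0 i * N i j = nth 0 (row 0 1) j + u * nth 0 (row c1 b1) j
      + v * nth 0 (row c2 b2) j + (u * v) * nth 0 (row c3 b3) j.
    by rewrite !big_ord_recr big_ord0 /= !mxE /=; ring.
  rewrite S; move: cz; set z0 := zs 1; set z1 := zs b1; set z2 := zs b2; set z3 := zs b3 => cz.
  have cq k (hk : (k < 4)%N) : c * @fun_of_matrix _ 1 4 z 0 (inord k) =
     @fun_of_matrix _ 1 4 z0 0 (inord k) + u * @fun_of_matrix _ 1 4 z1 0 (inord k)
     + v * @fun_of_matrix _ 1 4 z2 0 (inord k) + u * v * @fun_of_matrix _ 1 4 z3 0 (inord k).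
    by rewrite -qZ cz !(qD, qZ).
  case: j {S} => -[|[|[|[|//]]]] /= _; first by rewrite /c; ring.
  - by rewrite (cq 1%N).
  - by rewrite (cq 2%N).
  - by rewrite (cq 3%N).
have ptE (w : R) Y (h : 'cV[R]_4) : (pt w Y *m h) 0 0 = w * h (inord 0) 0
    + q1 Y * h (inord 1) 0 + q2 Y * h (inord 2) 0 + q3 Y * h (inord 3) 0.
  rewrite mxE !big_ord_recr big_ord0 /= add0r.
  by congr (_ + _ + _ + _); rewrite mxE /=; congr (_ * h _ 0); apply: val_inj;
    rewrite /= inordK.
have linpt (h : 'cV[R]_4) : lin_form (fun v : lifted R => (pt v.2 v.1.2 *m h) 0 0).
  have E (v : lifted R) : (pt v.2 v.1.2 *m h) 0 0 = lcoord 0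
    (mkquat 0 0 (h (inord 1) 0) (h (inord 2) 0) (h (inord 3) 0)) (h (inord 0) 0) v.
    by rewrite ptE /lcoord /qdot !qE; ring.
  by split=> *; rewrite !E; apply lin_lcoord.
have An0 u v : bl 0 (c1 *: a) (c2 *: a) (c3 *: a) u v != 0 ->
    u * c1 + v * c2 + u * v * c3 != 0.
  by rewrite Ea scaler_eq0 negb_or => /andP[].
have [Nu|Nu] := boolP (N \in unitmx); last first.
  have [h hn Nh] : exists2 h : 'cV[R]_4, h != 0 & N *m h = 0.
    have : kermx N^T != 0 by rewrite kermx_eq0 row_free_unit unitmx_tr.
    move=> /rowV0Pn[v /sub_kermxP vM v0]; exists v^T.
      by apply: contra_neq v0 => /(congr1 trmx); rewrite trmxK trmx0.
    by apply: trmx_inj; rewrite trmx_mul trmxK vM trmx0.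
  apply: (@inverted_cyclide_intro _ (fun v => v.2 * (pt v.2 v.1.2 *m h) 0 0)).
  - by apply: quad_mul; [exact: lin_W|exact: linpt].
  - by move=> T; rewrite /= mul0r.
  - move=> FY; move/negP: hn; apply; apply/eqP/colP => i; rewrite [RHS]mxE.
    have G Y : q0 Y = 0 -> h (inord 0) 0 + q1 Y * h (inord 1) 0 + q2 Y * h (inord 2) 0
       + q3 Y * h (inord 3) 0 = 0.
      by move=> /FY /=; rewrite ptE !mul1r.
    have := G 0; have := G (mkquat 0 0 1 0 0); have := G (mkquat 0 0 0 1 0).
    have := G (mkquat 0 0 0 0 1); rewrite !qE => /(_ erefl) g3 /(_ erefl) g2 /(_ erefl) g1 /(_ erefl) g0.
    have -> : i = inord i by rewrite inord_val.
    by case: i => -[|[|[|[|//]]]] /= _; lra.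
  - move=> z z0 [u [v [/An0 c0 /muN zA]]].
    rewrite /= mul1r; apply: (mulfI c0); rewrite mulr0.
    have := congr1 (fun M : 'M[R]_(1, 4) => (M *m h) 0 0) zA.
    by rewrite -mulmxA Nh mulmx0 -scalemxAl !mxE => <-.
pose l (i : nat) (v : lifted R) := (pt v.2 v.1.2 *m col (inord i) (invmx N)) 0 0.
have lE i v : l i v = (pt v.2 v.1.2 *m invmx N) 0 (inord i) by rewrite /l !mxE; apply: eq_bigr => k _; rewrite !mxE.
apply: (@inverted_cyclide_intro _ (fun v => l 0%N v * l 3 v - l 1%N v * l 2 v)).
- by apply: quad_sub; apply: quad_mul; exact: linpt.
- move=> T; have p0 : pt 0 0 = 0.
    by apply/rowP => j; rewrite !mxE; case: j => -[|[|[|[|//]]]] /= _; rewrite ?qE.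
  by rewrite !lE /= p0 mul0mx !mxE mul0r subrr.
(* a point with mu = (1, k1, k2, 1) off the quadric mu0 mu3 = mu1 mu2 whose
   first coordinate W is not 0 *)
- have [k1 [k2 [k12 Wn]]] : exists k1 k2 : R, k1 * k2 = 0 /\ k1 * c1 + k2 * c2 + c3 != 0.
    have [c30|c30] := eqVneq c3 0; last by exists 0, 0; rewrite !mul0r !add0r.
    have [c20|c20] := eqVneq c2 0; last by exists 0, 1; rewrite !mul0r c30 mul1r add0r addr0.
    exists 1, 0; rewrite mul0r mulr0 mul1r c30 !addr0; split=> //.
    by apply: contra_neq cn => ->; rewrite c20 c30.
  move=> FY; set W := _ + c3 in Wn.
  pose p : 'rV[R]_4 := \row_(i < 4) nth 0 [:: 1; k1; k2; 1] i.
  pose Y : quat R := mkquat 0 0 (W^-1 * (p *m N) 0 (inord 1)) (W^-1 * (p *m N) 0 (inord 2))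
    (W^-1 * (p *m N) 0 (inord 3)).
  have EY : pt 1 Y = W^-1 *: (p *m N).
    apply/rowP => j; rewrite [RHS]mxE.
    have -> : j = inord j by rewrite inord_val.
    case: j => -[|[|[|[|//]]]] /= _; rewrite [LHS]mxE inordK //= ?qE //.
    apply: (mulfI Wn); rewrite mulr1 mulrA mulfV // mul1r mxE.
    rewrite !big_ord_recr big_ord0 /= !mxE /= !inordK //= /W.
    by ring.
  have := FY Y; rewrite !qE => /(_ erefl); rewrite !lE /= EY.
  rewrite -scalemxAl mulmxK // !mxE !inordK //=.
  have -> : W^-1 * 1 * (W^-1 * 1) - W^-1 * k1 * (W^-1 * k2) = W^-1 ^+ 2 * (1 - k1 * k2) by ring.
  by rewrite k12 subr0 mulr1 => /eqP; rewrite expf_eq0 /= invr_eq0 (negbTE Wn).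
- move=> z z0 [u [v [/An0 c0 /muN zA]]].
  set c := _ + _ in c0 zA.
  have E i : c * l i (qlift z) = mu u v 0 (inord i).
    rewrite lE /= -[in RHS](mulmxK Nu (mu u v)) zA -scalemxAl; by rewrite [RHS]mxE.
  have c20 : c ^+ 2 != 0 by rewrite expf_neq0.
  apply: (mulfI c20); rewrite mulr0.
  transitivity ((c * l 0%N (qlift z)) * (c * l 3 (qlift z))
     - (c * l 1%N (qlift z)) * (c * l 2 (qlift z))); first by ring.
  by rewrite !E !mxE !inordK //=; ring.
Qed.
End LowRank.

Section BilinearFraction.
Variable R : realType.
Implicit Types (a b c x z n t d Y w B : quat R).

Lemma parallel_im a b : q0 a = 0 -> q0 b = 0 -> qcross a b = 0 -> a != 0 ->
  exists c : R, b = c *: a.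
Proof.
move=> a0 b0 ab an; exists (qdot a b / qdot a a).
have n1 : qdot a a != 0 by rewrite qdot_eq0.
have : qdot a a *: b = qdot a b *: a - im (im a * qcross a b).
  by apply: quatP; rewrite /qdot !qX a0 b0; ring.
rewrite ab mulr0; have -> : im (0 : quat R) = 0 by apply: quatP; rewrite !qX.
by rewrite subr0 => E; rewrite mulrC -scalerA -E scalerA mulVf // scale1r.
Qed.

(** The cases Re a3 <> 0, and then rank 3, 2 and at most 1 of the imaginary
    a1, a2, a3, exhaust everything. *)
Lemma bilinear_inverted_cyclide a1 a2 a3 b1 b2 b3 : q0 a1 = 0 -> q0 a2 = 0 ->
  qdot b1 a1 = 0 -> qdot b2 a2 = 0 -> qdot b3 a3 = 0 ->
  q0 a3 + qdot b1 a2 + qdot b2 a1 = 0 -> qdot b1 a3 + qdot b3 a1 = 0 ->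
  qdot b2 a3 + qdot b3 a2 = 0 -> inverted_cyclide (bl_values a1 a2 a3 b1 b2 b3).
Proof.
move=> a10 a20 h11 h22 h33 h12 h13 h23.
have [a30|l0] := eqVneq (q0 a3) 0; last exact: inverted_cyclide_skew.
rewrite a30 add0r in h12.
have [d0|d0] := eqVneq (det3 a1 a2 a3) 0; last exact: inverted_cyclide_rank3.
have [c12|] := eqVneq (qcross a1 a2) 0; last by move=> c; apply: inverted_cyclide_rank2 => //; left.
have [c23|] := eqVneq (qcross a2 a3) 0; last by move=> c; apply: inverted_cyclide_rank2 => //; right; left.
have [c31|] := eqVneq (qcross a3 a1) 0; last by move=> c; apply: inverted_cyclide_rank2 => //; right; right.
have crossN a b : qcross b a = - qcross a b by apply: quatP; rewrite !qX; ring.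
have [a1E|an] := eqVneq a1 0; last first.
  have [k2 ->] := parallel_im a10 a20 c12 an.
  have c13 : qcross a1 a3 = 0 by rewrite crossN c31 oppr0.
  have [k3 ->] := parallel_im a10 a30 c13 an.
  rewrite -[X in bl_values X](scale1r a1); exact: inverted_cyclide_rank1.
have [a2E|an] := eqVneq a2 0; last first.
  have [k3 ->] := parallel_im a20 a30 c23 an.
  rewrite a1E -(scale0r a2) -[X in bl_values _ X](scale1r a2); exact: inverted_cyclide_rank1.
rewrite a1E a2E; have [->|an] := eqVneq a3 0; last first.
  rewrite -(scale0r a3) -[X in bl_values _ _ X](scale1r a3); exact: inverted_cyclide_rank1.
rewrite -(scale0r (mkquat 0 0 1 0 0)); apply: inverted_cyclide_rank1; last by rewrite qE.
by rewrite -qdot_eq0 /qdot !qE mulr1 !mulr0 add0r !addr0 oner_eq0.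
Qed.

(** This is all that is used of the open sets of parameters on which relations
    are known to hold: the relations have degree at most 2 in each parameter. *)
Definition rich (I : R -> Prop) : Prop := forall c0 c1 c2 : R,
  (forall u, I u -> c0 + u * c1 + u ^+ 2 * c2 = 0) -> [/\ c0 = 0, c1 = 0 & c2 = 0].

Lemma rich_three (I : R -> Prop) (u0 e : R) : 0 < e ->
  (forall u, `|u - u0| < e -> I u) -> rich I.
Proof.
move=> e0 hI c0 c1 c2 h.
have h0 : I u0 by apply: hI; rewrite subrr normr0.
have h1 : I (u0 + e / 2) by apply: hI; rewrite addrC addKr ger0_norm; lra.
have h2 : I (u0 - e / 2) by apply: hI; rewrite addrC addKr normrN ger0_norm; lra.
move: (h _ h0) (h _ h1) (h _ h2) => E0 E1 E2.
have e2 : e ^+ 2 * c2 = 0 by lra.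
have c20 : c2 = 0 by move/eqP: e2; rewrite mulf_eq0 expf_eq0 (gt_eqF e0) /= => /eqP.
have e1 : e * c1 = 0 by rewrite c20 in E1 E2; lra.
have c10 : c1 = 0 by move/eqP: e1; rewrite mulf_eq0 (gt_eqF e0) /= => /eqP.
by split=> //; rewrite c10 c20 in E0; lra.
Qed.

Lemma rich_all : rich (fun _ => True).
Proof. by apply: (@rich_three _ 0 1). Qed.

Lemma rich2 (I J : R -> Prop) (c00 c01 c02 c10 c11 c12 c20 c21 c22 : R) :
  rich I -> rich J ->
  (forall u v, I u -> J v -> (c00 + v * c01 + v ^+ 2 * c02) +
     u * (c10 + v * c11 + v ^+ 2 * c12) + u ^+ 2 * (c20 + v * c21 + v ^+ 2 * c22) = 0) ->
  [/\ [/\ c00 = 0, c01 = 0 & c02 = 0], [/\ c10 = 0, c11 = 0 & c12 = 0]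
    & [/\ c20 = 0, c21 = 0 & c22 = 0]].
Proof.
move=> rI rJ h.
have g v : J v -> [/\ c00 + v * c01 + v ^+ 2 * c02 = 0, c10 + v * c11 + v ^+ 2 * c12 = 0
   & c20 + v * c21 + v ^+ 2 * c22 = 0].
  by move=> Jv; apply: rI => u Iu; exact: h.
by split; apply: rJ => v /g [].
Qed.

Section Coefficients.
Variables (b0 b1 b2 b3 a0 a1 a2 a3 : quat R).

(** The coefficients of the polynomial <B(u, v), A(u, v)>, of bidegree (2, 2). *)
Lemma bl_orthoP (I J : R -> Prop) : rich I -> rich J ->
  (forall u v, I u -> J v -> qdot (bl b0 b1 b2 b3 u v) (bl a0 a1 a2 a3 u v) = 0) ->
  [/\ [/\ qdot b0 a0 = 0, qdot b0 a2 + qdot b2 a0 = 0 & qdot b2 a2 = 0],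
      [/\ qdot b0 a1 + qdot b1 a0 = 0,
          qdot b0 a3 + qdot b3 a0 + qdot b1 a2 + qdot b2 a1 = 0
        & qdot b2 a3 + qdot b3 a2 = 0]
    & [/\ qdot b1 a1 = 0, qdot b1 a3 + qdot b3 a1 = 0 & qdot b3 a3 = 0]].
Proof.
move=> rI rJ h; apply: (rich2 rI rJ) => u v Iu Jv; rewrite -(h _ _ Iu Jv).
by rewrite /bl !qdotDl !qdotZl !qdotDr !qdotZr; ring.
Qed.

Lemma bl_ortho_all (I J : R -> Prop) : rich I -> rich J ->
  (forall u v, I u -> J v -> qdot (bl b0 b1 b2 b3 u v) (bl a0 a1 a2 a3 u v) = 0) ->
  forall u v, qdot (bl b0 b1 b2 b3 u v) (bl a0 a1 a2 a3 u v) = 0.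
Proof.
move=> rI rJ /(bl_orthoP rI rJ) [[h1 h2 h3] [h4 h5 h6] [h7 h8 h9]] u v.
transitivity ((qdot b0 a0 + v * (qdot b0 a2 + qdot b2 a0) + v ^+ 2 * qdot b2 a2)
  + u * ((qdot b0 a1 + qdot b1 a0) + v * (qdot b0 a3 + qdot b3 a0 + qdot b1 a2 + qdot b2 a1)
       + v ^+ 2 * (qdot b2 a3 + qdot b3 a2))
  + u ^+ 2 * (qdot b1 a1 + v * (qdot b1 a3 + qdot b3 a1) + v ^+ 2 * qdot b3 a3)).
  by rewrite /bl !qdotDl !qdotZl !qdotDr !qdotZr; ring.
by rewrite h1 h2 h3 h4 h5 h6 h7 h8 h9; ring.
Qed.
End Coefficients.

Lemma bl_shift x0 x1 x2 x3 (u0 v0 u v : R) : bl x0 x1 x2 x3 (u + u0) (v + v0) =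
  bl (bl x0 x1 x2 x3 u0 v0) (x1 + v0 *: x3) (x2 + u0 *: x3) x3 u v.
Proof. by rewrite /bl; apply: quatP; rewrite !qE; ring. Qed.

(** The action of y |-> (y - y0)^-1 on the lifts of imaginary y, where w^-1 =
    - w / |w|^2. *)
Definition inv_lift y0 (v : lifted R) : lifted R :=
  (v.2, v.2 *: y0 - v.1.2, v.1.1 - 2 * qdot y0 v.1.2 + qdot y0 y0 * v.2).

Lemma lin_inv_lift y0 : lin_map (inv_lift y0).
Proof.
split=> [[[T Y] W] [[T' Y'] W']|k [[T Y] W]]; rewrite /inv_lift /ladd /lscale /=;
  congr (_, _, _); try (by apply: quatP; rewrite !qE; ring);
  by rewrite /qdot !qE; ring.
Qed.

Lemma inverted_cyclide_surface (S : set 'rV[R]_3) (y0 : 'rV[R]_3) (Z : quat R -> Prop) :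
  inverted_cyclide Z -> S y0 -> (forall y, S y -> y <> y0 -> Z (imq y - imq y0)^-1) -> cyclide_surface S.
Proof.
move=> [F [qF F0 [v [Y0 nv Fv]] FZ]] Sy0 hZ.
apply: (cyclide_intro (quad_comp (lin_inv_lift (imq y0)) qF)); first by exists y0.
- move=> y Sy; rewrite /= /inv_lift /qlift /=.
  have [->|yn] := eqVneq y y0.
    rewrite scale1r subrr qnormsq_dot.
    by have -> : forall k : R, k - 2 * k + k * 1 = 0 by move=> k; ring.
  set w := imq y - imq y0.
  have wn : w != 0 by rewrite subr_eq0; apply: contra_neq yn => /imq_inj.
  have Nn : qdot w w != 0 by rewrite qdot_eq0.
  have w0 : q0 w = 0 by rewrite !qE subrr.
  have zE : w^-1 = (qdot w w)^-1 *: - w by rewrite qinvE qnormsq_dot (qconj_im w0).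
  have -> : (1, 1 *: imq y0 - imq y, qnormsq (imq y) - 2 * qdot (imq y0) (imq y)
       + qdot (imq y0) (imq y0) * 1) = lscale (qdot w w) (qlift w^-1).
    rewrite /lscale /qlift /=; congr (_, _, _).
    - rewrite zE qnormsq_dot.
      have -> : qdot ((qdot w w)^-1 *: - w) ((qdot w w)^-1 *: - w) = (qdot w w)^-1 ^+ 2 * qdot w w.
        by move: (_^-1) => k; rewrite /qdot !qE; ring.
      by field.
    - by rewrite zE scalerA mulfV // scale1r scale1r /w opprB.
    - by rewrite mulr1 qnormsq_dot /w /qdot !qE; ring.
  rewrite quad_scale // FZ ?mulr0 //.
    by rewrite zE !qE subrr oppr0 mulr0.
  by apply: hZ => //; exact/eqP.
- case: v Y0 nv Fv => [[T Y] W] /= Y0 nv Fv.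
  pose Y' := T *: imq y0 - Y.
  exists (W + 2 * qdot (imq y0) Y' - qdot (imq y0) (imq y0) * T, Y', T); split.
  + by rewrite /= !qE Y0; ring.
  + move: nv; rewrite /null_lift /= => nv.
    transitivity (T * W + 2 * T * qdot (imq y0) Y' - T ^+ 2 * qdot (imq y0) (imq y0)).
      by ring.
    by rewrite nv /Y' !qnormsq_dot /qdot !qE; ring.
  + rewrite /inv_lift /=; move: Fv; congr (F _ != 0); congr (_, _, _).
      by rewrite /Y' opprB addrC subrK.
    by ring.
Qed.

(** The point y0 of the surface is sent to infinity by z = (y - y0)^-1, the
    parameters being moved so that it has parameters (0, 0); the roles of
    numerator and denominator are exchanged by the inversion, and dividing by
    the old denominator at (0, 0) makes the constant term 1. *)
Theorem bilinear_fraction_cyclide (S : set 'rV[R]_3) (I J : R -> Prop) b0 b1 b2 b3 a0 a1 a2 a3 :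
  rich I -> rich J ->
  (forall u v, I u -> J v -> qdot (bl b0 b1 b2 b3 u v) (bl a0 a1 a2 a3 u v) = 0) ->
  S !=set0 ->
  (forall y, S y -> exists u v, bl a0 a1 a2 a3 u v != 0 /\
      imq y * bl a0 a1 a2 a3 u v = bl b0 b1 b2 b3 u v) ->
  cyclide_surface S.
Proof.
move=> rI rJ /(bl_ortho_all rI rJ) ortho [y0 Sy0] hS.
have [u0 [v0 [P0 y0P]]] := hS _ Sy0.
set be := bl a0 a1 a2 a3 u0 v0 in P0 y0P.
have [bi bE] : exists bi, be * bi = 1 by exists be^-1; exact: qmulV.
have bin : bi != 0 by apply/eqP => b0'; move/eqP: bE; rewrite b0' mulr0 eq_sym oner_eq0.
pose q := imq y0.
pose B1 := (a1 + v0 *: a3) * bi; pose B2 := (a2 + u0 *: a3) * bi; pose B3 := a3 * bi.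
pose A1 := ((b1 + v0 *: b3) - q * (a1 + v0 *: a3)) * bi.
pose A2 := ((b2 + u0 *: b3) - q * (a2 + u0 *: a3)) * bi.
pose A3 := (b3 - q * a3) * bi.
have EB u v : bl 1 B1 B2 B3 u v = bl a0 a1 a2 a3 (u + u0) (v + v0) * bi.
  by rewrite bl_shift bl_mulr -/be bE.
have EA u v : bl 0 A1 A2 A3 u v =
   (bl b0 b1 b2 b3 (u + u0) (v + v0) - q * bl a0 a1 a2 a3 (u + u0) (v + v0)) * bi.
  rewrite !bl_shift bl_mull bl_sub bl_mulr -/be y0P subrr mul0r //.
have oAB u v : qdot (bl 1 B1 B2 B3 u v) (bl 0 A1 A2 A3 u v) = 0.
  rewrite EA EB; set P := bl a0 _ _ _ _ _; set Q := bl b0 _ _ _ _ _.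
  have QP : qdot Q P = 0 by exact: ortho.
  transitivity (qdot bi bi * (qdot Q P - qdot P (q * P))).
    by rewrite /q; move: (P) (Q) => P' Q'; rewrite /qdot !qE; ring.
  rewrite QP; have -> : qdot P (q * P) = 0.
    by rewrite /q; move: (P) => P'; rewrite /qdot !qE; ring.
  by rewrite subrr mulr0.
have [[_ h2 h3] [h4 h5 h6] [h7 h8 h9]] :=
  bl_orthoP rich_all rich_all (fun u v _ _ => oAB u v).
have d1 x : qdot 1 x = q0 x by rewrite /qdot !qE; ring.
have d0 x : qdot x 0 = 0 by rewrite /qdot !qE; ring.
rewrite !d1 !d0 !addr0 in h2 h4 h5.
apply: (inverted_cyclide_surface (bilinear_inverted_cyclide h4 h2 h7 h3 h9 h5 h8 h6) Sy0) => y Sy yn.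
have [u [v [Pn yP]]] := hS _ Sy.
exists (u - u0), (v - v0); rewrite EA EB !subrK -yP -mulrBl.
have wn : imq y - imq y0 != 0 by rewrite subr_eq0; apply/eqP => /imq_inj.
split; first by rewrite !qmul_eq0 !negb_or wn Pn bin.
by rewrite !mulrA qVmul // mul1r.
Qed.
End BilinearFraction.

(** * Möbius transformations as quaternionic fractions *)

Section MobiusFractions.
Variable R : realType.
Implicit Types (a b c d n x z X Y w : quat R).

Definition conj_if (s : bool) x : quat R := if s then qconj x else x.

Lemma conj_ifK s x : conj_if s (conj_if s x) = x.
Proof. by case: s => //=; exact: qconjK. Qed.
Lemma conj_ifN s x : conj_if (~~ s) x = conj_if s (qconj x).
Proof. by case: s => //=; rewrite qconjK. Qed.

(** The conjugation is kept outside the fraction, whose coefficients act from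
    the left: inversions reverse the orientation, so each one adds a
    conjugation. *)
Definition frac (s : bool) a b c d x : Rinf R 4 :=
  if c * x + d == 0 then None else Some (conj_if s ((a * x + b) * (c * x + d)^-1)).

(** Injectivity of the matrix with rows (a, b) and (c, d), acting from the
    left; it plays the role of a nonzero determinant. *)
Definition mx_inj a b c d : Prop :=
  forall X Y, a * X + b * Y = 0 -> c * X + d * Y = 0 -> X = 0 /\ Y = 0.

Definition is_frac (g : quat R -> Rinf R 4) : Prop := exists s a b c d,
  mx_inj a b c d /\ forall x, g x = frac s a b c d x.

(** c + r^2 (x - c) / |x - c|^2 is the conjugate of conj(c) + r^2 (x - c)^-1. *)
Lemma inversion_conj s c (r : R) z : inversion (conj_if s c : 'rV[R]_4) r (Some (conj_if s z : 'rV[R]_4)) =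
  if z == c then None else Some (conj_if (~~ s) (qconj c + r ^+ 2 *: (z - c)^-1)).
Proof.
have cjI : (conj_if s z == conj_if s c) = (z == c).
  by apply/eqP/eqP => [/(congr1 (conj_if s))|->//]; rewrite !conj_ifK.
rewrite /inversion; have [->|zc] := eqVneq z c; first by rewrite eqxx.
have -> : ((conj_if s z : 'rV[R]_4) == conj_if s c) = (z == c) := cjI.
rewrite (negbTE zc); congr Some.
rewrite dot4E qinvE qnormsq_dot conj_ifN.
have -> : qdot ((conj_if s z : 'rV[R]_4) - conj_if s c) ((conj_if s z : 'rV[R]_4) - conj_if s c) = qdot (z - c) (z - c).
  by case: s {cjI} => /=; rewrite /qdot !qE; ring.
rewrite scalerA; move: (r ^+ 2 / _) => k; case: s {cjI} => /=.
  by apply: quatP; rewrite !(qE, mxE); ring.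
by apply: quatP; rewrite !(qE, mxE); ring.
Qed.

Lemma is_frac_inversion c (r : R) g : 0 < r -> is_frac g -> is_frac (@inversion R 4 c r \o g).
Proof.
move=> r0 [s [a0 [b0 [c0 [d0 [inj hg]]]]]].
pose c' := conj_if s c; have cE : c = conj_if s c' by rewrite /c' conj_ifK.
pose k := r ^+ 2 - qdot c' c'.
have kE n d : qconj c' * n + k *: d = qconj c' * (n - c' * d) + r ^+ 2 *: d.
  by rewrite /k; apply: quatP; rewrite /qdot !qE; ring.
have kW n d w : (n - c' * d) * w = 1 ->
    (qconj c' * n + k *: d) * w = qconj c' + r ^+ 2 *: (d * w).
  by move=> h; rewrite kE mulrDl -mulrA h mulr1 qscaleAl.
exists (~~ s), (qconj c' * a0 + k *: c0), (qconj c' * b0 + k *: d0), (a0 - c' * c0), (b0 - c' * d0).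
have num X Y : (qconj c' * a0 + k *: c0) * X + (qconj c' * b0 + k *: d0) * Y =
   qconj c' * (a0 * X + b0 * Y) + k *: (c0 * X + d0 * Y).
  by rewrite !mulrDl !mulrDr !qscaleAl scalerDr !mulrA addrACA.
have den X Y : (a0 - c' * c0) * X + (b0 - c' * d0) * Y =
   (a0 * X + b0 * Y) - c' * (c0 * X + d0 * Y).
  by rewrite !mulrBl mulrDr !mulrA opprD addrACA.
split.
  move=> X Y; rewrite num den => h1 h2; move: h1; rewrite kE h2 mulr0 add0r => /eqP.
  rewrite scaler_eq0 expf_eq0 (gt_eqF r0) /= => /eqP d1.
  by apply: inj => //; move: h2; rewrite d1 mulr0 subr0.
move=> x; rewrite /= hg /frac.
have -> : (qconj c' * a0 + k *: c0) * x + (qconj c' * b0 + k *: d0) =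
    qconj c' * (a0 * x + b0) + k *: (c0 * x + d0).
  by have := num x 1; rewrite !mulr1.
have -> : (a0 - c' * c0) * x + (b0 - c' * d0) = (a0 * x + b0) - c' * (c0 * x + d0).
  by have := den x 1; rewrite !mulr1.
have nz : c0 * x + d0 = 0 -> a0 * x + b0 != 0.
  move=> h; apply/eqP => h'; have [] := inj x 1; rewrite ?mulr1 // => _ /eqP.
  by rewrite oner_eq0.
set n := a0 * x + b0 in nz *; set d := c0 * x + d0 in nz *.
have [d0'|dn] := eqVneq d 0.
  rewrite d0' mulr0 subr0 scaler0 addr0 (negbTE (nz d0')) -mulrA qmulV ?nz // mulr1 /=.
  by rewrite conj_ifN qconjK -cE.
rewrite {1}cE inversion_conj.
have e : (n / d == c') = (n - c' * d == 0).
  rewrite subr_eq0; apply/eqP/eqP => [<-|->]; first by rewrite -mulrA qVmul // mulr1.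
  by rewrite -mulrA qmulV // mulr1.
rewrite e; case: ifPn => // nd; congr (Some (conj_if _ _)).
have zc : n / d - c' = (n - c' * d) / d by rewrite mulrBl -mulrA qmulV // mulr1.
have zV : (n / d - c')^-1 = d / (n - c' * d).
  apply: qinv_uniq.
  by rewrite zc mulrA -[_ / d * d]mulrA qVmul // mulr1 qmulV.
rewrite zV; have [w wE] : exists w, (n - c' * d) * w = 1 by exists (n - c' * d)^-1; exact: qmulV.
by rewrite (qinv_uniq wE) (kW _ _ _ wE).
Qed.

Lemma mobius_frac (M : Rinf R 4 -> Rinf R 4) : mobius M ->
  forall g, is_frac g -> is_frac (M \o g).
Proof.
elim=> [c r r0 g|f1 f2 _ h1 _ h2 g /h2/h1 //]; exact: is_frac_inversion.
Qed.

Lemma is_frac_conj_if s : is_frac (fun x => Some (conj_if s x)).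
Proof.
exists s, 1, 0, 0, 1; split=> [X Y|x].
  by rewrite !mul1r !mul0r addr0 add0r.
rewrite /frac !mul0r add0r oner_eq0 mul1r addr0.
by rewrite (qinv_uniq (mulr1 (1 : quat R))) mulr1.
Qed.

(** A conjugation inside, before M, is one more step of the same kind. One
    left outside only changes the sign of an imaginary value, and the sign is
    absorbed in a and b. *)
Lemma mobius_imq (M : Rinf R 4 -> Rinf R 4) s : mobius M ->
  exists a b c d, mx_inj a b c d /\
    forall x (y : 'rV[R]_3), M (Some (conj_if s x)) = Some (imq y) ->
      c * x + d != 0 /\ imq y = (a * x + b) * (c * x + d)^-1.
Proof.
move=> mM; have [s' [a [b [c [d [inj h]]]]]] := mobius_frac mM (is_frac_conj_if s).
exists (if s' then - a else a), (if s' then - b else b), c, d; split.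
  move=> X Y h1 h2; apply: inj => //; case: s' h1 {h} => //.
  by rewrite !mulNr -opprD => /eqP; rewrite oppr_eq0 => /eqP.
move=> x y; have := h x; rewrite /= => -> ; rewrite /frac; case: ifPn => // dn [] E.
split=> //; case: s' E {h} => /= E; last by rewrite E.
rewrite !mulNr -opprD mulNr; apply: oppr_inj; rewrite opprK -qconj_im ?imqE //.
by rewrite -E qconjK.
Qed.
End MobiusFractions.

(** * Products of a circle and an ellipse on a sphere *)

Section CircleProducts.
Variable R : realType.
Implicit Types (b c n o p r q w x z m T X Y Z : quat R) (e d : R).

(** X lies on the sphere or hyperplane sig = 0, which will be mapped to R^3;
    the second equation F = 0 cuts out a proper subset of it. *)
Definition sphere_quadric (sig : quat R -> R) (X : quat R -> Prop) : Prop :=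
  exists F : lifted R -> R, [/\ quad_form F, forall x, X x -> F (qlift x) = 0 &
    exists x1, sig x1 = 0 /\ F (qlift x1) != 0].

Lemma sphere_quadric_intro (sig : quat R -> R) (X : quat R -> Prop) F : quad_form F -> (forall x, X x -> F (qlift x) = 0) ->
  ((forall x, sig x = 0 -> F (qlift x) = 0) -> False) -> sphere_quadric sig X.
Proof.
move=> qF FX Fn; exists F; split=> //; apply: contrapT => h; apply: Fn => x sx.
by apply/eqP; apply: contraT => Fx; case: h; exists x.
Qed.

(** The hypothesis says that e |z|^2 + Re z + d = 0 is a genuine sphere or a
    hyperplane. It contains a sphere of dimension 2 of points with constant
    real part k; these serve to test whether a form vanishes on all of it. *)
Lemma sphere_slice e d : 0 < 1 - 4 * e * d -> exists k rho : R, 0 < rho /\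
  forall x1 x2 x3 : R, x1 ^+ 2 + x2 ^+ 2 + x3 ^+ 2 = 1 ->
   e * (k ^+ 2 + (rho * x1) ^+ 2 + (rho * x2) ^+ 2 + (rho * x3) ^+ 2) + k + d = 0.
Proof.
move=> h; have [->|e0] := eqVneq e 0.
  by exists (- d), 1; split=> // *; ring.
pose D := 1 - 4 * e * d.
exists (- (2 * e)^-1), (Num.sqrt D / (2 * `|e|)); split.
  by rewrite divr_gt0 ?sqrtr_gt0 // mulr_gt0 // normr_gt0.
move=> x1 x2 x3 hx; set s := _ / _.
have s2 : s ^+ 2 = D / (4 * e ^+ 2).
  by rewrite expr_div_n sqr_sqrtr ?ltW // exprMn real_normK ?num_real //; congr (_ / (_ * _)); ring.
transitivity (e * ((2 * e)^-1 ^+ 2 + s ^+ 2 * (x1 ^+ 2 + x2 ^+ 2 + x3 ^+ 2)) - (2 * e)^-1 + d).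
  by ring.
by rewrite hx s2 /D; field.
Qed.

Definition cplx (u v : R) : quat R := mkquat 0 u v 0 0.

Section NormalForm.
Variables (e d : R) (c p w1 w2 : quat R).
Let T (f1 f2 : R) : quat R := p + f1 *: w1 + f2 *: w2.
Let Zs z := exists e1 e2 f1 f2 : R, [/\ e1 ^+ 2 + e2 ^+ 2 = 1, f1 ^+ 2 + f2 ^+ 2 = 1
   & z = (cplx e1 e2 + c) * T f1 f2].
Let sig z := e * qdot z z + q0 z + d.
Hypothesis disc : 0 < 1 - 4 * e * d.
Hypothesis on_sig : forall z, Zs z -> sig z = 0.

(** The equation of the sphere is affine in (e1, e2) on the unit circle, so
    its three coefficients vanish. *)
Lemma coef_eqs f1 f2 : f1 ^+ 2 + f2 ^+ 2 = 1 -> let t := T f1 f2 in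
  [/\ q0 t + 2 * e * q0 c * qdot t t = 0, q1 t - 2 * e * q1 c * qdot t t = 0
    & e * (1 + qdot c c) * qdot t t + q0 (c * t) + d = 0].
Proof.
move=> hf t.
have E e1 e2 : e1 ^+ 2 + e2 ^+ 2 = 1 ->
    e * ((1 + qdot c c + 2 * (e1 * q0 c + e2 * q1 c)) * qdot t t)
      + (e1 * q0 t - e2 * q1 t) + q0 (c * t) + d = 0.
  move=> he; rewrite -(on_sig (z := (cplx e1 e2 + c) * t)); last by exists e1, e2, f1, f2.
  transitivity (e * ((e1 ^+ 2 + e2 ^+ 2 + qdot c c + 2 * (e1 * q0 c + e2 * q1 c)) * qdot t t)
      + (e1 * q0 t - e2 * q1 t) + q0 (c * t) + d); first by rewrite he.
  by rewrite /sig; move: (t) => t'; rewrite /qdot /cplx !qE; ring.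
have := E 1 0; have := E (-1) 0; have := E 0 1; have := E 0 (-1).
rewrite !expr0n /= expr1n sqrrN expr1n addr0 add0r.
move=> /(_ erefl) h1 /(_ erefl) h2 /(_ erefl) h3 /(_ erefl) h4.
by split; lra.
Qed.

Lemma lin_im_form : lin_form (fun v : lifted R => q1 v.1.2).
Proof. by lin_tac. Qed.

(** By [coef_eqs], <c, z> and <c i, z>, corrected by multiples of z0 + d = - e
    |z|^2, are up to sign - e1 z0 - e2 z1 and e2 z0 - e1 z1; so the sum of
    their squares is z0^2 + z1^2. The resulting form vanishes on the whole
    sphere only if c is a complex number of modulus 1. *)
Lemma generic_quadric : ~ (q2 c = 0 /\ q3 c = 0 /\ q0 c ^+ 2 + q1 c ^+ 2 = 1) ->
  sphere_quadric sig Zs.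
Proof.
move=> cgen.
pose L0 : lifted R -> R := lcoord 0 (c - qreal (2 * q0 c)) (- (2 * q0 c * d)).
pose ci : quat R := mkquat 0 (- q1 c) (q0 c) (q3 c) (- q2 c).
pose L1 : lifted R -> R := lcoord 0 (ci + qreal (2 * q1 c)) (2 * q1 c * d).
pose F (v : lifted R) : R := q0 v.1.2 * q0 v.1.2 + q1 v.1.2 * q1 v.1.2 - L0 v * L0 v - L1 v * L1 v.
have L0E z : L0 (qlift z) = qdot c z - 2 * q0 c * (q0 z + d).
  by rewrite /L0 /lcoord /qlift /qdot /= !qE; ring.
have L1E z : L1 (qlift z) = (- q1 c * q0 z + q0 c * q1 z + q3 c * q2 z - q2 c * q3 z)
    + 2 * q1 c * (q0 z + d).
  by rewrite /L1 /ci /lcoord /qlift /qdot /= !qE; ring.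
have FE z : F (qlift z) = q0 z * q0 z + q1 z * q1 z - L0 (qlift z) * L0 (qlift z)
    - L1 (qlift z) * L1 (qlift z) by [].
apply: (@sphere_quadric_intro _ _ F).
- rewrite /F; apply: quad_sub; first apply: quad_sub; first apply: quad_add.
  + by apply: quad_mul; lin_tac.
  + by apply: quad_mul; lin_tac.
  + by apply: quad_mul; exact: lin_lcoord.
  + by apply: quad_mul; exact: lin_lcoord.
- move=> z Zz; have sz := on_sig Zz; case: Zz => [e1 [e2 [f1 [f2 [he hf zE]]]]].
  have [t1 t2 _] := coef_eqs hf; set t := T f1 f2 in zE t1 t2.
  have zd : q0 z + d = - (e * qdot z z) by move: sz; rewrite /sig; lra.
  pose x2 := qdot (cplx e1 e2 + c) (cplx e1 e2 + c).
  have h0 : qdot c z + 2 * q0 c * (e * qdot z z) = - (e1 * q0 z + e2 * q1 z).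
    apply/eqP; rewrite -subr_eq0 opprK; apply/eqP.
    transitivity (x2 * (q0 t + 2 * e * q0 c * qdot t t)); last by rewrite t1 mulr0.
    by rewrite zE /x2 /cplx; move: (t) => t'; rewrite /qdot !qE; ring.
  have h1 : (- q1 c * q0 z + q0 c * q1 z + q3 c * q2 z - q2 c * q3 z)
      - 2 * q1 c * (e * qdot z z) = e2 * q0 z - e1 * q1 z.
    apply/eqP; rewrite -subr_eq0; apply/eqP.
    transitivity (x2 * (q1 t - 2 * e * q1 c * qdot t t)); last by rewrite t2 mulr0.
    by rewrite zE /x2 /cplx; move: (t) => t'; rewrite /qdot !qE; ring.
  rewrite FE L0E L1E zd !mulrN opprK h0 h1.
  transitivity ((q0 z ^+ 2 + q1 z ^+ 2) * (1 - (e1 ^+ 2 + e2 ^+ 2))); first by ring.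
  by rewrite he subrr mulr0.
- move=> hF; apply: cgen.
  (* testing on [sphere_slice] makes the form a polynomial on the unit
     sphere; two great circles and rational points on them suffice *)
  have [k [rho [rho0 slice]]] := sphere_slice disc.
  pose tau := k + 2 * d.
  have G (x1 x2 x3 : R) : x1 ^+ 2 + x2 ^+ 2 + x3 ^+ 2 = 1 ->
     k ^+ 2 + (rho * x1) ^+ 2
     - (rho * (q1 c * x1 + (q2 c * x2 + q3 c * x3)) - q0 c * tau) ^+ 2
     - (rho * (q0 c * x1 + (q3 c * x2 - q2 c * x3)) + q1 c * tau) ^+ 2 = 0.
    move=> hx; rewrite -(hF (mkquat 0 k (rho * x1) (rho * x2) (rho * x3))).
      by rewrite FE L0E L1E /tau /qdot !qE; ring.
    by apply: etrans (slice _ _ _ hx); rewrite /sig /qdot !qE; ring.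
  have r2 : rho ^+ 2 != 0 by rewrite expf_neq0 // gt_eqF.
  pose K := q2 c ^+ 2 + q3 c ^+ 2.
  have [K0|Kn] := eqVneq K 0.
    have [c20 c30] : q2 c = 0 /\ q3 c = 0.
      move/eqP: K0; rewrite /K paddr_eq0 ?sqr_ge0 // !expf_eq0 /= => /andP[/eqP -> /eqP ->].
      by [].
    split=> //; split=> //; apply: (mulfI r2).
    have := G 1 0 0; have := G 0 1 0; rewrite c20 c30 !expr0n !expr1n /= !addr0 add0r.
    by move=> /(_ erefl) g1 /(_ erefl) g2; lra.
  exfalso; pose s := Num.sqrt K.
  have Kp : 0 < K by rewrite lt_def Kn /K addr_ge0 ?sqr_ge0.
  have s2 : s ^+ 2 = K by rewrite sqr_sqrtr // ltW.
  have sn : s != 0 by apply: contra_neq Kn => s0; rewrite -s2 s0 expr0n.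
  have H (x1 y : R) : x1 ^+ 2 + y ^+ 2 = 1 ->
     k ^+ 2 + (rho * x1) ^+ 2 - (rho * (q1 c * x1 + s * y) - q0 c * tau) ^+ 2
     - (rho * (q0 c * x1) + q1 c * tau) ^+ 2 = 0.
    move=> hx; rewrite -(G x1 (q2 c / s * y) (q3 c / s * y)).
      have -> : q2 c * (q2 c / s * y) + q3 c * (q3 c / s * y) = s * y.
        transitivity (K / s * y); first by rewrite /K; ring.
        by rewrite -s2 expr2 mulfK.
      by ring.
    rewrite -addrA !exprMn -mulrDl -mulrDl -/K exprVn s2 mulfV // mul1r.
    exact: hx.
  have H' (x1 y : R) : x1 ^+ 2 + y ^+ 2 = 1 ->
     k ^+ 2 + (rho * x1) ^+ 2 - (rho * (q1 c * x1) - q0 c * tau) ^+ 2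
     - (rho * (q0 c * x1 + s * y) + q1 c * tau) ^+ 2 = 0.
    move=> hx; rewrite -(G x1 (q3 c / s * y) (- q2 c / s * y)).
      have -> : q3 c * (q3 c / s * y) - q2 c * (- q2 c / s * y) = s * y.
        transitivity (K / s * y); first by rewrite /K; ring.
        by rewrite -s2 expr2 mulfK.
      by ring.
    rewrite -addrA !exprMn sqrrN -mulrDl -mulrDl addrC [q3 c ^+ 2 + _]addrC -/K exprVn s2 mulfV // mul1r addrC.
    exact: hx.
  have hp : (3 / 5 : R) ^+ 2 + (4 / 5) ^+ 2 = 1 by field.
  have hm : (3 / 5 : R) ^+ 2 + (- (4 / 5)) ^+ 2 = 1 by field.
  have hp' : (- (3 / 5) : R) ^+ 2 + (4 / 5) ^+ 2 = 1 by field.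
  have hm' : (- (3 / 5) : R) ^+ 2 + (- (4 / 5)) ^+ 2 = 1 by field.
  have c10 : q1 c = 0.
    apply: (mulfI sn); apply: (mulfI r2); rewrite !mulr0.
    by move: (H _ _ hp) (H _ _ hm) (H _ _ hp') (H _ _ hm'); lra.
  have c00 : q0 c = 0.
    apply: (mulfI sn); apply: (mulfI r2); rewrite !mulr0.
    by move: (H' _ _ hp) (H' _ _ hm) (H' _ _ hp') (H' _ _ hm'); lra.
  have := H 1 0; rewrite c00 c10 expr1n expr0n /= addr0 => /(_ erefl).
  have : 0 <= k ^+ 2 by exact: sqr_ge0.
  have : 0 < rho ^+ 2 by rewrite exprn_gt0.
  by lra.
Qed.

(** When c is a complex number of modulus 1, |E + c|^2 = 2 <E + c, c>. If e =
    0, then T is orthogonal to 1 and i, hence so is z. If e <> 0, then c (z0 +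
    i z1) is a real multiple of E + c. This recovers the direction of E + c
    from z, and <nu, T> is constant for a vector nu orthogonal to the plane of
    T. Choosing nu orthogonal to i times the conjugate of c as well makes the
    form nonzero. *)
Lemma degenerate_quadric : q2 c = 0 -> q3 c = 0 -> q0 c ^+ 2 + q1 c ^+ 2 = 1 ->
  sphere_quadric sig Zs.
Proof.
move=> c2 c3 c01.
have [k [rho [rho0 slice]]] := sphere_slice disc.
have rn : rho != 0 by rewrite gt_eqF.
have on (x1 x2 x3 : R) : x1 ^+ 2 + x2 ^+ 2 + x3 ^+ 2 = 1 ->
    sig (mkquat 0 k (rho * x1) (rho * x2) (rho * x3)) = 0.
  by move=> hx; apply: etrans (slice _ _ _ hx); rewrite /sig /qdot !qE; ring.
have u1 : (1 : R) ^+ 2 + 0 ^+ 2 + 0 ^+ 2 = 1 by ring.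
have u2 : (0 : R) ^+ 2 + 1 ^+ 2 + 0 ^+ 2 = 1 by ring.
have u2' : (0 : R) ^+ 2 + (-1) ^+ 2 + 0 ^+ 2 = 1 by ring.
have u3 : (0 : R) ^+ 2 + 0 ^+ 2 + 1 ^+ 2 = 1 by ring.
have u3' : (0 : R) ^+ 2 + 0 ^+ 2 + (-1) ^+ 2 = 1 by ring.
have [e0|en] := eqVneq e 0.
  apply: (@sphere_quadric_intro _ _ (fun v => v.2 * q1 v.1.2)).
  - by apply: quad_mul; [exact: lin_W|exact: lin_im_form].
  - move=> _ [e1 [e2 [f1 [f2 [he hf ->]]]]]; have [t1 t2 _] := coef_eqs hf.
    set t := T f1 f2 in t1 t2 *; rewrite e0 mulr0 !mul0r addr0 in t1.
    rewrite e0 mulr0 !mul0r subr0 in t2.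
    rewrite /= mul1r /cplx; move: (t) t1 t2 => t' t1 t2.
    by rewrite !qE t1 t2 c2 c3; ring.
  - move=> hF; have := hF _ (on _ _ _ u1); rewrite /= mul1r !qE mulr1 => r0.
    by rewrite r0 eqxx in rn.
have c2n : qdot c c = 1 by rewrite -c01 /qdot c2 c3; ring.
have d0 : d = 0.
  have h : (1 : R) ^+ 2 + 0 ^+ 2 = 1 by ring.
  have [t1 t2 t3] := coef_eqs h; set t := T 1 0 in t1 t2 t3.
  have := t3; rewrite c2n; have -> : q0 (c * t) = q0 c * q0 t - q1 c * q1 t.
    by move: (t) => t'; rewrite !qE c2 c3; ring.
  have -> : q0 t = - (2 * e * q0 c * qdot t t) by move: t1; lra.
  have -> : q1 t = 2 * e * q1 c * qdot t t by move: t2; lra.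
  move: (qdot t t) => N E.
  transitivity (e * (1 + 1) * N + (q0 c * - (2 * e * q0 c * N) - q1 c * (2 * e * q1 c * N)) + d
    - 2 * e * N * (1 - (q0 c ^+ 2 + q1 c ^+ 2))); first by ring.
  by rewrite E c01; ring.
have ek : e * (k ^+ 2 + rho ^+ 2) + k = 0.
  by move: (slice _ _ _ u1); rewrite d0; lra.
have kn : k != 0.
  apply: contra_neq rn => k0; move: ek; rewrite k0 expr0n addr0 add0r => /eqP.
  by rewrite mulf_eq0 (negbTE en) expf_eq0 /= => /eqP.
have [nu [nun nu1 nu2 nu3]] := perp_exists w1 w2 (cplx (q1 c) (q0 c)).
pose a : lifted R -> R := lcoord 0 (cplx (q0 c) (- q1 c)) 0.
pose b : lifted R -> R := lcoord 0 (cplx (q1 c) (q0 c)) 0.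
pose inu : quat R := mkquat 0 (q1 nu) (- q0 nu) (q3 nu) (- q2 nu).
pose F (v : lifted R) : R := a v * lcoord 0 nu 0 v - b v * lcoord 0 inu 0 v
   - v.2 * (2 * qdot nu p * q0 v.1.2).
have FE z : F (qlift z) = (q0 c * q0 z - q1 c * q1 z) * qdot nu z
    - (q1 c * q0 z + q0 c * q1 z)
      * (q1 nu * q0 z - q0 nu * q1 z + q3 nu * q2 z - q2 nu * q3 z)
    - 2 * qdot nu p * q0 z.
  rewrite /F /a /b /lcoord /qlift /=; congr (_ * _ - _ * _ - _).
  - by rewrite /qdot /cplx !qE; ring.
  - by ring.
  - by rewrite /qdot /cplx !qE; ring.
  - by rewrite /inu /qdot !qE; ring.
  - by rewrite mul1r.
apply: (@sphere_quadric_intro _ _ F).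
- rewrite /F; apply: quad_sub; first apply: quad_sub.
  + by apply: quad_mul; exact: lin_lcoord.
  + by apply: quad_mul; exact: lin_lcoord.
  + by apply: quad_mul; [exact: lin_W|lin_tac].
- move=> _ [e1 [e2 [f1 [f2 [he hf ->]]]]]; have [t1 t2 _] := coef_eqs hf.
  set t := T f1 f2 in t1 t2 *; rewrite FE.
  have nt : qdot nu t = qdot nu p.
    transitivity (qdot nu p + f1 * qdot nu w1 + f2 * qdot nu w2).
      by rewrite /t /T /qdot !qE; ring.
    by rewrite nu1 nu2 !mulr0 !addr0.
  have ht1 : q0 t = - (2 * e * q0 c * qdot t t) by move: t1; lra.
  have ht2 : q1 t = 2 * e * q1 c * qdot t t by move: t2; lra.
  set N := qdot t t in ht1 ht2; clearbody N; clear t1 t2; clearbody t.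
  pose X0 := e1 + q0 c; pose X1 := e2 + q1 c.
  have XE : cplx e1 e2 + c = cplx X0 X1.
    by apply: quatP; rewrite /cplx !qE ?c2 ?c3 ?addr0.
  have X2 : X0 ^+ 2 + X1 ^+ 2 = 2 * (X0 * q0 c + X1 * q1 c).
    apply/eqP; rewrite -subr_eq0; apply/eqP.
    transitivity ((e1 ^+ 2 + e2 ^+ 2) - (q0 c ^+ 2 + q1 c ^+ 2)); first by rewrite /X0 /X1; ring.
    by rewrite he c01 subrr.
  rewrite XE; clearbody X0 X1; set z := cplx X0 X1 * t.
  have z0 : q0 z = - (e * N * (X0 ^+ 2 + X1 ^+ 2)).
    rewrite X2 /z /cplx !qE ht1 ht2; ring.
  have az : q0 c * q0 z - q1 c * q1 z = - (2 * e * N * X0).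
    transitivity (- (2 * e * N * (X0 * (q0 c ^+ 2 + q1 c ^+ 2)))); last by rewrite c01 mulr1.
    by rewrite /z /cplx !qE ht1 ht2; ring.
  have bz : q1 c * q0 z + q0 c * q1 z = - (2 * e * N * X1).
    transitivity (- (2 * e * N * (X1 * (q0 c ^+ 2 + q1 c ^+ 2)))); last by rewrite c01 mulr1.
    by rewrite /z /cplx !qE ht1 ht2; ring.
  have nz : X0 * qdot nu z - X1 * (q1 nu * q0 z - q0 nu * q1 z + q3 nu * q2 z - q2 nu * q3 z)
      = (X0 ^+ 2 + X1 ^+ 2) * qdot nu t.
    by rewrite /z /cplx /qdot !qE; ring.
  rewrite az bz -nt.
  transitivity (- (2 * e * N) * (X0 * qdot nu z - X1 * (q1 nu * q0 z - q0 nu * q1 z + q3 nu * q2 z - q2 nu * q3 z))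
    - 2 * qdot nu t * q0 z); first by ring.
  by rewrite nz z0; ring.
- move=> hF.
  have G (x1 x2 x3 : R) : x1 ^+ 2 + x2 ^+ 2 + x3 ^+ 2 = 1 ->
    (q0 c * k - q1 c * (rho * x1)) * (q0 nu * k + q1 nu * (rho * x1) + q2 nu * (rho * x2)
        + q3 nu * (rho * x3))
    - (q1 c * k + q0 c * (rho * x1)) * (q1 nu * k - q0 nu * (rho * x1)
        + q3 nu * (rho * x2) - q2 nu * (rho * x3)) - 2 * qdot nu p * k = 0.
    by move=> /on/hF <-; rewrite FE [qdot nu (mkquat _ _ _ _ _)]/qdot !qE; ring.
  have g1 := G _ _ _ u1; have g2 := G _ _ _ u2; have g2' := G _ _ _ u2'.
  have g3 := G _ _ _ u3; have g3' := G _ _ _ u3'.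
  have m1 : q0 c * q2 nu - q1 c * q3 nu = 0.
    apply: (mulfI kn); apply: (mulfI rn); rewrite !mulr0.
    by move: g2 g2'; lra.
  have m2 : q0 c * q3 nu + q1 c * q2 nu = 0.
    apply: (mulfI kn); apply: (mulfI rn); rewrite !mulr0.
    by move: g3 g3'; lra.
  have n2 : q2 nu = 0.
    transitivity ((q0 c ^+ 2 + q1 c ^+ 2) * q2 nu); first by rewrite c01 mul1r.
    transitivity (q0 c * (q0 c * q2 nu - q1 c * q3 nu) + q1 c * (q0 c * q3 nu + q1 c * q2 nu)).
      by ring.
    by rewrite m1 m2; ring.
  have n3 : q3 nu = 0.
    transitivity ((q0 c ^+ 2 + q1 c ^+ 2) * q3 nu); first by rewrite c01 mul1r.
    transitivity (q0 c * (q0 c * q3 nu + q1 c * q2 nu) - q1 c * (q0 c * q2 nu - q1 c * q3 nu)).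
      by ring.
    by rewrite m1 m2; ring.
  have m3 : q0 c * q0 nu - q1 c * q1 nu = 0.
    apply: (mulfI rn); apply: (mulfI rn); rewrite !mulr0.
    by move: g1 g2; rewrite n2 n3; lra.
  have m4 : q0 nu * q1 c + q1 nu * q0 c = 0.
    by rewrite -nu3 /cplx /qdot !qE; ring.
  have n0 : q0 nu = 0.
    transitivity ((q0 c ^+ 2 + q1 c ^+ 2) * q0 nu); first by rewrite c01 mul1r.
    transitivity (q0 c * (q0 c * q0 nu - q1 c * q1 nu) + q1 c * (q0 nu * q1 c + q1 nu * q0 c)).
      by ring.
    by rewrite m3 m4; ring.
  have n1 : q1 nu = 0.
    transitivity ((q0 c ^+ 2 + q1 c ^+ 2) * q1 nu); first by rewrite c01 mul1r.
    transitivity (q0 c * (q0 nu * q1 c + q1 nu * q0 c) - q1 c * (q0 c * q0 nu - q1 c * q1 nu)).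
      by ring.
    by rewrite m3 m4; ring.
  by move: nun; rewrite -qdot_eq0 /qdot n0 n1 n2 n3 !mul0r !addr0 eqxx.
Qed.

End NormalForm.
End CircleProducts.

Section CircleSurfaces.
Variable R : realType.
Implicit Types (a b c n o p r q w x z m v X Y Z g : quat R) (e d : R).

Lemma normal_quadric e d c p w1 w2 :
  let Zs z := exists e1 e2 f1 f2 : R, [/\ e1 ^+ 2 + e2 ^+ 2 = 1, f1 ^+ 2 + f2 ^+ 2 = 1
   & z = (cplx e1 e2 + c) * (p + f1 *: w1 + f2 *: w2)] in
  let sig z := e * qdot z z + q0 z + d in
  0 < 1 - 4 * e * d -> (forall z, Zs z -> sig z = 0) -> sphere_quadric sig Zs.
Proof.
move=> Zs sig disc on.
have [[c2 [c3 c01]]|cgen] := pselect (q2 c = 0 /\ q3 c = 0 /\ q0 c ^+ 2 + q1 c ^+ 2 = 1).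
  exact: degenerate_quadric.
exact: generic_quadric.
Qed.

(** When m is an imaginary unit, these points form a complex subfield. *)
Definition circ m (e1 e2 : R) : quat R := qreal e1 + e2 *: m.

Lemma unit_im_conj m : q0 m = 0 -> qdot m m = 1 -> exists g, g != 0 /\ g * cplx 0 1 = m * g.
Proof.
move=> m0 m1; have [mi|mi] := eqVneq (m + cplx 0 1) 0.
  exists (mkquat 0 0 0 1 0); split.
    by rewrite -qdot_eq0 /qdot !qE mulr1 !mul0r !add0r addr0 oner_eq0.
  have -> : m = - cplx 0 1 by apply/eqP; rewrite -addr_eq0 mi.
  by apply: quatP; rewrite /cplx !qE; ring.
exists (m + cplx 0 1); split=> //.
have mm : m * m = - 1.
  by rewrite -[X in m * X]opprK -(qconj_im m0) mulrN qmul_conj m1.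
have ii : cplx 0 1 * cplx 0 1 = (- 1 : quat R) by apply: quatP; rewrite /cplx !qE; ring.
by rewrite mulrDl mulrDr mm ii addrC.
Qed.

(** With n = 1 + 2 e o, the similarity x |-> g^-1 (x - o) conj(n) g, where g
    conjugates m to i, maps the sphere e |x|^2 + Re x = 0 to one of the form
    e' |z|^2 + Re z + d = 0 with discriminant 1 / |n|^2, and the circle of E
    to that of i. *)
Lemma product_quadric e m o c p w1 w2 :
  let Xs x := exists e1 e2 f1 f2 : R, [/\ e1 ^+ 2 + e2 ^+ 2 = 1, f1 ^+ 2 + f2 ^+ 2 = 1
   & x = o + (circ m e1 e2 + c) * (p + f1 *: w1 + f2 *: w2)] in
  let sig x := e * qdot x x + q0 x in
  q0 m = 0 -> qdot m m = 1 -> 1 + (2 * e) *: o != 0 ->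
  (forall x, Xs x -> sig x = 0) -> sphere_quadric sig Xs.
Proof.
move=> Xs sig m0 m1 nn on; set n := 1 + _ in nn.
have [g [gn gi]] := unit_im_conj m0 m1.
have [h hg gh] : exists2 h, h * g = 1 & g * h = 1 by exists g^-1; [exact: qVmul|exact: qmulV].
have nbn : qconj n != 0 by rewrite -qnormsq_eq0 qnormsq_conj qnormsq_eq0.
have [nbi nbE] : exists nbi, nbi * qconj n = 1 by exists (qconj n)^-1; exact: qVmul.
pose N := qdot n n.
have Np : 0 < N by exact: qdot_gt0.
have Nn : N != 0 by rewrite gt_eqF.
pose phi x := h * (x - o) * qconj n * g.
pose d := e * qdot o o + q0 o.
pose sig' z := e / N * qdot z z + q0 z + d.
have phi_norm x : qdot (phi x) (phi x) = N * qdot (x - o) (x - o).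
  have gh1 : qnormsq h * qnormsq g = 1 by rewrite -qnormsqM hg qnormsqE !qE; ring.
  rewrite -!qnormsq_dot /phi !qnormsqM qnormsq_conj.
  transitivity (qnormsq h * qnormsq g * (qnormsq n * qnormsq (x - o))); first by ring.
  by rewrite gh1 mul1r /N qnormsq_dot.
have sigE x : sig' (phi x) = sig x.
  rewrite /sig' /sig phi_norm.
  have -> : q0 (phi x) = qdot n (x - o).
    by rewrite /phi q0_cycle !mulrA gh mul1r /qdot !qE; ring.
  rewrite mulrA divfK // /d /n /qdot !qE; ring.
have phiE e1 e2 f1 f2 : phi (o + (circ m e1 e2 + c) * (p + f1 *: w1 + f2 *: w2)) =
   (cplx e1 e2 + h * c * g) * (h * p * qconj n * g + f1 *: (h * w1 * qconj n * g)
     + f2 *: (h * w2 * qconj n * g)).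
  have hmg : h * m * g = cplx 0 1 by rewrite -mulrA -gi mulrA hg mul1r.
  have -> : cplx e1 e2 + h * c * g = h * (circ m e1 e2 + c) * g.
    rewrite mulrDr mulrDl /circ mulrDr mulrDl qscaleAr qscaleAl hmg qmul_real qscaleAl hg.
    by congr (_ + _); apply: quatP; rewrite /cplx !qE; ring.
  have -> : h * p * qconj n * g + f1 *: (h * w1 * qconj n * g)
     + f2 *: (h * w2 * qconj n * g) = h * (p + f1 *: w1 + f2 *: w2) * qconj n * g.
    by rewrite !mulrDr !mulrDl !qscaleAr !qscaleAl.
  rewrite /phi (addrC o) addrK; move: (circ m e1 e2 + c) (p + _ + _) => X T.
  have -> : h * X * g * (h * T * qconj n * g) = h * X * (g * h) * T * qconj n * g by rewrite !mulrA.
  by rewrite gh mulr1 !mulrA.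
have disc : 0 < 1 - 4 * (e / N) * d.
  have E : N * (1 - 4 * (e / N) * d) = 1.
    rewrite mulrBr mulr1 /d; transitivity (N - 4 * e * (e * qdot o o + q0 o)).
      by field.
    by rewrite /N /n /qdot !qE; ring.
  by rewrite -(pmulr_rgt0 _ Np) E ltr01.
have [|F [qF FZ [z1 [s1 Fz1]]]] := @normal_quadric (e / N) d (h * c * g)
    (h * p * qconj n * g) (h * w1 * qconj n * g) (h * w2 * qconj n * g) disc.
  move=> z [e1 [e2 [f1 [f2 [he hf ->]]]]]; rewrite -phiE -/(sig' _) sigE.
  by apply: on; exists e1, e2, f1, f2.
pose Lam (v : lifted R) : lifted R :=
  (N * (v.1.1 - 2 * qdot o v.1.2 + qdot o o * v.2),
   h * (v.1.2 - v.2 *: o) * qconj n * g, v.2).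
have LamE x : Lam (qlift x) = qlift (phi x).
  rewrite /Lam /qlift /= scale1r -/(phi x) !qnormsq_dot phi_norm; congr (_ * _, _, _).
  by rewrite /qdot !qE; ring.
have linL : lin_map Lam.
  split=> [[[t Y] W] [[t' Y'] W']|k [[t Y] W]]; rewrite /Lam /ladd /lscale /=;
    congr (_, _, _).
  - by rewrite /qdot !qE; ring.
  - by rewrite scalerDl opprD addrACA mulrDr !mulrDl.
  - by rewrite /qdot !qE; ring.
  - by rewrite -scalerA -scalerBr qscaleAr !qscaleAl.
exists (F \o Lam); split.
- exact: quad_comp.
- move=> _ [e1 [e2 [f1 [f2 [he hf ->]]]]]; rewrite /= LamE phiE; apply: FZ.
  by exists e1, e2, f1, f2.
- exists (o + g * z1 * h * nbi).
  have E : phi (o + g * z1 * h * nbi) = z1.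
    rewrite /phi (addrC o) addrK !mulrA hg mul1r -[z1 * h * nbi * _]mulrA nbE mulr1.
    by rewrite -mulrA hg mulr1.
  by rewrite /= LamE -sigE E.
Qed.
(** The points where the line through the centre - 1/(2 e) in the direction w
    meets the sphere. *)
Lemma sphere_points e w : e != 0 -> w != 0 -> exists2 s : R, s != 0 &
  forall s', s' ^+ 2 = s ^+ 2 ->
    let x := qreal (- (2 * e)^-1) + s' *: w in e * qdot x x + q0 x = 0.
Proof.
move=> e0 w0; have wp : 0 < qdot w w by exact: qdot_gt0.
have s2 : (Num.sqrt (qdot w w)) ^+ 2 = qdot w w by rewrite sqr_sqrtr // ltW.
exists (2 * e * Num.sqrt (qdot w w))^-1.
  by rewrite invr_eq0 !mulf_neq0 // ?pnatr_eq0 // gt_eqF // sqrtr_gt0.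
move=> s' hs x.
transitivity (e * (- (2 * e)^-1) ^+ 2 - (2 * e)^-1 + s' ^+ 2 * (e * qdot w w)
   + s' * q0 w * (1 - 2 * e * (2 * e)^-1)).
  by rewrite /x /qdot !qE; ring.
rewrite hs exprVn exprMn s2 mulfV ?mulf_neq0 ?pnatr_eq0 //.
by field; rewrite e0 gt_eqF.
Qed.

(** The sphere or hyperplane sig = 0 is contained in no hyperplane other than
    itself. *)
Lemma flat_quadric e b v (X : quat R -> Prop) :
  v != 0 -> (forall x, X x -> qdot v (x - b) = 0) -> (e = 0 -> q0 v = 0 /\ q0 b = 0) ->
  sphere_quadric (fun x => e * qdot x x + q0 x) X.
Proof.
move=> vn hX h0.
apply: (@sphere_quadric_intro _ _ _ (fun u => u.2 * lcoord 0 v (- qdot v b) u)).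
- by apply: quad_mul; [exact: lin_W|exact: lin_lcoord].
- move=> x /hX hx; rewrite -[RHS]hx /lcoord /qlift /qdot /= !qE; ring.
- move=> hF; have vv : qdot v v != 0 by rewrite qdot_eq0.
  have {}hF x : e * qdot x x + q0 x = 0 -> qdot v x = qdot v b.
    by move=> /hF; rewrite /lcoord /qlift /= mul0r add0r !mul1r mulr1 => /eqP; rewrite subr_eq0 => /eqP.
  have [e0|en] := eqVneq e 0.
    have [v0 b0] := h0 e0; have := hF (b + v).
    rewrite e0 mul0r add0r !qE v0 b0 addr0 => /(_ erefl) E.
    move/negP: vv; apply; apply/eqP; transitivity (qdot v (b + v) - qdot v b).
      by rewrite /qdot !qE; ring.
    by rewrite E subrr.
  have [s sn hs] := sphere_points en vn.
  have h1 := hF _ (hs s erefl); have h2 := hF _ (hs (- s) (sqrrN s)).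
  have : 2 * s * qdot v v = 0.
    transitivity (qdot v (qreal (- (2 * e)^-1) + s *: v) - qdot v (qreal (- (2 * e)^-1) + - s *: v)).
      by rewrite /qdot !qE; ring.
    by rewrite h1 h2 subrr.
  by move/eqP; rewrite !mulf_eq0 pnatr_eq0 (negbTE sn) (negbTE vv).
Qed.

(** If p = 0 or, for e = 0, q = 0, the surface lies in a hyperplane. Otherwise
    e <> 0, and the coefficient of E in the equation of the sphere makes p and
    m p orthogonal to q F; so x - b has the projection E p to the plane of p
    and m p, and the form is <p, x - b>^2 + <m p, x - b>^2 - |p|^4. *)
Lemma sum_quadric e m m' b p q :
  let Xs x := exists e1 e2 f1 f2 : R, [/\ e1 ^+ 2 + e2 ^+ 2 = 1, f1 ^+ 2 + f2 ^+ 2 = 1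
   & x = b + circ m e1 e2 * p + q * circ m' f1 f2] in
  let sig x := e * qdot x x + q0 x in
  q0 m = 0 -> qdot m m = 1 -> (forall x, Xs x -> sig x = 0) ->
  ~ [/\ e = 0, p != 0 & q != 0] -> sphere_quadric sig Xs.
Proof.
move=> Xs sig m0 m1 on ncirc.
have [u10 u10' u01 u01'] := axis_points R.
pose pt (e1 e2 f1 f2 : R) := b + (e1 *: p + e2 *: (m * p)) + (f1 *: q + f2 *: (q * m')).
have ptE e1 e2 f1 f2 : b + circ m e1 e2 * p + q * circ m' f1 f2 = pt e1 e2 f1 f2.
  by rewrite /circ mulrDl mulrDr qreal_mul qmul_real qscaleAl qscaleAr.
have onpt e1 e2 f1 f2 : e1 ^+ 2 + e2 ^+ 2 = 1 -> f1 ^+ 2 + f2 ^+ 2 = 1 ->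
    sig (pt e1 e2 f1 f2) = 0.
  by move=> he hf; apply: on; exists e1, e2, f1, f2; rewrite ptE.
have b0 : e = 0 -> q0 b = 0.
  move=> e0; have := onpt _ _ _ _ u10 u10; have := onpt _ _ _ _ u10' u10'.
  by rewrite /sig e0 !mul0r !add0r /pt !qE; lra.
have [p0|pn] := eqVneq p 0.
  have [v [vn v1 vq vqm]] := perp_exists 1 q (q * m').
  apply: (@flat_quadric _ b v) => // [x [e1 [e2 [f1 [f2 [he hf ->]]]]]|/b0 ?].
    rewrite ptE /pt p0; transitivity (f1 * qdot v q + f2 * qdot v (q * m')).
      by rewrite mulr0; move: (q * m') => qm; rewrite /qdot !qE; ring.
    by rewrite vq vqm !mulr0 addr0.
  by split=> //; rewrite -v1 /qdot !qE; ring.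
have mp : qdot p (m * p) = 0 by rewrite /qdot !qE m0; ring.
have mpn : qdot (m * p) (m * p) = qdot p p.
  by rewrite -!qnormsq_dot qnormsqM [qnormsq m]qnormsq_dot m1 mul1r.
have [e0|en] := eqVneq e 0.
  have [q0'|qn] := eqVneq q 0; last by case: ncirc.
  have [v [vn v1 vp vmp]] := perp_exists 1 p (m * p).
  apply: (@flat_quadric _ b v) => // [x [e1 [e2 [f1 [f2 [he hf ->]]]]]|/b0 ?].
    rewrite ptE /pt q0'; transitivity (e1 * qdot v p + e2 * qdot v (m * p)).
      by rewrite mul0r; move: (m * p) => qm; rewrite /qdot !qE; ring.
    by rewrite vp vmp !mulr0 addr0.
  by split=> //; rewrite -v1 /qdot !qE; ring.
have orth (w : quat R) : (forall f1 f2, f1 ^+ 2 + f2 ^+ 2 = 1 ->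
    2 * e * qdot w (b + (f1 *: q + f2 *: (q * m'))) + q0 w = 0) ->
    qdot w q = 0 /\ qdot w (q * m') = 0.
  move=> h; have dD f1 f2 : qdot w (b + (f1 *: q + f2 *: (q * m'))) =
     qdot w b + f1 * qdot w q + f2 * qdot w (q * m').
    by move: (q * m') => qm; rewrite /qdot !qE; ring.
  have := h _ _ u10; have := h _ _ u10'; have := h _ _ u01; have := h _ _ u01'.
  rewrite !dD => h1 h2 h3 h4; split; apply: (mulfI en); rewrite mulr0; lra.
have nsq e1 e2 f1 f2 : e1 ^+ 2 + e2 ^+ 2 = 1 -> let y := b + (f1 *: q + f2 *: (q * m')) in
   sig (pt e1 e2 f1 f2) = e * (qdot y y + qdot p p) + q0 y
     + e1 * (2 * e * qdot p y + q0 p) + e2 * (2 * e * qdot (m * p) y + q0 (m * p)).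
  move=> he y; have -> : pt e1 e2 f1 f2 = y + (e1 *: p + e2 *: (m * p)).
    by rewrite /pt /y addrAC.
  move: (y) mp mpn => {}y; move: (m * p) => mp' h1 h2.
  transitivity (e * (qdot y y + (e1 ^+ 2 * qdot p p + e2 ^+ 2 * qdot mp' mp'
      + 2 * e1 * e2 * qdot p mp')) + q0 y
     + e1 * (2 * e * qdot p y + q0 p) + e2 * (2 * e * qdot mp' y + q0 mp')).
    by rewrite /sig /qdot !qE; ring.
  by rewrite h1 h2 mulr0 addr0 -mulrDl he mul1r.
have [pq pqm] : qdot p q = 0 /\ qdot p (q * m') = 0.
  apply: orth => f1 f2 hf; have := onpt _ _ _ _ u10 hf; have := onpt _ _ _ _ u10' hf.
  by rewrite !nsq //; lra.
have [mpq mpqm] : qdot (m * p) q = 0 /\ qdot (m * p) (q * m') = 0.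
  apply: orth => f1 f2 hf; have := onpt _ _ _ _ u01 hf; have := onpt _ _ _ _ u01' hf.
  by rewrite !nsq //; lra.
pose A : lifted R -> R := lcoord 0 p (- qdot p b).
pose B : lifted R -> R := lcoord 0 (m * p) (- qdot (m * p) b).
have AE x : A (qlift x) = qdot p x - qdot p b by rewrite /A /lcoord /qlift /=; ring.
have BE x : B (qlift x) = qdot (m * p) x - qdot (m * p) b by rewrite /B /lcoord /qlift /=; ring.
have pp : qdot p p != 0 by rewrite qdot_eq0.
pose F (v : lifted R) : R := A v * A v + B v * B v - v.2 * (qdot p p ^+ 2 * v.2).
refine (@sphere_quadric_intro R sig Xs F _ _ _).
- rewrite /F; apply: quad_sub; first apply: quad_add.
  + by apply: quad_mul; exact: lin_lcoord.
  + by apply: quad_mul; exact: lin_lcoord.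
  + by apply: quad_mul; [exact: lin_W|move: (qdot p p) => k; split=> *; rewrite /=; ring].
- move=> x [e1 [e2 [f1 [f2 [he hf ->]]]]]; rewrite ptE /F AE BE /=.
  have -> : qdot p (pt e1 e2 f1 f2) - qdot p b = e1 * qdot p p.
    transitivity (e1 * qdot p p + e2 * qdot p (m * p) + f1 * qdot p q + f2 * qdot p (q * m')).
      by rewrite /pt; move: (m * p) (q * m') => ? ?; rewrite /qdot !qE; ring.
    by rewrite mp pq pqm !mulr0 !addr0.
  have -> : qdot (m * p) (pt e1 e2 f1 f2) - qdot (m * p) b = e2 * qdot p p.
    transitivity (e1 * qdot p (m * p) + e2 * qdot (m * p) (m * p) + f1 * qdot (m * p) q
       + f2 * qdot (m * p) (q * m')).
      by rewrite /pt; move: (m * p) (q * m') => ? ?; rewrite /qdot !qE; ring.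
    by rewrite mp mpn mpq mpqm !mulr0 !addr0 add0r.
  transitivity ((e1 ^+ 2 + e2 ^+ 2 - 1) * qdot p p ^+ 2); first by ring.
  by rewrite he subrr mul0r.
- move=> hF; have [s sn hs] := sphere_points en pn.
  have [v [vn _ vp vmp]] := perp_exists 0 p (m * p).
  have [s' s'n hs'] := sphere_points en vn.
  have h1 := hF _ (hs s erefl); have h2 := hF _ (hs (- s) (sqrrN s)).
  have h3 := hF _ (hs' s' erefl).
  set k := qreal _ in h1 h2 h3.
  have E1 (t : R) : qdot p (k + t *: p) = qdot p k + t * qdot p p by rewrite /qdot !qE; ring.
  have E2 (t : R) : qdot (m * p) (k + t *: p) = qdot (m * p) k.
    transitivity (qdot (m * p) k + t * qdot p (m * p)); last by rewrite mp mulr0 addr0.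
    by move: (m * p) (k) => ? ?; rewrite /qdot !qE; ring.
  have E3 (t : R) : qdot p (k + t *: v) = qdot p k.
    transitivity (qdot p k + t * qdot v p); last by rewrite vp mulr0 addr0.
    by move: (k) => ?; rewrite /qdot !qE; ring.
  have E4 (t : R) : qdot (m * p) (k + t *: v) = qdot (m * p) k.
    transitivity (qdot (m * p) k + t * qdot v (m * p)); last by rewrite vmp mulr0 addr0.
    by move: (m * p) (k) => ? ?; rewrite /qdot !qE; ring.
  rewrite /F !AE !BE !E1 !E2 !E3 !E4 in h1 h2 h3.
  have : (s * qdot p p) ^+ 2 = 0 by move: h1 h2 h3; rewrite /=; lra.
  by move/eqP; rewrite expf_eq0 /= mulf_eq0 (negbTE sn) (negbTE pp).
Qed.
End CircleSurfaces.

(** * From quadrics and sums of circles to surfaces in space *)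

Section Conclusions.
Variable R : realType.
Implicit Types (a b c n o p r q w x m v Y g : quat R) (e d : R) (X : quat R -> Prop) (S : set 'rV[R]_3).

Definition sum_surface S : Prop := exists al be : set 'rV[R]_3,
     [/\ is_circle al, is_circle be &
         mobius_of_subset (Some @` S) (Some @` sum_set al be)].

Lemma cyclide_surface_affine S X : S !=set0 -> sphere_quadric (fun x => 0 * qdot x x + q0 x) X ->
  (forall y, S y -> X (imq y)) -> cyclide_surface S.
Proof.
move=> Sn [F [qF FX [x1 [s1 Fx1]]]] SX.
apply: (cyclide_intro qF Sn) => [y /SX/FX //|].
exists (qlift x1); split=> //; first by move: s1; rewrite mul0r add0r.
by rewrite /null_lift /= mulr1.
Qed.

(** The map x |-> b + x^-1 acts linearly on lifts, as x^-1 is the conjugate of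
    x over |x|^2. *)
Lemma cyclide_surface_inverse S X b : S !=set0 ->
  sphere_quadric (fun x => q0 b * qdot x x + q0 x) X ->
  (forall y, S y -> exists x, [/\ X x, x != 0 & imq y = b + x^-1]) -> cyclide_surface S.
Proof.
move=> Sn [F [qF FX [x1 [s1 Fx1]]]] SX.
pose Lam (v : lifted R) : lifted R :=
  (v.2, qconj (v.1.2 - v.2 *: b), v.1.1 - 2 * qdot b v.1.2 + qdot b b * v.2).
have linL : lin_map Lam.
  split=> [[[t Y] W] [[t' Y'] W']|k [[t Y] W]]; rewrite /Lam /ladd /lscale /=;
    congr (_, _, _); try (by apply: quatP; rewrite !qE; ring); by rewrite /qdot !qE; ring.
apply: (cyclide_intro (quad_comp linL qF) Sn).
- move=> y /SX[x [Xx xn yE]].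
  have xx : qdot x x != 0 by rewrite qdot_eq0.
  have wE : imq y - b = (qdot x x)^-1 *: qconj x.
    by rewrite yE addrC addKr qinvE qnormsq_dot.
  have -> : (F \o Lam) (qlift (imq y)) = F (lscale (qdot x x)^-1 (qlift x)).
    congr F; rewrite /Lam /lscale /qlift /= scale1r wE !qnormsq_dot mulr1; congr (_, _, _).
    - by rewrite mulVf.
    - by apply: quatP; rewrite !qE; ring.
    - transitivity (qdot (imq y - b) (imq y - b)); first by rewrite /qdot !qE; ring.
      rewrite wE; transitivity ((qdot x x)^-1 ^+ 2 * qdot x x).
        by move: (_^-1) => k; rewrite /qdot !qE; ring.
      by rewrite expr2 -mulrA mulVf // mulr1.
  by rewrite quad_scale // FX // mulr0.
- pose W := qdot x1 x1; pose Y := qconj x1 + W *: b.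
  exists (1 + 2 * qdot b Y - qdot b b * W, Y, W); split.
  + by rewrite /= /Y !qE -[RHS]s1 /W; ring.
  + rewrite /null_lift /= qnormsq_dot /Y.
    transitivity (W + 2 * W * qdot b (qconj x1) + W ^+ 2 * qdot b b).
      by move: (qconj x1) (W) => ? ?; rewrite /qdot !qE; ring.
    transitivity (qdot (qconj x1) (qconj x1) + 2 * W * qdot b (qconj x1) + W ^+ 2 * qdot b b).
      by rewrite -[qdot (qconj x1) _]qnormsq_dot qnormsq_conj qnormsq_dot.
    by move: (qconj x1) (W) => ? ?; rewrite /qdot !qE; ring.
  + rewrite /= /Lam /=; move: Fx1; congr (F _ != 0); rewrite /qlift /Y qnormsq_dot -/W.
    congr (_, _, _); first by rewrite addrK qconjK.
    by move: (qdot b _) => k; ring.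
Qed.

Lemma is_circle_im m b (k : R) : q0 m = 0 -> m != 0 -> q0 b = 0 -> 0 < k ->
  is_circle [set z : 'rV[R]_3 | qdot m (imq z - b) = 0 /\ qdot (imq z - b) (imq z - b) = k].
Proof.
move=> m0 mn b0 kp; have [m3 em] := imq_surj m0; have [b3 eb] := imq_surj b0.
exists b3, m3, (Num.sqrt k); split.
- apply: contra_neq mn => m30; rewrite em m30; apply/eqP; rewrite -qdot_eq0 qdot_imq.
  by apply/eqP; rewrite /dot big1 // => i _; rewrite mxE mul0r.
- by rewrite sqrtr_gt0.
- have E z : imq z - b = imq (z - b3) by rewrite eb imqD imqN.
  by apply/funext => z /=; rewrite em !E !qdot_imq sqr_sqrtr ?ltW.
Qed.

(** The vectors E p are imaginary, orthogonal to m and of length |p|; likewise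
    q F and m'. *)
Lemma sum_circles m m' b p q : q0 m = 0 -> qdot m m = 1 -> q0 m' = 0 -> qdot m' m' = 1 ->
  q0 b = 0 -> q0 p = 0 -> q0 (m * p) = 0 -> q0 q = 0 -> q0 (q * m') = 0 ->
  p != 0 -> q != 0 ->
  exists al be : set 'rV[R]_3, [/\ is_circle al, is_circle be &
    forall e1 e2 f1 f2, e1 ^+ 2 + e2 ^+ 2 = 1 -> f1 ^+ 2 + f2 ^+ 2 = 1 ->
    exists2 z, sum_set al be z & imq z = b + circ m e1 e2 * p + q * circ m' f1 f2].
Proof.
move=> m0 m1 m0' m1' b0 p0 mp0 q0' qm0 pn qn.
have mn : m != 0 by rewrite -qdot_eq0 m1 oner_eq0.
have mn' : m' != 0 by rewrite -qdot_eq0 m1' oner_eq0.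
have z0 : q0 (0 : quat R) = 0 by rewrite qE.
exists [set z : 'rV[R]_3 | qdot m (imq z - b) = 0 /\ qdot (imq z - b) (imq z - b) = qdot p p].
exists [set z : 'rV[R]_3 | qdot m' (imq z - 0) = 0 /\ qdot (imq z - 0) (imq z - 0) = qdot q q].
split; [apply: is_circle_im => //; exact: qdot_gt0|apply: is_circle_im => //; exact: qdot_gt0|].
move=> e1 e2 f1 f2 he hf.
have cE : circ m e1 e2 * p = e1 *: p + e2 *: (m * p) by rewrite /circ mulrDl qreal_mul qscaleAl.
have cF : q * circ m' f1 f2 = f1 *: q + f2 *: (q * m') by rewrite /circ mulrDr qmul_real qscaleAr.
have nE (n : quat R) (g1 g2 : R) : q0 n = 0 -> qdot n n = 1 -> g1 ^+ 2 + g2 ^+ 2 = 1 ->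
    qnormsq (circ n g1 g2) = 1.
  move=> n0 n1 hg; transitivity (g1 ^+ 2 + g2 ^+ 2 * qdot n n).
    by rewrite qnormsq_dot /circ /qdot !qE n0; ring.
  by rewrite n1 mulr1.
have [z1 ez1] : exists z : 'rV[R]_3, b + circ m e1 e2 * p = imq z.
  by apply: imq_surj; rewrite cE !(qD, qZ) b0 p0 mp0; ring.
have [z2 ez2] : exists z : 'rV[R]_3, q * circ m' f1 f2 = imq z.
  by apply: imq_surj; rewrite cF !(qD, qZ) q0' qm0; ring.
exists (z1 + z2); last by rewrite imqD -ez1 -ez2.
exists z1, z2; split=> //=; split.
- rewrite -ez1 addrC addKr cE.
  transitivity (- e1 * q0 (m * p) + e2 * (q0 p * qdot m m)); last by rewrite mp0 p0; ring.
  by rewrite /qdot !qE m0; ring.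
- by rewrite -ez1 addrC addKr -!qnormsq_dot qnormsqM nE // mul1r.
- rewrite -ez2 subr0 cF.
  transitivity (- f1 * q0 (q * m') + f2 * (q0 q * qdot m' m')); last by rewrite qm0 q0'; ring.
  by rewrite /qdot !qE m0'; ring.
- by rewrite -ez2 subr0 -!qnormsq_dot qnormsqM nE // mulr1.
Qed.

Lemma q0_sum_circles m m' b p q :
  (forall e1 e2 f1 f2, e1 ^+ 2 + e2 ^+ 2 = 1 -> f1 ^+ 2 + f2 ^+ 2 = 1 ->
     q0 (b + circ m e1 e2 * p + q * circ m' f1 f2) = 0) ->
  [/\ q0 b = 0, q0 p = 0, q0 (m * p) = 0, q0 q = 0 & q0 (q * m') = 0].
Proof.
move=> h.
have [u10 u10' u01 u01'] := axis_points R.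
have E e1 e2 f1 f2 : q0 (b + circ m e1 e2 * p + q * circ m' f1 f2) =
    q0 b + (e1 * q0 p + e2 * q0 (m * p)) + (f1 * q0 q + f2 * q0 (q * m')).
  by rewrite /circ !qE; ring.
have := h _ _ _ _ u10 u10; have := h _ _ _ _ u10' u10; have := h _ _ _ _ u10 u10'.
have := h _ _ _ _ u01 u10; have := h _ _ _ _ u01' u10; have := h _ _ _ _ u10 u01.
have := h _ _ _ _ u10 u01'; rewrite !E; move: (q0 (m * p)) (q0 (q * m')) => k1 k2.
by move=> *; split; lra.
Qed.
End Conclusions.

(** * Clifford translational surfaces *)

Section CliffordCase.
Variable R : realType.
Implicit Types (a b c n o p r q w x m v Y g t s P Q : quat R) (S : set 'rV[R]_3).

Definition cross_surface S : Prop := exists al be : set 'rV[R]_3,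
     [/\ is_circle al, is_circle be,
         al `<=` @unit_sphere R, be `<=` @unit_sphere R &
         mobius_of_subset (Some @` S) (cross_set al be)].

(** Homotheties of ratios 4 and 1/4 with different centres compose to a
    translation. *)
Lemma mobius_translation (tau : 'rV[R]_3) : mobius (omap (fun z => z + tau) : Rinf R 3 -> Rinf R 3).
Proof.
have n0 : (2 : R) != 0 by rewrite pnatr_eq0.
have n1 : (1 : R) != 0 by rewrite oner_neq0.
have -> : (omap (fun z => z + tau) : Rinf R 3 -> Rinf R 3) =
   (@inversion R 3 ((4 / 3) *: tau) 1 \o @inversion R 3 ((4 / 3) *: tau) 2) \o
   (@inversion R 3 0 2 \o @inversion R 3 0 1).
  apply/funext => x; rewrite /= !inversion2 //; case: x => [x|] //=; congr Some.
  by apply/rowP => i; rewrite !mxE; field.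
by do !apply: mobius_comp; apply: mobius_inversion.
Qed.

Lemma imq_cross (x y : 'rV[R]_3) : imq (cross x y) = qcross (imq x) (imq y).
Proof.
have o0 : ordS (0 : 'I_3) = 1 by apply: val_inj.
have o1 : ordS (1 : 'I_3) = inord 2 by apply: val_inj; rewrite /= inordK.
have o2 : ordS (inord 2 : 'I_3) = 0 by apply: val_inj; rewrite /= inordK.
by apply: quatP; rewrite !qX ?mxE ?o0 ?o1 ?o2 ?o0 ?o1; ring.
Qed.

(** A circle on the unit sphere: the section by the plane <m, z> = k. *)
Definition scirc m (k : R) : set 'rV[R]_3 :=
  [set z | qdot m (imq z) = k /\ qdot (imq z) (imq z) = 1].

Lemma scirc_sphere m k : scirc m k `<=` @unit_sphere R.
Proof. by move=> z [_]; rewrite qdot_imq. Qed.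

Lemma is_circle_scirc m k : q0 m = 0 -> qdot m m = 1 -> k ^+ 2 < 1 -> is_circle (scirc m k).
Proof.
move=> m0 m1 k1.
have mn : m != 0 by rewrite -qdot_eq0 m1 oner_eq0.
have -> : scirc m k = [set z : 'rV[R]_3 | qdot m (imq z - k *: m) = 0 /\
    qdot (imq z - k *: m) (imq z - k *: m) = 1 - k ^+ 2].
  have E1 z : qdot m (imq z - k *: m) = qdot m (imq z) - k.
    by rewrite -[X in _ = _ - X]mulr1 -[in RHS]m1; rewrite /qdot !qE; ring.
  have E2 z : qdot (imq z - k *: m) (imq z - k *: m) =
      qdot (imq z) (imq z) - 2 * k * (qdot m (imq z) - k) - k ^+ 2.
    transitivity (qdot (imq z) (imq z) - 2 * k * qdot m (imq z) + k ^+ 2 * qdot m m).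
      by rewrite /qdot !qE; ring.
    by rewrite m1; ring.
  apply/funext => z; apply/propext; rewrite /= E2 E1; split=> [[h1 h2]|[h1 h2]].
    by split; [rewrite h1 subrr|rewrite h1 h2; ring].
  rewrite h1 mulr0 subr0 in h2; split; first by apply/eqP; rewrite -subr_eq0 h1.
  by apply: (addIr (- k ^+ 2)).
apply: is_circle_im => //; first by rewrite !qE m0 mulr0.
by rewrite subr_gt0.
Qed.

(** The Cayley transform (1 - t)^-1 (1 + t) of a unit quaternion is imaginary:
    it is stereographic projection. *)
Lemma cayley t : qdot t t = 1 -> t != 1 -> let s := (1 - q0 t)^-1 *: im t in
  [/\ 1 - q0 t != 0, q0 s = 0, s * (1 - t) = 1 + t & (1 - t) * s = 1 + t].
Proof.
move=> t1 tn s.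
have d0 : 1 - q0 t != 0.
  apply: contra_neq tn => h; have t0 : q0 t = 1 by apply/eqP; rewrite eq_sym -subr_eq0 h.
  apply/eqP; rewrite -subr_eq0 -qdot_eq0; apply/eqP.
  transitivity (qdot t t - 2 * q0 t + 1); first by rewrite /qdot !qE; ring.
  by rewrite t1 t0; ring.
have key : im t * (1 - t) = (1 - q0 t) *: (1 + t) /\ (1 - t) * im t = (1 - q0 t) *: (1 + t).
  by split; apply: quatP; rewrite !qX; try ring;
    (apply/eqP; rewrite -subr_eq0; apply/eqP;
     transitivity (qdot t t - 1); [rewrite /qdot; ring|by rewrite t1 subrr]).
split=> //; first by rewrite /s !qX mulr0.
  by rewrite /s qscaleAl key.1 scalerA mulVf // scale1r.
by rewrite /s qscaleAr key.2 scalerA mulVf // scale1r.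
Qed.

Lemma conj_invariant w v x y : w * v = 1 -> v * w = 1 ->
  q0 (w * x * v) = q0 x /\ qdot (w * x * v) (w * y * v) = qdot x y.
Proof.
move=> wv vw; split; first by rewrite q0_cycle mulrA vw mul1r.
have nn : qnormsq w * qnormsq v = 1 by rewrite -qnormsqM wv qnormsqE !qE; ring.
have dl a y' z' : qdot (a * y') (a * z') = qnormsq a * qdot y' z'.
  by rewrite qnormsq_dot /qdot !qE; ring.
have dr a y' z' : qdot (y' * a) (z' * a) = qdot y' z' * qnormsq a.
  by rewrite qnormsq_dot /qdot !qE; ring.
by rewrite dr dl mulrAC nn mul1r.
Qed.

(** On R^3, y = b + beta (Psi + 1) (Psi - 1)^-1 with Psi = P g Q is a
    stereographic projection of the surface of the products P g Q. The vectors
    p = v^-1 g^-1 P g v and q = v^-1 Q v also run through circles of the unit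
    sphere, and p q = v^-1 g^-1 Psi v. The Cayley transform of p q is 2 (p x
    q) / |p + q|^2. It remains to pass from Psi to g^-1 Psi before the
    transform: with e the Cayley transform of g and v = 1 + e, this amounts to
    an inversion centred at - e followed by a translation. *)
Lemma clifford_positive S b (beta : R) m1 k1 m2 k2 g : 0 < beta -> q0 b = 0 -> g != 1 ->
  q0 m1 = 0 -> qdot m1 m1 = 1 -> k1 ^+ 2 < 1 ->
  q0 m2 = 0 -> qdot m2 m2 = 1 -> k2 ^+ 2 < 1 -> qdot g g = 1 ->
  (forall y, S y -> exists P Q, [/\ [/\ q0 P = 0, qdot P P = 1 & qdot m1 P = k1],
     [/\ q0 Q = 0, qdot Q Q = 1 & qdot m2 Q = k2], P * g * Q != 1 &
     (imq y - b) * (P * g * Q - 1) = beta *: (P * g * Q + 1)]) -> cross_surface S.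
Proof.
move=> betap b0 gn m10 m11 k11 m20 m21 k21 g1 hS.
have [ge e0 eg _] := cayley g1 gn; set e := _ *: im g in e0 eg.
have gE : g * e = e * g by rewrite /e; apply: quatP; rewrite !qX; ring.
clearbody e.
have {}eg : (1 + e) * g = e - 1.
  rewrite mulrDl mul1r; apply/eqP; rewrite -subr_eq0; apply/eqP.
  transitivity (1 + g - e * (1 - g)); last by rewrite eg subrr.
  by rewrite mulrBr mulr1; apply: quatP; rewrite !qD !qN ?qD ?qN; ring.
have vn : 1 + e != 0.
  rewrite -qdot_eq0; have -> : qdot (1 + e) (1 + e) = 1 + qdot e e by rewrite /qdot !qE e0; ring.
  by rewrite gt_eqF // ltr_pwDl // /qdot -!expr2 !addr_ge0 ?sqr_ge0.
set v := 1 + e in eg vn.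
have [u [uv vu]] : exists u, u * v = 1 /\ v * u = 1 by exists v^-1; rewrite qVmul // qmulV.
have gn0 : g != 0 by rewrite -qdot_eq0 g1 oner_eq0.
have [h [hg gh]] : exists h, h * g = 1 /\ g * h = 1 by exists g^-1; rewrite qVmul // qmulV.
have w1 : (u * h) * (g * v) = 1 by rewrite mulrA -(mulrA u) hg mulr1.
have w2 : (g * v) * (u * h) = 1 by rewrite mulrA -(mulrA g) vu mulr1.
pose al := scirc (u * h * m1 * (g * v)) k1; pose be := scirc (u * m2 * v) k2.
exists al, be; split.
- by apply: is_circle_scirc => //; [rewrite (conj_invariant _ 0 w1 w2).1|rewrite (conj_invariant _ _ w1 w2).2].
- by apply: is_circle_scirc => //; [rewrite (conj_invariant _ 0 uv vu).1|rewrite (conj_invariant _ _ uv vu).2].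
- exact: scirc_sphere.
- exact: scirc_sphere.
have [e3 ee3] := imq_surj e0; have [b3 eb3] := imq_surj b0.
pose rr := Num.sqrt (beta * (1 + qdot e e)).
pose tau := b3 - beta *: e3 + e3.
have eep : 0 < 1 + qdot e e by rewrite ltr_pwDl // /qdot -!expr2 !addr_ge0 ?sqr_ge0.
have rp : 0 < rr by rewrite sqrtr_gt0 mulr_gt0.
have r2 : rr ^+ 2 = beta * (1 + qdot e e) by rewrite sqr_sqrtr // ltW // mulr_gt0.
apply: (mobius_of_subset_intro (mobius_comp (mobius_translation tau) (mobius_inversion (- e3) rp))).
move=> y /hS [P [Q [[P0 P1 Pm] [Q0 Q1 Qm] Psi1 yE]]].
set p := u * h * P * (g * v); set q := u * Q * v.
have [p0 _] := conj_invariant P P w1 w2; have [q0' _] := conj_invariant Q Q uv vu.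
rewrite -/p P0 in p0; rewrite -/q Q0 in q0'.
have [p3 ep3] := imq_surj p0; have [q3 eq3] := imq_surj q0'.
have alp : al p3.
  by split; rewrite -ep3 /p (conj_invariant _ _ w1 w2).2.
have beq : be q3.
  by split; rewrite -eq3 /q (conj_invariant _ _ uv vu).2.
exists (cross_quotient p3 q3); first by exists p3, q3.
set Psi := P * g * Q in Psi1 yE.
have Psin : Psi - 1 != 0 by rewrite subr_eq0.
have uniq w : w * (Psi - 1) = beta *: (Psi + 1) -> imq y = b + w.
  move=> hw; have : (imq y - b - w) * (Psi - 1) = 0 by rewrite mulrBl yE hw subrr.
  by move/eqP; rewrite qmul_eq0 (negbTE Psin) orbF subr_eq0 => /eqP <-; rewrite addrC subrK.
have gv : g * v = e - 1.
  by rewrite -eg /v mulrDr mulrDl mulr1 mul1r gE.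
set t := p * q.
have tE : t = u * h * Psi * v.
  transitivity (u * h * P * g * (v * u) * Q * v); first by rewrite /t /p /q !mulrA.
  by rewrite vu mulr1 /Psi !mulrA.
have PsiE : Psi = (e - 1) * t * u.
  transitivity (g * (v * u) * h * Psi * (v * u)); first by rewrite vu !mulr1 gh mul1r.
  by rewrite tE -gv !mulrA.
have pp1 : qdot p p = 1 by rewrite /p (conj_invariant _ _ w1 w2).2.
have qq1 : qdot q q = 1 by rewrite /q (conj_invariant _ _ uv vu).2.
clearbody Psi p q.
have tt1 : qdot t t = 1 by exact: qdot_unitM.
have dE : dot (p3 + q3) (p3 + q3) = 2 * (1 - q0 t).
  rewrite -qdot_imq imqD -ep3 -eq3; transitivity (qdot p p + qdot q q + 2 * qdot p q).
    by rewrite /qdot !qE; ring.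
  by rewrite pp1 qq1 /t /qdot !qE p0; ring.
have e2 : e * e = qreal (- qdot e e).
  by apply: quatP; rewrite /qdot !qE ?e0; ring.
rewrite /cross_quotient; case: eqVneq => [pq0|pqn] /=.
  (* the case p + q = 0, where the cross quotient is infinite and the
     inversion sends it to its centre *)
  have t1 : t = 1.
    apply/eqP; rewrite -subr_eq0 -qdot_eq0; apply/eqP.
    transitivity (qdot t t - 2 * q0 t + 1); first by rewrite /qdot !qE; ring.
    have : dot (p3 + q3) (p3 + q3) = 0 by rewrite pq0 /dot big1 // => i _; rewrite mxE mul0r.
    by rewrite dE tt1; lra.
  congr Some; apply: imq_inj.
  have -> : imq y = b + (- beta *: e).
    have Pg : Psi = g by rewrite PsiE t1 mulr1 -gv -mulrA vu mulr1.
    have eg' : e * g = e - 1 - g by rewrite -eg /v mulrDl mul1r addrC addKr.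
    apply: uniq; rewrite Pg qscaleAl mulrBr mulr1 eg'.
    by apply: quatP; rewrite !qE; ring.
  by rewrite /tau !(imqD, imqN, imqZ) -eb3 -ee3; apply: quatP; rewrite !qE; ring.
have tn1 : t != 1.
  apply: contra_neq pqn => t1; apply: dot3_eq0; rewrite dE t1 !qE subrr mulr0 //.
have [dt s0 st _] := cayley tt1 tn1; set s := _ *: im t in s0 st.
have sE : imq ((2 / dot (p3 + q3) (p3 + q3)) *: cross p3 q3) = s.
  rewrite imqZ imq_cross -ep3 -eq3 dE /s; congr (_ *: _).
    by rewrite invfM mulrA mulfV ?mul1r // pnatr_eq0.
  by rewrite /t; apply: quatP; rewrite !qX ?p0 ?q0'; ring.
pose L := 1 + qdot e e.
have ve : v * (e - 1) = qreal (- L).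
  transitivity (e * e - 1); first by rewrite /v mulrDl mul1r mulrBr mulr1; apply: quatP; rewrite !qE; ring.
  by rewrite e2 /L; apply: quatP; rewrite !qE; ring.
have XE : v * Psi + 1 - e = L *: ((1 - t) * u).
  have -> : v * Psi = - (L *: (t * u)).
    by rewrite PsiE -(mulrA (e - 1)) mulrA ve qreal_mul scaleNr.
  rewrite -addrA; have -> : 1 - e = L *: u.
    transitivity (- (v * (e - 1)) * u).
      have cv : v * (e - 1) = (e - 1) * v by rewrite /v mulrDl mul1r [(e - 1) * (1 + e)]mulrDr !mulr1 mulrBr mulrBl mulr1 mul1r.
      by rewrite cv mulNr -mulrA vu mulr1 opprB.
    by rewrite ve mulNr qreal_mul scaleNr opprK.
  by rewrite mulrBl mul1r scalerBr addrC.
(* the effect on Cayley transforms of multiplying Psi by g^-1 *)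
have main : L *: (1 - Psi) = (e + s) * (v * Psi + 1 - e).
  rewrite XE qscaleAr; congr (_ *: _); rewrite mulrA mulrDl st.
  transitivity ((v - (e - 1) * t) * u); first by rewrite mulrBl vu -PsiE.
  congr (_ * _); rewrite /v mulrBr mulr1 mulrBl mul1r; move: (e * t) => et.
  by apply: quatP; rewrite !qE; ring.
have esn : e + s != 0.
  apply/eqP => es0; move: main; rewrite es0 mul0r => /eqP.
  by rewrite scaler_eq0 gt_eqF //= subr_eq0 eq_sym (negbTE Psi1).
set z := (2 / _) *: _ in sE *; clearbody z.
have zn : z != - e3.
  by apply: contra_neq esn => ze; rewrite -sE ze imqN -ee3 subrr.
rewrite (negbTE zn) /=; congr Some; apply: imq_inj.
have DE : dot (z - - e3) (z - - e3) = qdot (e + s) (e + s).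
  by rewrite opprK -qdot_imq imqD sE -ee3 addrC.
rewrite DE r2; have Dn : qdot (e + s) (e + s) != 0 by rewrite qdot_eq0.
have -> : imq y = b + (- beta *: e + (beta * L / qdot (e + s) (e + s)) *: (e + s)).
  apply: uniq; rewrite mulrDl !qscaleAl.
  set X := v * Psi + 1 - e in main.
  have es0 : q0 (e + s) = 0 by rewrite qD e0 s0 addr0.
  have aa : (e + s) * (e + s) = qreal (- qdot (e + s) (e + s)).
    by move: (e + s) es0 => a a0; apply: quatP; rewrite /qdot !qE ?a0; ring.
  have LX : L *: ((e + s) * (Psi - 1)) = qdot (e + s) (e + s) *: X.
    have -> : (e + s) * (Psi - 1) = - ((e + s) * (1 - Psi)) by rewrite -mulrN opprB.
    by rewrite scalerN -qscaleAr main mulrA aa qreal_mul scaleNr opprK.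
  have -> : beta * L / qdot (e + s) (e + s) = beta / qdot (e + s) (e + s) * L by rewrite mulrAC.
  rewrite -scalerA LX scalerA divfK // scaleNr -scalerN -scalerDr; congr (_ *: _).
  rewrite /X /v mulrDl mul1r mulrBr mulr1; move: (e * Psi) => ep.
  by apply: quatP; rewrite !qE; ring.
by rewrite opprK /tau !(imqD, imqN, imqZ) sE -eb3 -ee3 -/L; apply: quatP; rewrite !qE; ring.
Qed.
(** A negative beta is made positive by conjugation, which exchanges P and Q
    and changes the sign of y - b. If g = 1, replacing P by - P and the first
    plane by its opposite replaces g by - 1. *)
Lemma clifford_cross_surface S b (beta : R) m1 k1 m2 k2 g : beta != 0 -> q0 b = 0 ->
  q0 m1 = 0 -> qdot m1 m1 = 1 -> k1 ^+ 2 < 1 ->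
  q0 m2 = 0 -> qdot m2 m2 = 1 -> k2 ^+ 2 < 1 -> qdot g g = 1 ->
  (forall y, S y -> exists P Q, [/\ [/\ q0 P = 0, qdot P P = 1 & qdot m1 P = k1],
     [/\ q0 Q = 0, qdot Q Q = 1 & qdot m2 Q = k2], P * g * Q != 1 &
     (imq y - b) * (P * g * Q - 1) = beta *: (P * g * Q + 1)]) -> cross_surface S.
Proof.
have pos (be : R) n1 l1 n2 l2 h : 0 < be -> q0 b = 0 -> q0 n1 = 0 -> qdot n1 n1 = 1 -> l1 ^+ 2 < 1 ->
    q0 n2 = 0 -> qdot n2 n2 = 1 -> l2 ^+ 2 < 1 -> qdot h h = 1 ->
    (forall y, S y -> exists P Q, [/\ [/\ q0 P = 0, qdot P P = 1 & qdot n1 P = l1],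
     [/\ q0 Q = 0, qdot Q Q = 1 & qdot n2 Q = l2], P * h * Q != 1 &
     (imq y - b) * (P * h * Q - 1) = be *: (P * h * Q + 1)]) -> cross_surface S.
  move=> bep b0 n10 n11 l1lt n20 n21 l2lt h1 hS.
  have [hE|hn] := eqVneq h 1; last exact: (clifford_positive bep b0 hn n10 n11 l1lt n20 n21 l2lt h1).
  have hn : (- 1 : quat R) != 1.
    rewrite -subr_eq0 -qdot_eq0; have -> : qdot (-1 - 1 : quat R) (-1 - 1) = 4 by rewrite /qdot !qE; ring.
    by rewrite pnatr_eq0.
  have h1' : qdot (- 1 : quat R) (- 1) = 1 by rewrite /qdot !qE; ring.
  have l1lt' : (- l1) ^+ 2 < 1 by rewrite sqrrN.
  apply: (clifford_positive bep b0 hn n10 n11 l1lt' n20 n21 l2lt h1') => y /hS[P [Q [[P0 P1 Pm] HQ Pn yE]]].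
  have E : - P * - 1 * Q = P * h * Q by rewrite hE mulrNN.
  exists (- P), Q; rewrite E; split=> //; split.
  - by rewrite qN P0 oppr0.
  - by rewrite -P1 /qdot !qE; ring.
  - by rewrite -Pm /qdot !qE; ring.
move=> betan b0 m10 m11 k11 m20 m21 k21 g1 hS.
have [bp|bn|be0] := ltrgtP 0 beta; last by rewrite be0 eqxx in betan.
  exact: (pos beta m1 k1 m2 k2 g).
have bp : 0 < - beta by rewrite oppr_gt0.
have g1' : qdot (qconj g) (qconj g) = 1 by rewrite -g1 -!qnormsq_dot qnormsq_conj.
apply: (pos (- beta) m2 k2 m1 k1 (qconj g)) => // y /hS[P [Q [[P0 P1 Pm] [Q0 Q1 Qm] Pn yE]]].
exists Q, P.
have cE : Q * qconj g * P = qconj (P * g * Q).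
  by rewrite !qconjM (qconj_im P0) (qconj_im Q0) mulrN mulrNN mulrA.
have g1u : qdot (P * g * Q) (P * g * Q) = 1 by rewrite !qdot_unitM.
have cB x z : qconj (x - z) = qconj x - qconj z by apply: quatP; rewrite !qE; ring.
have c1 : qconj 1 = 1 :> quat R by apply: quatP; rewrite !qE ?oppr0.
split=> //; rewrite cE.
  by apply: contra_neq Pn => h; rewrite -[LHS]qconjK h c1.
set t := P * g * Q in Pn yE g1u *; clearbody t.
have w0 : q0 (imq y - b) = 0 by rewrite !qE b0 subr0.
(* conjugating the relation turns the imaginary w into -w on the right, and w commutes with t *)
have tn : t - 1 != 0 by rewrite subr_eq0.
have [ti [tiE Eti]] : exists ti, (t - 1) * ti = 1 /\ ti * (t - 1) = 1.
  by exists (t - 1)^-1; rewrite qmulV // qVmul.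
have wE : imq y - b = beta *: ((t + 1) * ti).
  by rewrite -qscaleAl -yE -mulrA tiE mulr1.
have cti : ti * t = t * ti.
  have : ti * ((t - 1) * t) * ti = ti * (t * (t - 1)) * ti.
    by congr (_ * _ * _); rewrite mulrBl mulrBr mul1r mulr1.
  by rewrite !mulrA Eti mul1r -[_ * (t - 1) * ti]mulrA tiE mulr1 => ->.
have wt : (t - 1) * (imq y - b) = beta *: (t + 1).
  rewrite wE qscaleAr; congr (_ *: _).
  rewrite mulrA; have -> : (t - 1) * (t + 1) = (t + 1) * (t - 1).
    by apply: quatP; rewrite !qE; ring.
  by rewrite -mulrA tiE mulr1.
have := congr1 (@qconj R) wt; rewrite qconjM (qconj_im w0) cB c1 mulNr => E.
rewrite -[LHS]opprK E.
by apply: quatP; rewrite !qE; ring.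
Qed.

Lemma cauchy_schwarz a b : qdot a b ^+ 2 <= qdot a a * qdot b b.
Proof.
have -> : qdot a a * qdot b b = qdot a b ^+ 2 + qdot (im (a * qconj b)) (im (a * qconj b)).
  by rewrite /qdot !qX; ring.
by rewrite lerDl /qdot -!expr2 !addr_ge0 ?sqr_ge0.
Qed.

(** If c is orthogonal to 1 and m, then E + c has constant norm, and
    multiplying by a unit vector orthogonal to 1, m and c turns the circle of
    all E + c into a circle of imaginary quaternions. *)
Lemma circle_imag m c (xi : R) : q0 m = 0 -> qdot m m = 1 -> q0 c = 0 -> qdot m c = 0 ->
  0 < xi -> xi ^+ 2 = 1 + qdot c c ->
  exists h k, [/\ qdot h h = 1, k ^+ 2 < 1 & forall e1 e2, e1 ^+ 2 + e2 ^+ 2 = 1 ->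
    let P := xi^-1 *: ((circ m e1 e2 + c) * qconj h) in
    [/\ q0 P = 0, qdot P P = 1 & qdot m P = k]].
Proof.
move=> m0 m1 c0 mc xip xi2.
have [v [vn v1 vm vc]] := perp_exists 1 m c.
have vp : 0 < qdot v v by exact: qdot_gt0.
pose h := (Num.sqrt (qdot v v))^-1 *: v.
have sv : Num.sqrt (qdot v v) ^+ 2 = qdot v v by rewrite sqr_sqrtr // ltW.
have hh : qdot h h = 1.
  transitivity ((Num.sqrt (qdot v v) ^+ 2)^-1 * qdot v v).
    by rewrite -exprVn /h; move: (_^-1) => k; rewrite /qdot !qE; ring.
  by rewrite sv mulVf // gt_eqF.
have hZ w : qdot h w = (Num.sqrt (qdot v v))^-1 * qdot v w.
  by rewrite /h; move: (_^-1) => k; rewrite /qdot !qE; ring.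
have h1 : q0 h = 0 by transitivity (qdot h 1); [rewrite /qdot !qE; ring|rewrite hZ v1 mulr0].
have hm : qdot h m = 0 by rewrite hZ vm mulr0.
have hc : qdot h c = 0 by rewrite hZ vc mulr0.
clearbody h.
exists h, (xi^-1 * qdot (m * h) c); split=> //.
  rewrite exprMn exprVn xi2 mulrC ltr_pdivrMr; last by rewrite -xi2 exprn_gt0.
  rewrite mul1r; apply: le_lt_trans (cauchy_schwarz _ _) _.
  by rewrite (qdot_unitM m1 hh) mul1r ltrDr.
move=> e1 e2 he P.
have Xn : qdot (circ m e1 e2 + c) (circ m e1 e2 + c) = xi ^+ 2.
  rewrite xi2 -he -[e2 ^+ 2]mulr1 -m1.
  transitivity (e1 ^+ 2 + e2 ^+ 2 * qdot m m + qdot c c + 2 * e1 * q0 c + 2 * e2 * qdot m c).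
    by rewrite /circ /qdot !qE m0; ring.
  by rewrite c0 mc; ring.
have xin : xi != 0 by rewrite gt_eqF.
split.
- transitivity (xi^-1 * qdot (circ m e1 e2 + c) h).
    by rewrite /P; move: (_^-1) => k; rewrite /qdot !qE; ring.
  transitivity (xi^-1 * (e1 * q0 h + e2 * qdot h m + qdot h c)).
    by rewrite /circ; congr (_ * _); rewrite /qdot !qE; ring.
  by rewrite h1 hm hc; ring.
- transitivity (xi^-1 ^+ 2 * (qdot (circ m e1 e2 + c) (circ m e1 e2 + c) * qdot h h)).
    rewrite -!qnormsq_dot -[qnormsq h]qnormsq_conj -qnormsqM !qnormsq_dot /P.
    by move: (_^-1) (_ * _) => k Y; rewrite /qdot !qE; ring.
  by rewrite Xn hh mulr1 exprVn mulVf // expf_neq0.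
- transitivity (xi^-1 * qdot (m * h) (circ m e1 e2 + c)).
    by rewrite /P; move: (_^-1) (circ _ _ _) => k E; rewrite /qdot !qE; ring.
  congr (_ * _); transitivity (- e1 * qdot h m + e2 * (q0 h * qdot m m) + qdot (m * h) c).
    by rewrite /circ /qdot !qE m0; ring.
  by rewrite hm h1; ring.
Qed.

(** As o = - 1/(2 e), with e = Re b1, is the centre of the sphere, |x - o|^2
    is constant; it is a product of an affine function of E and one of F, so
    both factors are constant, whence c is orthogonal to 1 and m, and c' to 1
    and m'. Multiplying the two factors by suitable unit quaternions makes
    them imaginary. *)
Lemma product_cross_surface S b1 m m' c c' r :
  q0 m = 0 -> qdot m m = 1 -> q0 m' = 0 -> qdot m' m' = 1 -> q0 b1 != 0 ->
  let pt e1 e2 f1 f2 := qreal (- (2 * q0 b1)^-1)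
     + (circ m e1 e2 + c) * r * (circ m' f1 f2 + c') in
  (forall e1 e2 f1 f2, e1 ^+ 2 + e2 ^+ 2 = 1 -> f1 ^+ 2 + f2 ^+ 2 = 1 ->
     q0 b1 * qdot (pt e1 e2 f1 f2) (pt e1 e2 f1 f2) + q0 (pt e1 e2 f1 f2) = 0) ->
  (forall y, S y -> exists e1 e2 f1 f2, [/\ e1 ^+ 2 + e2 ^+ 2 = 1, f1 ^+ 2 + f2 ^+ 2 = 1,
     pt e1 e2 f1 f2 != 0 & imq y = b1 + (pt e1 e2 f1 f2)^-1]) -> cross_surface S.
Proof.
move=> m0 m1 m0' m1' en; have [e eE] : exists e, e = q0 b1 by exists (q0 b1).
rewrite -eE in en *; move=> pt on hS.
pose Z e1 e2 f1 f2 := (circ m e1 e2 + c) * r * (circ m' f1 f2 + c').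
have Zn e1 e2 f1 f2 : e1 ^+ 2 + e2 ^+ 2 = 1 -> f1 ^+ 2 + f2 ^+ 2 = 1 ->
    4 * e ^+ 2 * qdot (Z e1 e2 f1 f2) (Z e1 e2 f1 f2) = 1.
  move=> he hf; have := on _ _ _ _ he hf; rewrite /pt -/(Z _ _ _ _); move: (Z _ _ _ _) => z.
  move=> E; transitivity (4 * e * (e * qdot (qreal (- (2 * e)^-1) + z) (qreal (- (2 * e)^-1) + z)
       + q0 (qreal (- (2 * e)^-1) + z)) + 1); last by rewrite E mulr0 add0r.
  by rewrite /qdot !qE; field.
have nE n a (e1 e2 : R) : q0 n = 0 -> qdot n n = 1 -> e1 ^+ 2 + e2 ^+ 2 = 1 ->
   qdot (circ n e1 e2 + a) (circ n e1 e2 + a) = 1 + qdot a a + 2 * (e1 * q0 a + e2 * qdot n a).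
  move=> n0 n1 he; transitivity (e1 ^+ 2 + e2 ^+ 2 * qdot n n + qdot a a + 2 * (e1 * q0 a + e2 * qdot n a)).
    by rewrite /circ /qdot !qE n0; ring.
  by rewrite n1 mulr1 he.
pose A (e1 e2 : R) := 1 + qdot c c + 2 * (e1 * q0 c + e2 * qdot m c).
pose B (f1 f2 : R) := 1 + qdot c' c' + 2 * (f1 * q0 c' + f2 * qdot m' c').
have AB e1 e2 f1 f2 : e1 ^+ 2 + e2 ^+ 2 = 1 -> f1 ^+ 2 + f2 ^+ 2 = 1 ->
    4 * e ^+ 2 * qdot r r * (A e1 e2 * B f1 f2) = 1.
  move=> he hf; apply: etrans (Zn _ _ _ _ he hf).
  rewrite /Z -[qdot (_ * _) _]qnormsq_dot !qnormsqM !qnormsq_dot.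
  by rewrite !nE // /A /B; ring.
pose K := 4 * e ^+ 2 * qdot r r; rewrite -/K in AB.
have [u10 u10' u01 u01'] := axis_points R.
have nz (k a : R) : k * a = 1 -> k != 0.
  by move=> h; apply/eqP => k0; move/eqP: h; rewrite k0 mul0r eq_sym oner_eq0.
have KB : K * B 1 0 != 0 by apply: (nz _ (A 1 0)); rewrite -mulrA [B _ _ * _]mulrC AB.
have KA : K * A 1 0 != 0 by apply: (nz _ (B 1 0)); rewrite -mulrA AB.
have c0 : q0 c = 0.
  apply: (mulfI KB); rewrite mulr0; have := AB _ _ _ _ u10 u10; have := AB _ _ _ _ u10' u10.
  by move: (B 1 0) => b; rewrite /A; lra.
have mc : qdot m c = 0.
  apply: (mulfI KB); rewrite mulr0; have := AB _ _ _ _ u01 u10; have := AB _ _ _ _ u01' u10.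
  by move: (B 1 0) => b; rewrite /A; lra.
have c0' : q0 c' = 0.
  apply: (mulfI KA); rewrite mulr0; have := AB _ _ _ _ u10 u10; have := AB _ _ _ _ u10 u10'.
  by move: (A 1 0) => b; rewrite /B; lra.
have mc' : qdot m' c' = 0.
  apply: (mulfI KA); rewrite mulr0; have := AB _ _ _ _ u10 u01; have := AB _ _ _ _ u10 u01'.
  by move: (A 1 0) => b; rewrite /B; lra.
have posx a : 0 < 1 + qdot a a by rewrite ltr_pwDl // /qdot -!expr2 !addr_ge0 ?sqr_ge0.
pose xi := Num.sqrt (1 + qdot c c); pose xi' := Num.sqrt (1 + qdot c' c').
have xip : 0 < xi by rewrite sqrtr_gt0.
have xip' : 0 < xi' by rewrite sqrtr_gt0.
have xi2 : xi ^+ 2 = 1 + qdot c c by rewrite sqr_sqrtr // ltW.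
have xi2' : xi' ^+ 2 = 1 + qdot (qconj c') (qconj c').
  by rewrite sqr_sqrtr ?ltW // -!qnormsq_dot qnormsq_conj.
have [h [k [hh k1 hP]]] := circle_imag m0 m1 c0 mc xip xi2.
have n0 : q0 (- m') = 0 by rewrite qN m0' oppr0.
have n1 : qdot (- m') (- m') = 1 by rewrite -m1' /qdot !qE; ring.
have cc0 : q0 (qconj c') = 0 by rewrite qE.
have ncc : qdot (- m') (qconj c') = 0 by rewrite -mc' /qdot !qE c0'; ring.
have [h' [k' [hh' k1' hQ]]] := circle_imag n0 n1 cc0 ncc xip' xi2'.
have xin : xi != 0 by rewrite gt_eqF.
have xin' : xi' != 0 by rewrite gt_eqF.
clearbody xi xi'.
(* 2 e x = P g Q - 1, so that Re b1 + x^-1 = e (P g Q + 1) (P g Q - 1)^-1 *)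
pose g := (2 * e * xi * xi') *: (h * r * qconj h').
pose b := im b1; have b0 : q0 b = 0 by rewrite imE.
pose P e1 e2 := xi^-1 *: ((circ m e1 e2 + c) * qconj h).
pose Q f1 f2 := qconj (xi'^-1 *: ((circ (- m') f1 f2 + qconj c') * qconj h')).
have QE f1 f2 : Q f1 f2 = xi'^-1 *: (h' * (circ m' f1 f2 + c')).
  have cZ (l : R) x : qconj (l *: x) = l *: qconj x by apply: quatP; rewrite !qE; ring.
  have -> : circ m' f1 f2 + c' = qconj (circ (- m') f1 f2 + qconj c').
    by apply: quatP; rewrite /circ !qE ?m0'; ring.
  by rewrite /Q cZ qconjM qconjK.
have PgQ e1 e2 f1 f2 : P e1 e2 * g * Q f1 f2 = (2 * e) *: Z e1 e2 f1 f2.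
  rewrite QE /P /g /Z; move: (circ m e1 e2 + c) (circ m' f1 f2 + c') => X Y.
  have ch : qconj h * h = 1.
    by rewrite -[X in _ * X]qconjK qmul_conj -qnormsq_dot qnormsq_conj qnormsq_dot hh.
  have ch' : qconj h' * h' = 1.
    by rewrite -[X in _ * X]qconjK qmul_conj -qnormsq_dot qnormsq_conj qnormsq_dot hh'.
  rewrite !(qscaleAl, qscaleAr) !scalerA.
  have -> : X * qconj h * (h * r * qconj h') * (h' * Y) = X * (qconj h * h) * r * (qconj h' * h') * Y.
    by rewrite !mulrA.
  rewrite ch ch' !mulr1; congr (_ *: _).
  by field; rewrite xin xin'.
have Qprop f1 f2 : f1 ^+ 2 + f2 ^+ 2 = 1 ->
   [/\ q0 (Q f1 f2) = 0, qdot (Q f1 f2) (Q f1 f2) = 1 & qdot m' (Q f1 f2) = k'].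
  move=> /hQ []; rewrite /Q; move: (xi'^-1 *: _) => x x0 x1 xm; split.
  - by rewrite qE.
  - by rewrite -!qnormsq_dot qnormsq_conj qnormsq_dot.
  - by rewrite -xm /qdot !qE x0; ring.
have [P0 P1 _] := hP _ _ u10; have [Q0 Q1 _] := Qprop _ _ u10.
rewrite -/(P 1 0) in P0 P1.
have gg : qdot g g = 1.
  have := congr1 (@qnormsq R) (PgQ 1 0 1 0).
  rewrite !qnormsqM !qnormsq_dot P1 Q1 mul1r mulr1 => ->.
  apply: etrans (Zn _ _ _ _ u10 u10); move: (Z 1 0 1 0) => z; rewrite /qdot !qE; ring.
apply: (@clifford_cross_surface S b e m k m' k' g) => // y /hS[e1 [e2 [f1 [f2 [he hf xn yE]]]]].
exists (P e1 e2), (Q f1 f2); rewrite PgQ.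
have ptZ : (2 * e) *: pt e1 e2 f1 f2 = (2 * e) *: Z e1 e2 f1 f2 - 1.
  rewrite /pt -/(Z e1 e2 f1 f2); move: (Z _ _ _ _) => z.
  by apply: quatP; rewrite !qE; field.
have e2n : 2 * e != 0 by rewrite mulf_neq0 // pnatr_eq0.
split; [exact: hP|exact: Qprop| |].
  by rewrite -subr_eq0 -ptZ scaler_eq0 negb_or e2n.
have -> : (2 * e) *: Z e1 e2 f1 f2 + 1 = (2 * e) *: pt e1 e2 f1 f2 + 2 *: (1 : quat R).
  by rewrite ptZ; move: (Z _ _ _ _) => z; apply: quatP; rewrite !qE; ring.
rewrite -ptZ yE; move: (pt e1 e2 f1 f2) xn => x xn.
have -> : b1 + x^-1 - b = qreal e + x^-1.
  rewrite addrAC; congr (_ + _); rewrite /b eE.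
  by apply: quatP; rewrite !qX; ring.
rewrite mulrDl qreal_mul !qscaleAr qVmul //.
by apply: quatP; rewrite !qE; ring.
Qed.
End CliffordCase.

(** * Bicircular surfaces in the space of quaternions *)

Section BicircularSurfaces.
Variable R : realType.
Implicit Types (a b c d n o p q r w x m v Y g s t : quat R) (S : set 'rV[R]_3).

(** The general function affine in a point of each of two circles, multiplied
    from the left and from the right; the unit circles of the complex
    subfields of m and m' serve as models of all circles. *)
Definition bicirc b p q r m m' (e1 e2 f1 f2 : R) : quat R :=
  b + circ m e1 e2 * p + q * circ m' f1 f2 + circ m e1 e2 * r * circ m' f1 f2.

(** The counterpart of [rich] for affine functions on the unit circle. *)
Definition circle_rich (I : R -> R -> Prop) : Prop :=
  (forall e1 e2, I e1 e2 -> e1 ^+ 2 + e2 ^+ 2 = 1) /\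
  forall k0 k1 k2 : R, (forall e1 e2, I e1 e2 -> k0 + e1 * k1 + e2 * k2 = 0) ->
    [/\ k0 = 0, k1 = 0 & k2 = 0].

Let aff (k : R * R * R) (f1 f2 : R) := k.1.1 + f1 * k.1.2 + f2 * k.2.

(** Since |E| = |F| = 1, the function is affine in E and in F: the norms of E
    T and F T are independent of E and F. *)
Lemma bicirc_sig (e : R) b p q r m m' : q0 m = 0 -> qdot m m = 1 -> q0 m' = 0 -> qdot m' m' = 1 ->
  exists k0 k1 k2 : R * R * R, forall e1 e2 f1 f2, e1 ^+ 2 + e2 ^+ 2 = 1 -> f1 ^+ 2 + f2 ^+ 2 = 1 ->
    let x := bicirc b p q r m m' e1 e2 f1 f2 in
    e * qdot x x + q0 x = aff k0 f1 f2 + e1 * aff k1 f1 f2 + e2 * aff k2 f1 f2.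
Proof.
move=> m0 m1 m0' m1'.
have mm x y : qdot (m * x) (m * y) = qdot x y.
  by rewrite -[RHS]mul1r -m1 /qdot !qE m0; ring.
have xmx x : qdot x (m * x) = 0 by rewrite /qdot !qE m0; ring.
have mm' x y : qdot (x * m') (y * m') = qdot x y.
  by rewrite -[RHS]mul1r -m1' /qdot !qE m0'; ring.
have mxy x y : qdot (x * m') y = - qdot x (y * m').
  by rewrite /qdot !qE m0'; ring.
pose K x z : R * R * R := (2 * e * (qdot x b + qdot z q) + q0 x,
  2 * e * (qdot x q + qdot z b) + q0 z, 2 * e * (qdot x (q * m') + qdot (z * m') b) + q0 (z * m')).
pose K0 : R * R * R := (e * (qdot b b + qdot q q + qdot p p + qdot r r) + q0 b,
  2 * e * (qdot b q + qdot p r) + q0 q,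
  2 * e * (qdot b (q * m') + qdot p (r * m')) + q0 (q * m')).
exists K0, (K p r), (K (m * p) (m * r)) => e1 e2 f1 f2 he hf x.
pose y := b + (f1 *: q + f2 *: (q * m')).
have K1E (z1 z2 : quat R) : let t := z1 + (f1 *: z2 + f2 *: (z2 * m')) in
    aff (K z1 z2) f1 f2 = 2 * e * qdot t y + q0 t.
  rewrite /aff /K /y /= !(qdotDl, qdotZl) !(qdotDr, qdotZr) mm' !(qD, qZ) [qdot (z2 * m') q]mxy.
  move: (qdot z2 q) (qdot z2 (q * m')) => k1 k2.
  apply/eqP; rewrite -subr_eq0; apply/eqP.
  transitivity (2 * e * ((1 - (f1 ^+ 2 + f2 ^+ 2)) * k1)); first by ring.
  by rewrite hf subrr mul0r mulr0.
pose t := p + (f1 *: r + f2 *: (r * m')).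
have mt : m * p + (f1 *: (m * r) + f2 *: (m * r * m')) = m * t.
  by rewrite /t !mulrDr !qscaleAr mulrA.
rewrite !K1E mt -/t.
have qmq (z : quat R) : qdot z (z * m') = 0 by rewrite /qdot !qE m0'; ring.
have nrm (z1 z2 : quat R) : qdot (z1 + (f1 *: z2 + f2 *: (z2 * m'))) (z1 + (f1 *: z2 + f2 *: (z2 * m'))) =
   qdot z1 z1 + qdot z2 z2 + 2 * (f1 * qdot z1 z2 + f2 * qdot z1 (z2 * m')).
  rewrite !(qdotDl, qdotZl) !(qdotDr, qdotZr) mm' qmq [qdot (z2 * m') z2]qdotC qmq
    [qdot z2 z1]qdotC [qdot (z2 * m') z1]qdotC.
  transitivity (qdot z1 z1 + (f1 ^+ 2 + f2 ^+ 2) * qdot z2 z2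
     + 2 * (f1 * qdot z1 z2 + f2 * qdot z1 (z2 * m'))); first by ring.
  by rewrite hf mul1r.
have K0E : aff K0 f1 f2 = e * (qdot y y + qdot t t) + q0 y.
  by rewrite /y /t !nrm /aff /K0 /= !(qD, qZ); ring.
have xE : x = y + (e1 *: t + e2 *: (m * t)).
  have -> : e1 *: t + e2 *: (m * t) = circ m e1 e2 * t.
    by rewrite /circ mulrDl qreal_mul qscaleAl.
  have -> : y = b + q * circ m' f1 f2 by rewrite /y /circ mulrDr qmul_real qscaleAr.
  have -> : t = p + r * circ m' f1 f2 by rewrite /t /circ mulrDr qmul_real qscaleAr.
  rewrite /x /bicirc; move: (circ m e1 e2) (circ m' f1 f2) => E F.
  by rewrite (mulrDr E p (r * F)) (mulrA E r F) addrA (addrAC b (q * F)).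
rewrite xE K0E; move: (y) (t) => Y T.
rewrite !(qdotDl, qdotZl) !(qdotDr, qdotZr) mm xmx [qdot (m * T) T]qdotC xmx [qdot Y T]qdotC [qdot Y (m * T)]qdotC !(qD, qZ).
transitivity (e * (qdot Y Y + (e1 ^+ 2 + e2 ^+ 2) * qdot T T) + q0 Y
   + e1 * (2 * e * qdot T Y + q0 T) + e2 * (2 * e * qdot (m * T) Y + q0 (m * T))); first by ring.
by rewrite he mul1r.
Qed.
End BicircularSurfaces.

Section BicircularConclusion.
Variable R : realType.
Implicit Types (a b c d n o p q r w x m v Y g s t : quat R) (S : set 'rV[R]_3) (I J : R -> R -> Prop).

Definition classified S : Prop := sum_surface S \/ cross_surface S \/ cyclide_surface S.

Lemma bicirc_all (e : R) I J b p q r m m' :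
  q0 m = 0 -> qdot m m = 1 -> q0 m' = 0 -> qdot m' m' = 1 -> circle_rich I -> circle_rich J ->
  (forall e1 e2 f1 f2, I e1 e2 -> J f1 f2 -> let x := bicirc b p q r m m' e1 e2 f1 f2 in
     e * qdot x x + q0 x = 0) ->
  forall e1 e2 f1 f2, e1 ^+ 2 + e2 ^+ 2 = 1 -> f1 ^+ 2 + f2 ^+ 2 = 1 ->
     let x := bicirc b p q r m m' e1 e2 f1 f2 in e * qdot x x + q0 x = 0.
Proof.
move=> m0 m1 m0' m1' [Iu Ir] [Ju Jr] h.
have [k0 [k1 [k2 kE]]] := bicirc_sig e b p q r m0 m1 m0' m1'.
have hf f1 f2 : J f1 f2 -> [/\ k0.1.1 + f1 * k0.1.2 + f2 * k0.2 = 0,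
    k1.1.1 + f1 * k1.1.2 + f2 * k1.2 = 0 & k2.1.1 + f1 * k2.1.2 + f2 * k2.2 = 0].
  move=> Jf; apply: Ir => e1 e2 Ie; rewrite -(h _ _ _ _ Ie Jf).
  by rewrite kE //; [exact: Iu|exact: Ju].
have [z1 z2 z3] := Jr k0.1.1 k0.1.2 k0.2 (fun f1 f2 h => let: And3 x _ _ := hf f1 f2 h in x).
have [z4 z5 z6] := Jr k1.1.1 k1.1.2 k1.2 (fun f1 f2 h => let: And3 _ x _ := hf f1 f2 h in x).
have [z7 z8 z9] := Jr k2.1.1 k2.1.2 k2.2 (fun f1 f2 h => let: And3 _ _ x := hf f1 f2 h in x).
move=> e1 e2 f1 f2 he hf' x; rewrite kE // z1 z2 z3 z4 z5 z6 z7 z8 z9; ring.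
Qed.

Lemma bicirc_r0 b p q m m' e1 e2 f1 f2 : bicirc b p q 0 m m' e1 e2 f1 f2 =
  b + circ m e1 e2 * p + q * circ m' f1 f2.
Proof. by rewrite /bicirc mulr0 mul0r addr0. Qed.

(** The surface is a product after translation to o = b - q r^-1 p. *)
Lemma bicirc_factor b p q r m m' e1 e2 f1 f2 : r != 0 ->
  bicirc b p q r m m' e1 e2 f1 f2 = (b - q * r^-1 * p) +
    (circ m e1 e2 + q * r^-1) * (p + r * circ m' f1 f2).
Proof.
move=> rn; rewrite /bicirc; move: (circ m _ _) (circ m' _ _) => E F.
have [ri riE] : exists ri, r^-1 = ri /\ ri * r = 1 by exists r^-1; rewrite qVmul.
case: riE => -> riE.
have -> : (E + q * ri) * (p + r * F) = E * p + q * ri * p + E * r * F + q * (ri * r) * F.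
  by rewrite mulrDl !mulrDr !mulrA addrACA addrA.
rewrite riE mulr1; move: (E * p) (q * ri * p) (E * r * F) (q * F) => x y z w.
by apply: quatP; rewrite !qE; ring.
Qed.

Lemma bicirc_quadric e b p q r m m' :
  let Xs x := exists e1 e2 f1 f2 : R, [/\ e1 ^+ 2 + e2 ^+ 2 = 1, f1 ^+ 2 + f2 ^+ 2 = 1
   & x = bicirc b p q r m m' e1 e2 f1 f2] in
  let sig x := e * qdot x x + q0 x in
  q0 m = 0 -> qdot m m = 1 -> (forall x, Xs x -> sig x = 0) ->
  (if r == 0 then ~ [/\ e = 0, p != 0 & q != 0]
   else 1 + (2 * e) *: (b - q * r^-1 * p) != 0) -> sphere_quadric sig Xs.
Proof.
move=> Xs sig m0 m1 on; have [r0|rn] := eqVneq r 0 => h.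
  have E : Xs = fun x => exists e1 e2 f1 f2 : R, [/\ e1 ^+ 2 + e2 ^+ 2 = 1, f1 ^+ 2 + f2 ^+ 2 = 1
   & x = b + circ m e1 e2 * p + q * circ m' f1 f2].
    apply/funext => x; rewrite /Xs r0; apply/propext.
    by split=> -[e1 [e2 [f1 [f2 [he hf xE]]]]]; exists e1, e2, f1, f2; split=> //;
      rewrite xE ?bicirc_r0.
  by rewrite E; apply: sum_quadric => // x hx; apply: on; rewrite E.
have E : Xs = fun x => exists e1 e2 f1 f2 : R, [/\ e1 ^+ 2 + e2 ^+ 2 = 1, f1 ^+ 2 + f2 ^+ 2 = 1
   & x = (b - q * r^-1 * p) + (circ m e1 e2 + q * r^-1) * (p + f1 *: r + f2 *: (r * m'))].
  have cE f1 f2 : p + r * circ m' f1 f2 = p + f1 *: r + f2 *: (r * m').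
    by rewrite /circ mulrDr qmul_real qscaleAr addrA.
  apply/funext => x; rewrite /Xs; apply/propext.
  by split=> -[e1 [e2 [f1 [f2 [he hf xE]]]]]; exists e1, e2, f1, f2; split=> //;
    rewrite xE bicirc_factor // cE.
by rewrite E; apply: product_quadric => // x hx; apply: on; rewrite E.
Qed.

(** Here the sphere of [bicirc_quadric] is the hyperplane R^3, and the only
    surface outside (D) is the sum of two circles. *)
Lemma bicirc_affine S I J b p q r m m' :
  q0 m = 0 -> qdot m m = 1 -> q0 m' = 0 -> qdot m' m' = 1 -> circle_rich I -> circle_rich J ->
  (forall e1 e2 f1 f2, I e1 e2 -> J f1 f2 -> q0 (bicirc b p q r m m' e1 e2 f1 f2) = 0) ->
  S !=set0 -> (forall y, S y -> exists e1 e2 f1 f2, [/\ e1 ^+ 2 + e2 ^+ 2 = 1,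
     f1 ^+ 2 + f2 ^+ 2 = 1 & imq y = bicirc b p q r m m' e1 e2 f1 f2]) -> classified S.
Proof.
move=> m0 m1 m0' m1' cI cJ h Sn Su.
have on e1 e2 f1 f2 : e1 ^+ 2 + e2 ^+ 2 = 1 -> f1 ^+ 2 + f2 ^+ 2 = 1 ->
     let x := bicirc b p q r m m' e1 e2 f1 f2 in 0 * qdot x x + q0 x = 0.
  by apply: (bicirc_all m0 m1 m0' m1' cI cJ) => *; rewrite mul0r add0r; exact: h.
have [[r0 pn qn]|nsum] := pselect [/\ r = 0, p != 0 & q != 0].
  left; rewrite r0 in on Su *.
  have [b0 p0 mp0 q00 qm0] : [/\ q0 b = 0, q0 p = 0, q0 (m * p) = 0, q0 q = 0 & q0 (q * m') = 0].
    by apply: q0_sum_circles => e1 e2 f1 f2 he hf; have := on _ _ _ _ he hf;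
      rewrite /= mul0r add0r bicirc_r0.
  have [al [be [cal cbe hz]]] := sum_circles m0 m1 m0' m1' b0 p0 mp0 q00 qm0 pn qn.
  exists al, be; split=> //; apply: (mobius_of_subset_intro (mobius_id3 R)) => y.
  move=> /Su[e1 [e2 [f1 [f2 [he hf yE]]]]].
  have [z hz1 zE] := hz _ _ _ _ he hf.
  exists (Some z); first by exists z.
  by congr Some; apply: imq_inj; rewrite zE yE bicirc_r0.
right; right; apply: (@cyclide_surface_affine R S (fun x => exists e1 e2 f1 f2 : R,
   [/\ e1 ^+ 2 + e2 ^+ 2 = 1, f1 ^+ 2 + f2 ^+ 2 = 1
   & x = bicirc b p q r m m' e1 e2 f1 f2])) => //.
apply: bicirc_quadric => //.
  by move=> x [e1 [e2 [f1 [f2 [he hf ->]]]]]; exact: on.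
case: eqVneq => [r0 [_ pn qn]|rn]; first exact: nsum.
by rewrite mulr0 scale0r addr0 oner_eq0.
Qed.

(** The two exceptions to (D): a sum of two circles in the hyperplane of
    imaginary x, seen through the inversion b1 + x^-1, and a product around
    the centre of the sphere. *)
Lemma bicirc_inverse S I J b1 b p q r m m' :
  q0 m = 0 -> qdot m m = 1 -> q0 m' = 0 -> qdot m' m' = 1 -> circle_rich I -> circle_rich J ->
  (forall e1 e2 f1 f2, I e1 e2 -> J f1 f2 -> let x := bicirc b p q r m m' e1 e2 f1 f2 in
     q0 b1 * qdot x x + q0 x = 0) ->
  S !=set0 -> (forall y, S y -> exists e1 e2 f1 f2, let x := bicirc b p q r m m' e1 e2 f1 f2 in
     [/\ e1 ^+ 2 + e2 ^+ 2 = 1, f1 ^+ 2 + f2 ^+ 2 = 1, x != 0 & imq y = b1 + x^-1]) -> classified S.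
Proof.
move=> m0 m1 m0' m1' cI cJ h Sn Su.
have on := bicirc_all m0 m1 m0' m1' cI cJ h.
have main : (if r == 0 then ~ [/\ q0 b1 = 0, p != 0 & q != 0]
   else 1 + (2 * q0 b1) *: (b - q * r^-1 * p) != 0) -> classified S.
  move=> nd; right; right; apply: (@cyclide_surface_inverse R S (fun x => exists e1 e2 f1 f2 : R,
   [/\ e1 ^+ 2 + e2 ^+ 2 = 1, f1 ^+ 2 + f2 ^+ 2 = 1
   & x = bicirc b p q r m m' e1 e2 f1 f2]) b1) => //.
    by apply: bicirc_quadric => // x [e1 [e2 [f1 [f2 [he hf ->]]]]]; exact: on.
  move=> y /Su[e1 [e2 [f1 [f2 [he hf xn yE]]]]].
  by exists (bicirc b p q r m m' e1 e2 f1 f2); split=> //; exists e1, e2, f1, f2.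
move: main; have [r0|rn] := eqVneq r 0 => /= main.
  have [[b10 pn qn]|//] := pselect [/\ q0 b1 = 0, p != 0 & q != 0].
  left; rewrite r0 in on Su *.
  have [b0 p0 mp0 q00 qm0] : [/\ q0 b = 0, q0 p = 0, q0 (m * p) = 0, q0 q = 0 & q0 (q * m') = 0].
    by apply: q0_sum_circles => e1 e2 f1 f2 he hf; have := on _ _ _ _ he hf;
      rewrite /= b10 mul0r add0r bicirc_r0.
  have [y1 y1E] := imq_surj b10.
  have c0 : q0 (b1 - b) = 0 by rewrite !qE b10 b0 subr0.
  have p0' : q0 (- p) = 0 by rewrite qN p0 oppr0.
  have mp0' : q0 (m * - p) = 0 by rewrite mulrN qN mp0 oppr0.
  have q00' : q0 (- q) = 0 by rewrite qN q00 oppr0.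
  have qm0' : q0 (- q * m') = 0 by rewrite mulNr qN qm0 oppr0.
  have pn' : - p != 0 by rewrite oppr_eq0.
  have qn' : - q != 0 by rewrite oppr_eq0.
  have [al [be [cal cbe hz]]] := sum_circles m0 m1 m0' m1' c0 p0' mp0' q00' qm0' pn' qn'.
  exists al, be; split=> //; apply: (mobius_of_subset_intro (mobius_inversion y1 ltr01)) => y.
  move=> /Su[e1 [e2 [f1 [f2 [he hf xn yE]]]]].
  have [z hz1 zE] := hz _ _ _ _ he hf.
  exists (Some z); first by exists z.
  set x := bicirc _ _ _ _ _ _ _ _ _ _ in xn yE.
  have x0 : q0 x = 0 by have := on _ _ _ _ he hf; rewrite /= b10 mul0r add0r.
  have zxE : imq (z - y1) = - x.
    rewrite imqD imqN zE -y1E /x bicirc_r0 mulrN mulNr.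
    by move: (_ * p) (q * _) => ? ?; apply: quatP; rewrite !qE; ring.
  have zn : z != y1.
    apply: contra_neq xn => zy; move: zxE; rewrite zy subrr => E.
    by apply: oppr_inj; rewrite -E oppr0; apply: quatP; rewrite !qE ?mxE.
  rewrite /= (negbTE zn); congr Some; apply: imq_inj; clearbody x.
  rewrite imqD imqZ zxE -y1E yE -qdot_imq zxE qinvE qnormsq_dot expr1n mul1r.
  have -> : qdot (- x) (- x) = qdot x x by rewrite /qdot !qE; ring.
  by rewrite (qconj_im x0).
have [n0|nn] := eqVneq (1 + (2 * q0 b1) *: (b - q * r^-1 * p)) 0; last exact: (main nn).
right; left.
have en : q0 b1 != 0.
  apply/eqP => e0; move/eqP: n0; rewrite e0 mulr0 scale0r addr0; exact/negP/oner_neq0.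
have oE : b - q * r^-1 * p = qreal (- (2 * q0 b1)^-1).
  have : (2 * q0 b1)^-1 *: (1 + (2 * q0 b1) *: (b - q * r^-1 * p)) = 0 by rewrite n0 scaler0.
  rewrite scalerDr scalerA mulVf ?mulf_neq0 ?pnatr_eq0 // scale1r => /eqP.
  rewrite addrC addr_eq0 => /eqP ->.
  by move: (_^-1) => k; apply: quatP; rewrite !qE; ring.
have ptE e1 e2 f1 f2 : bicirc b p q r m m' e1 e2 f1 f2 = qreal (- (2 * q0 b1)^-1) +
   (circ m e1 e2 + q * r^-1) * r * (circ m' f1 f2 + r^-1 * p).
  have -> : (circ m e1 e2 + q * r^-1) * r * (circ m' f1 f2 + r^-1 * p) =
     (circ m e1 e2 + q * r^-1) * (p + r * circ m' f1 f2).
    by rewrite -mulrA (mulrDr r) (mulrA r) qmulV // mul1r (addrC p).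
  by rewrite bicirc_factor // oE.
apply: (@product_cross_surface R S b1 m m' (q * r^-1) (r^-1 * p) r) => //.
  by move=> e1 e2 f1 f2 he hf; rewrite -ptE; exact: on.
move=> y /Su[e1 [e2 [f1 [f2 [he hf xn yE]]]]].
by exists e1, e2, f1, f2; rewrite -ptE.
Qed.
End BicircularConclusion.

(** * Möbius images of bicircular surfaces *)

Section Charts.
Variable R : realType.
Implicit Types (a b c d n o p q r w m s t : quat R) (S : set 'rV[R]_3).
Implicit Types (x : R -> R -> quat R) (Dp : R -> R -> Prop) (M : Rinf R 4 -> Rinf R 4).

(** The factors al and be only replace m and m' by conjugate units. *)
Lemma bicirc_transform al be ga b p q r m m' (e1 e2 f1 f2 : R) : al != 0 -> be != 0 ->
  al * bicirc b p q r m m' e1 e2 f1 f2 * be + ga =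
  bicirc (al * b * be + ga) (al * p * be) (al * q * be) (al * r * be)
    (al * m * al^-1) (be^-1 * m' * be) e1 e2 f1 f2.
Proof.
move=> aln ben; move: al^-1 be^-1 (qVmul aln) (qmulV ben) => ai bi aia bbi.
have aE : circ (al * m * ai) e1 e2 * al = al * circ m e1 e2.
  rewrite /circ mulrDl mulrDr qreal_mul qmul_real qscaleAl qscaleAr; congr (_ + _ *: _).
  by rewrite -mulrA aia mulr1.
have bE : be * circ (bi * m' * be) f1 f2 = circ m' f1 f2 * be.
  rewrite /circ mulrDl mulrDr qreal_mul qmul_real qscaleAl qscaleAr; congr (_ + _ *: _).
  by rewrite !mulrA bbi mul1r.
rewrite /bicirc; move: (circ _ e1 e2) (circ m e1 e2) (circ _ f1 f2) (circ m' f1 f2) aE bE => E' E F' F aE bE.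
have h1 : E' * (al * p * be) = al * (E * p) * be by rewrite !mulrA aE.
have h2 : al * q * be * F' = al * (q * F) * be by rewrite -(mulrA _ be) bE !mulrA.
have h3 : E' * (al * r * be) * F' = al * (E * r * F) * be.
  by rewrite -(mulrA E') -(mulrA _ be) bE !mulrA aE.
rewrite h1 h2 h3; move: (E * p) (q * F) (E * r * F) => {h1 h2 h3 aE bE} u1 u2 u3.
rewrite !mulrDr !mulrDl.
move: (al * b * be) (al * u1 * be) (al * u2 * be) (al * u3 * be) => v0 v1 v2 v3.
by apply: quatP; rewrite !qE; ring.
Qed.

Lemma unit_im_conjugate a ai m : a * ai = 1 -> q0 m = 0 -> qdot m m = 1 ->
  q0 (a * m * ai) = 0 /\ qdot (a * m * ai) (a * m * ai) = 1.
Proof.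
move=> h m0 m1; split.
  have aia : ai * a = 1.
    have an : a != 0 by apply/eqP => a0; move/eqP: h; rewrite a0 mul0r eq_sym oner_eq0.
    by rewrite -(qinv_uniq h) qVmul.
  by rewrite q0_cycle mulrA aia mul1r.
rewrite -qnormsq_dot !qnormsqM [qnormsq m]qnormsq_dot m1 mulr1 -qnormsqM h.
by rewrite qnormsq_dot /qdot !qE; ring.
Qed.

(** If c = 0, M is affine on H. If not, dividing gives (a x + b') (c x + d)^-1
    = a c^-1 + k (c x + d)^-1 with k = b' - a c^-1 d, and k <> 0 by
    injectivity. *)
Theorem bicirc_mobius S (I J : R -> R -> Prop) M tau b p q r m m' :
  q0 m = 0 -> qdot m m = 1 -> q0 m' = 0 -> qdot m' m' = 1 -> circle_rich I -> circle_rich J ->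
  mobius M -> S !=set0 ->
  (forall y, S y -> exists e1 e2 f1 f2, [/\ e1 ^+ 2 + e2 ^+ 2 = 1, f1 ^+ 2 + f2 ^+ 2 = 1
     & M (Some (conj_if tau (bicirc b p q r m m' e1 e2 f1 f2))) = Some (imq y)]) ->
  (forall e1 e2 f1 f2, I e1 e2 -> J f1 f2 -> exists y : 'rV[R]_3,
     M (Some (conj_if tau (bicirc b p q r m m' e1 e2 f1 f2))) = Some (imq y)) -> classified S.
Proof.
move=> m0 m1 m0' m1' cI cJ mM [y0 Sy0] hS hM.
have [a [b' [c [d [inj hfr]]]]] := mobius_imq tau mM.
pose B := bicirc b p q r m m'.
have [c0|cn] := eqVneq c 0.
  have dn : d != 0.
    by have [e1 [e2 [f1 [f2 [_ _ /hfr []]]]]] := hS _ Sy0; rewrite c0 mul0r add0r.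
  have an : a != 0.
    apply/eqP => a0; have [] := inj 1 0; first by rewrite a0 mul0r mulr0 addr0.
      by rewrite c0 mul0r mulr0 addr0.
    by move/eqP; rewrite oner_eq0.
  have din : d^-1 != 0 by rewrite qinv_eq0.
  have dE : d^-1 * d^-1^-1 = 1 by rewrite qmulV.
  have dE' : d^-1^-1 * d^-1 = 1 by rewrite qVmul.
  have aE : a * a^-1 = 1 by rewrite qmulV.
  have [n0 n1] := unit_im_conjugate aE m0 m1.
  have [n0' n1'] := unit_im_conjugate dE' m0' m1'.
  have yE e1 e2 f1 f2 (y : 'rV[R]_3) : M (Some (conj_if tau (B e1 e2 f1 f2))) = Some (imq y) ->
      imq y = bicirc (a * b * d^-1 + b' * d^-1) (a * p * d^-1) (a * q * d^-1) (a * r * d^-1)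
        (a * m * a^-1) (d^-1^-1 * m' * d^-1) e1 e2 f1 f2.
    move=> /hfr[_ ->]; rewrite c0 mul0r add0r -bicirc_transform //.
    by rewrite mulrDl.
  apply: (@bicirc_affine R S I J (a * b * d^-1 + b' * d^-1) (a * p * d^-1) (a * q * d^-1)
    (a * r * d^-1) (a * m * a^-1) (d^-1^-1 * m' * d^-1)) => //.
  - by move=> e1 e2 f1 f2 Ie Jf; have [y /yE <-] := hM _ _ _ _ Ie Jf; rewrite imqE.
  - by exists y0.
  - by move=> y /hS[e1 [e2 [f1 [f2 [he hf /yE E]]]]]; exists e1, e2, f1, f2.
have [ci cE] : exists ci, ci = c^-1 /\ c * ci = 1 by exists c^-1; rewrite qmulV.
case: cE => _ cE; pose k := b' - a * ci * d.
have kn : k != 0.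
  apply/eqP => k0; have [] := inj (- (ci * d)) 1.
  - by rewrite mulrN mulrA mulr1 addrC.
  - by rewrite mulrN mulrA cE mul1r mulr1 addNr.
  by move=> _ /eqP; rewrite oner_eq0.
have kin : k^-1 != 0 by rewrite qinv_eq0.
have ccE : c * c^-1 = 1 by rewrite qmulV.
have kE' : k^-1^-1 * k^-1 = 1 by rewrite qVmul.
have [n0 n1] := unit_im_conjugate ccE m0 m1.
have [n0' n1'] := unit_im_conjugate kE' m0' m1'.
pose x e1 e2 f1 f2 := bicirc (c * b * k^-1 + d * k^-1) (c * p * k^-1) (c * q * k^-1) (c * r * k^-1)
        (c * m * c^-1) (k^-1^-1 * m' * k^-1) e1 e2 f1 f2.
have yE e1 e2 f1 f2 (y : 'rV[R]_3) : M (Some (conj_if tau (B e1 e2 f1 f2))) = Some (imq y) ->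
   x e1 e2 f1 f2 != 0 /\ imq y = a * ci + (x e1 e2 f1 f2)^-1.
  move=> /hfr[dn yE]; rewrite /x -bicirc_transform // -/(B e1 e2 f1 f2) -mulrDl.
  split; first by rewrite qmul_eq0 negb_or dn.
  have kki : k^-1^-1 = k by apply: qinv_uniq; rewrite qVmul.
  rewrite qinvM // kki yE {yE}; move: (B e1 e2 f1 f2) dn => X dn.
  have num : a * X + b' = a * ci * (c * X + d) + k.
    have cicE : ci * c = 1 by rewrite -(qinv_uniq cE) qVmul.
    by rewrite mulrDr mulrA -(mulrA a ci c) cicE mulr1 /k (addrC b') addrA addrK.
  by rewrite num mulrDl -mulrA qmulV // mulr1.
apply: (@bicirc_inverse R S I J (a * ci) (c * b * k^-1 + d * k^-1) (c * p * k^-1) (c * q * k^-1) (c * r * k^-1)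
        (c * m * c^-1) (k^-1^-1 * m' * k^-1)) => //.
- move=> e1 e2 f1 f2 Ie Jf; have [y /yE[]] := hM _ _ _ _ Ie Jf; rewrite -/(x e1 e2 f1 f2).
  move: (x e1 e2 f1 f2) => X Xn E.
  have X2 : qdot X X != 0 by rewrite qdot_eq0.
  have : q0 (a * ci + X^-1) = 0 by rewrite -E imqE.
  move: (a * ci) => g; rewrite qinvE qnormsq_dot qD qZ qconjE => E'.
  transitivity (qdot X X * (q0 g + (qdot X X)^-1 * q0 X)); last by rewrite E' mulr0.
  by field.
- by exists y0.
- move=> y /hS[e1 [e2 [f1 [f2 [he hf /yE[xn E]]]]]]; exists e1, e2, f1, f2.
  by rewrite -/(x e1 e2 f1 f2).
Qed.
End Charts.

(** * Charts given by fractions of bilinear quaternions *)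

Section FractionCharts.
Variable R : realType.
Implicit Types (a b c d n o p q r w m s t : quat R) (S : set 'rV[R]_3).
Implicit Types (x : R -> R -> quat R) (Dp : R -> R -> Prop) (M : Rinf R 4 -> Rinf R 4).

(** x parametrises, over the parameters in Dp, a surface that M (after
    conjugation if tau holds) maps onto a subset of R^3 containing S; on a
    product of rich sets relations can be tested. *)
Definition chart S M (tau : bool) x Dp : Prop :=
  [/\ mobius M,
      exists I J : R -> Prop, [/\ rich I, rich J & forall u v, I u -> J v -> Dp u v],
      S !=set0,
      forall y, S y -> exists u v, Dp u v /\ M (Some (conj_if tau (x u v))) = Some (imq y)
    & forall u v, Dp u v -> exists y : 'rV[R]_3, M (Some (conj_if tau (x u v))) = Some (imq y)].

Lemma chart_swap S M tau x Dp : chart S M tau x Dp ->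
  chart S M tau (fun v u => x u v) (fun v u => Dp u v).
Proof.
move=> [mM [I [J [rI rJ IJ]]] Sn hS hM]; split=> //.
- by exists J, I; split=> // v u Jv Iu; exact: IJ.
- by move=> y /hS[u [v h]]; exists v, u.
- by move=> v u; exact: hM.
Qed.

Lemma chart_conj S M tau x Dp : chart S M tau x Dp ->
  chart S M (~~ tau) (fun u v => qconj (x u v)) Dp.
Proof.
have cE z : conj_if (~~ tau) (qconj z) = conj_if tau z by rewrite conj_ifN qconjK.
move=> [mM box Sn hS hM]; split=> //.
- by move=> y /hS[u [v h]]; exists u, v; rewrite cE.
- by move=> u v Duv; rewrite cE; exact: hM.
Qed.

Lemma chart_ext S M tau x x' Dp : (forall u v, Dp u v -> x u v = x' u v) ->
  chart S M tau x Dp -> chart S M tau x' Dp.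
Proof.
move=> e [mM box Sn hS hM]; split=> //.
- by move=> y /hS[u [v [Duv h]]]; exists u, v; rewrite -e.
- by move=> u v Duv; rewrite -e //; exact: hM.
Qed.

(** y = (a N D^-1 + b) (c N D^-1 + d)^-1 = (a N + b D) (c N + d D)^-1. *)
Lemma chart_right_fraction S M tau x Dp n0 n1 n2 n3 d0 d1 d2 d3 : chart S M tau x Dp ->
  (forall u v, Dp u v -> bl d0 d1 d2 d3 u v != 0 /\
     x u v = bl n0 n1 n2 n3 u v * (bl d0 d1 d2 d3 u v)^-1) -> classified S.
Proof.
move=> [mM [I [J [rI rJ IJ]]] Sn hS hM] hx; right; right.
have [a [b [c [d [inj hfr]]]]] := mobius_imq tau mM.
have hy u v (y : 'rV[R]_3) : Dp u v -> M (Some (conj_if tau (x u v))) = Some (imq y) ->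
   c * bl n0 n1 n2 n3 u v + d * bl d0 d1 d2 d3 u v != 0 /\
   imq y * (c * bl n0 n1 n2 n3 u v + d * bl d0 d1 d2 d3 u v) =
     a * bl n0 n1 n2 n3 u v + b * bl d0 d1 d2 d3 u v.
  move=> /hx[]; move: (bl n0 _ _ _ _ _) (bl d0 _ _ _ _ _) => N D Dn -> /hfr[].
  have [Di [-> DDi]] : exists Di, D^-1 = Di /\ D * Di = 1 by exists D^-1; rewrite qmulV.
  have Din : Di != 0 by apply/eqP => z; move/eqP: DDi; rewrite z mulr0 eq_sym oner_eq0.
  have fE g h : g * (N * Di) + h = (g * N + h * D) * Di.
    by rewrite mulrDl !mulrA -(mulrA h) DDi mulr1.
  rewrite !fE qmul_eq0 negb_or Din andbT => P2n yE; split=> //.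
  have DiD : Di * D = 1 by rewrite -(qinv_uniq DDi) qVmul.
  have : imq y * ((c * N + d * D) * Di) = (a * N + b * D) * Di.
    by rewrite yE -(mulrA _ _ ((c * N + d * D) * Di)) qVmul ?mulr1 // qmul_eq0 negb_or P2n.
  by move=> /(congr1 (fun z => z * D)); rewrite !mulrA -!(mulrA _ Di D) DiD !mulr1.
apply: (@bilinear_fraction_cyclide R S I J (a * n0 + b * d0) (a * n1 + b * d1)
   (a * n2 + b * d2) (a * n3 + b * d3) (c * n0 + d * d0) (c * n1 + d * d1)
   (c * n2 + d * d2) (c * n3 + d * d3)) => //.
- move=> u v Iu Jv; have Duv := IJ _ _ Iu Jv; have [y yE] := hM _ _ Duv.
  have [_] := hy _ _ _ Duv yE.
  rewrite -!bl_add -!bl_mull => <-; move: (c * _ + _) => P.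
  by rewrite /qdot !qE; ring.
- move=> y /hS[u [v [Duv yE]]]; exists u, v; rewrite -!bl_add -!bl_mull.
  exact: hy yE.
Qed.

Definition linear_quotient s t n0 n1 n2 n3 (u v : R) : quat R :=
  (qreal u + s)^-1 * bl n0 n1 n2 n3 u v * (qreal v + t)^-1.

(** With s = s0 + sg m, sg > 0, and u = sg g - s0, (u + s)^-1 is (g - m) / (sg
    (g^2 + 1)); this is (E - m) / (2 sg) for the rational parametrisation E of
    the unit circle of the subfield of m. *)
Lemma linear_circle s : im s != 0 -> exists m (lam : R) (g1 g2 : R -> R),
  [/\ q0 m = 0 /\ qdot m m = 1,
      forall u, g1 u ^+ 2 + g2 u ^+ 2 = 1,
      forall u, (qreal u + s)^-1 = lam *: (circ m (g1 u) (g2 u) - m)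
    & forall I, rich I -> circle_rich (fun e1 e2 => exists2 u, I u & e1 = g1 u /\ e2 = g2 u)].
Proof.
move=> sn; have ssp : 0 < qdot (im s) (im s) by exact: qdot_gt0.
pose sg := Num.sqrt (qdot (im s) (im s)).
have sgp : 0 < sg by rewrite sqrtr_gt0.
have sgn : sg != 0 by rewrite gt_eqF.
have sg2 : sg ^+ 2 = qdot (im s) (im s) by rewrite sqr_sqrtr // ltW.
clearbody sg; pose m := sg^-1 *: im s.
have m0 : q0 m = 0 by rewrite qZ imE mulr0.
have m1 : qdot m m = 1.
  transitivity (sg^-1 ^+ 2 * qdot (im s) (im s)).
    by rewrite /m; move: (sg^-1) (im s) => k z; rewrite /qdot !qE; ring.
  by rewrite -sg2; field.
have sE : s = qreal (q0 s) + sg *: m.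
  by rewrite /m scalerA mulfV // scale1r; apply: quatP; rewrite !qX; ring.
clearbody m; pose c := q0 s.
pose g u := (u + c) / sg; pose D u := g u ^+ 2 + 1.
have Dp u : 0 < D u by rewrite ltr_wpDl // sqr_ge0.
have Dn u : D u != 0 by rewrite gt_eqF.
exists m, (2 * sg)^-1, (fun u => 2 * g u / D u), (fun u => (g u ^+ 2 - 1) / D u); split=> //.
- by move=> u; move: (Dn u); rewrite /D; move: (g u) => k kn; field.
- move=> u; apply: qinv_uniq; rewrite sE -/c.
  have -> : qreal u + (qreal c + sg *: m) = sg *: (qreal (g u) + m).
    by apply: quatP; rewrite /g !qE; field.
  have -> : circ m (2 * g u / D u) ((g u ^+ 2 - 1) / D u) - m = (2 / D u) *: (qreal (g u) - m).
    move: (Dn u); rewrite /D; move: (g u) => k kn.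
    by apply: quatP; rewrite /circ !qE; field.
  rewrite !(qscaleAl, qscaleAr) !scalerA.
  have -> : (qreal (g u) + m) * (qreal (g u) - m) = qreal (D u).
    have -> : qreal (g u) - m = qconj (qreal (g u) + m) by apply: quatP; rewrite !qE ?m0; ring.
    rewrite qmul_conj; congr qreal; rewrite /D -m1.
    by move: (g u) => k; rewrite /qdot !qE m0; ring.
  by move: (D u) (Dn u) => k kn; apply: quatP; rewrite !qE; field; rewrite ?sgn ?kn.
- move=> I rI; split=> [_ _ [u _ [-> ->]]|k0 k1 k2 h].
    by move: (Dn u); rewrite /D; move: (g u) => k kn; field.
  pose r := sg^-1; have rn : r != 0 by rewrite invr_eq0.
  have [e0 e1 e2] : [/\ (k0 - k2) + 2 * k1 * (r * c) + (k0 + k2) * (r * c) ^+ 2 = 0,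
     r * (2 * k1 + 2 * (k0 + k2) * (r * c)) = 0 & r ^+ 2 * (k0 + k2) = 0].
    apply: rI => u Iu; have := h _ _ (ex_intro2 _ _ u Iu (conj erefl erefl)).
    have gE : g u = r * u + r * c by rewrite /g /r mulrDl ![_ / sg]mulrC.
    move=> E; transitivity (D u * (k0 + 2 * g u / D u * k1 + (g u ^+ 2 - 1) / D u * k2)).
      by move: (Dn u); rewrite /D gE; move: (r * c) => rc kn; field.
    by rewrite E mulr0.
  have k02 : k0 + k2 = 0.
    by apply: (mulfI (expf_neq0 2 rn)); rewrite mulr0.
  have k10 : k1 = 0.
    have : 2 * k1 + 2 * (k0 + k2) * (r * c) = 0 by apply: (mulfI rn); rewrite mulr0.
    by rewrite k02; lra.
  by move: e0; rewrite k02 k10 !(mulr0, mul0r) => e0; split; lra.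
Qed.

(** Write N in powers of u + s and v + t: N = (u + s) n3 (v + t) + P (v + t) +
    (u + s) Q + W. *)
Lemma linear_quotient_bicirc m m' (lam kap : R) s t n0 n1 n2 n3 (u v e1 e2 f1 f2 : R) :
  qreal u + s != 0 -> qreal v + t != 0 ->
  (qreal u + s)^-1 = lam *: (circ m e1 e2 - m) ->
  (qreal v + t)^-1 = kap *: (circ m' f1 f2 - m') ->
  let P := n2 - s * n3 in let Q := n1 - n3 * t in
  let W := n0 - s * n1 - n2 * t + s * n3 * t in
  linear_quotient s t n0 n1 n2 n3 u v =
  bicirc (n3 - lam *: (m * P) - kap *: (Q * m') + (lam * kap) *: (m * W * m'))
    (lam *: P - (lam * kap) *: (W * m')) (kap *: Q - (lam * kap) *: (m * W))
    ((lam * kap) *: W) m m' e1 e2 f1 f2.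
Proof.
move=> un vn uE vE P Q W.
have NE : bl n0 n1 n2 n3 u v = (qreal u + s) * n3 * (qreal v + t) + P * (qreal v + t)
   + (qreal u + s) * Q + W.
  rewrite /bl /P /Q /W !(mulNr, mulrN, mulrDl, mulrDr, mulrBl, mulrBr) !(qreal_mul, qmul_real, qscaleAl) ?mulrA.
  move: (s * n3) (s * n1) (n2 * t) (n3 * t) (s * n3 * t) => z1 z2 z3 z4 z5.
  by rewrite !scalerA; apply: quatP; rewrite !qE; ring.
have LE : linear_quotient s t n0 n1 n2 n3 u v = n3 + (qreal u + s)^-1 * P
   + Q * (qreal v + t)^-1 + (qreal u + s)^-1 * W * (qreal v + t)^-1.
  rewrite /linear_quotient NE; clearbody P Q W; move: (qreal u + s) (qreal v + t) un vn => U V Un Vn.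
  move: U^-1 V^-1 (qVmul Un) (qmulV Vn) => Ui Vi UU VV.
  by rewrite !mulrDr !mulrDl !mulrA UU !mul1r -!(mulrA _ V Vi) VV !mulr1.
rewrite LE uE vE /bicirc; clearbody P Q W; move: (circ m _ _) (circ m' _ _) => E F.
rewrite !(mulrBl, mulrBr, scalerBr, qscaleAl, qscaleAr, scalerA) !mulrA.
move: (E * P) (m * P) (Q * F) (Q * m') (E * W * F) (m * W * F) (E * W * m') (m * W * m')
  => z1 z2 z3 z4 z5 z6 z7 z8.
by apply: quatP; rewrite !qE; ring.
Qed.
End FractionCharts.

Section FactoredCharts.
Variable R : realType.
Implicit Types (a b c d n o p q r w m s t : quat R) (S : set 'rV[R]_3).
Implicit Types (x : R -> R -> quat R) (Dp : R -> R -> Prop) (M : Rinf R 4 -> Rinf R 4).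

Lemma q0_im s : s = qreal (q0 s) + im s.
Proof. by apply: quatP; rewrite !qX; ring. Qed.

Lemma linear_quotient_classified_bicirc S M tau s t n0 n1 n2 n3 Dp :
  chart S M tau (linear_quotient s t n0 n1 n2 n3) Dp ->
  im s != 0 -> im t != 0 -> classified S.
Proof.
move=> [mM [I [J [rI rJ IJ]]] Sn hS hM] sn tn.
have [m [lam [g1 [g2 [[m0 m1] gu gE gr]]]]] := linear_circle sn.
have [m' [kap [h1 [h2 [[m0' m1'] hu hE hr]]]]] := linear_circle tn.
have nz (z : quat R) (k : R) : im z != 0 -> qreal k + z != 0.
  apply: contra_neq => E; apply: quatP; rewrite !qX //.
  - by have := congr1 (fun y : quat R => q1 y) E; rewrite !qE add0r.
  - by have := congr1 (fun y : quat R => q2 y) E; rewrite !qE add0r.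
  - by have := congr1 (fun y : quat R => q3 y) E; rewrite !qE add0r.
have LE u v := linear_quotient_bicirc n0 n1 n2 n3 (nz s u sn) (nz t v tn) (gE u) (hE v).
apply: (bicirc_mobius m0 m1 m0' m1' (gr _ rI) (hr _ rJ) mM Sn).
- move=> y /hS[u [v [_ yE]]]; exists (g1 u), (g2 u), (h1 v), (h2 v); split=> //.
  by rewrite -yE LE.
- move=> _ _ _ _ [u Iu [-> ->]] [v Jv [-> ->]]; rewrite -LE.
  by apply: hM; exact: IJ.
Qed.

Lemma rich_ex (I : R -> Prop) : rich I -> exists u, I u.
Proof.
move=> rI; apply: contrapT => h; have [] := rI 1 0 0; last by move/eqP; rewrite oner_eq0.
by move=> u Iu; case: h; exists u.
Qed.

(** In terms of g = 1/(u + s), x = g N (v + t)^-1, and g N is bilinear in g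
    and v. *)
Lemma linear_quotient_classified_real S M tau s t n0 n1 n2 n3 Dp :
  chart S M tau (linear_quotient s t n0 n1 n2 n3) Dp ->
  (forall u v, Dp u v -> qreal u + s != 0 /\ qreal v + t != 0) ->
  im s = 0 -> classified S.
Proof.
move=> [mM [I [J [rI rJ IJ]]] Sn hS hM] nz s0.
pose k := q0 s; have sE : s = qreal k by rewrite (q0_im s) s0 addr0.
have usE u : qreal u + s = qreal (u + k) by rewrite sE; apply: quatP; rewrite !qE ?addr0.
have nz' u v : Dp u v -> u + k != 0.
  move=> /nz[+ _]; rewrite usE; apply: contra_neq => ->.
  by apply: quatP; rewrite !qE.
pose x g v := linear_quotient s t n0 n1 n2 n3 (g^-1 - k) v.
pose Dg g v := g != 0 /\ Dp (g^-1 - k) v.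
have back u v : Dp u v -> (u + k)^-1 != 0 /\ (u + k)^-1^-1 - k = u.
  by move=> /nz' h; rewrite invr_eq0 h invrK addrK.
have ch : chart S M tau x Dg.
  split=> //.
  - exists (fun g => g != 0 /\ I (g^-1 - k)), J; split=> //; last first.
      by move=> g v [gn Ig] Jv; split=> //; exact: IJ.
    move=> c0 c1 c2 h; have [v Jv] := rich_ex rJ.
    have [e0 e1 e2] : [/\ c2 + k * c1 + k ^+ 2 * c0 = 0, c1 + 2 * k * c0 = 0 & c0 = 0].
      apply: rI => u Iu; have Duv := IJ _ _ Iu Jv; have [gn gE] := back _ _ Duv.
      have := h (u + k)^-1; rewrite gn gE => /(_ (conj isT Iu)) E.
      have un := nz' _ _ Duv.
      transitivity ((u + k) ^+ 2 * (c0 + (u + k)^-1 * c1 + (u + k)^-1 ^+ 2 * c2)).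
        by field.
      by rewrite E mulr0.
    have c10 : c1 = 0 by move: e1; rewrite e2 mulr0 addr0.
    by move: e0; rewrite e2 c10 !mulr0 !addr0.
  - move=> y /hS[u [v [Duv yE]]]; have [gn gE] := back _ _ Duv.
    by exists (u + k)^-1, v; rewrite /Dg /x gE.
  - by move=> g v [_ Dgv]; exact: hM.
apply: (chart_right_fraction (n0 := n1) (n1 := n0 - k *: n1) (n2 := n3) (n3 := n2 - k *: n3)
   (d0 := t) (d1 := 0) (d2 := 1) (d3 := 0) ch) => g v [gn Dgv].
have [_ tn] := nz _ _ Dgv.
have -> : bl t 0 1 0 g v = qreal v + t.
  by rewrite /bl; apply: quatP; rewrite !qE; ring.
split=> //; rewrite /x /linear_quotient usE subrK; congr (_ * _).
have -> : (qreal g^-1)^-1 = qreal g.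
  by apply: qinv_uniq; rewrite qreal_mul; apply: quatP; rewrite !qE; field.
by rewrite qreal_mul /bl; apply: quatP; rewrite !qE; field.
Qed.

Lemma linear_quotient_conj s t n0 n1 n2 n3 (u v : R) : qreal u + s != 0 -> qreal v + t != 0 ->
  qconj (linear_quotient s t n0 n1 n2 n3 u v) =
  linear_quotient (qconj t) (qconj s) (qconj n0) (qconj n2) (qconj n1) (qconj n3) v u.
Proof.
move=> un vn.
rewrite /linear_quotient !qconjM !qconjV // !qconj_shift mulrA; congr (_ * _ * _).
by rewrite /bl; apply: quatP; rewrite !qE; ring.
Qed.

(** If t is real, conjugation together with the exchange of u and v brings it
    to the place of s. *)
Lemma linear_quotient_classified S M tau s t n0 n1 n2 n3 Dp :
  chart S M tau (linear_quotient s t n0 n1 n2 n3) Dp ->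
  (forall u v, Dp u v -> qreal u + s != 0 /\ qreal v + t != 0) -> classified S.
Proof.
move=> ch nz; have [sr|sn] := eqVneq (im s) 0.
  exact: linear_quotient_classified_real ch nz sr.
have [tr|tn] := eqVneq (im t) 0; last exact: linear_quotient_classified_bicirc ch sn tn.
have trc : im (qconj t) = 0.
  have -> : im (qconj t) = - im t by apply: quatP; rewrite !qX ?oppr0.
  by rewrite tr oppr0.
apply: (linear_quotient_classified_real (chart_swap (chart_ext _ (chart_conj ch))) _ trc).
- by move=> u v /nz[un vn]; exact: linear_quotient_conj.
- move=> v u /nz[un vn].
  by rewrite -!qconj_shift -!qnormsq_eq0 !qnormsq_conj !qnormsq_eq0.
Qed.

Lemma bl_swap a0 a1 a2 a3 (u v : R) : bl a0 a1 a2 a3 u v = bl a0 a2 a1 a3 v u.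
Proof. by rewrite /bl (mulrC u) (addrAC a0). Qed.

Lemma bl_const a0 (u v : R) : bl a0 0 0 0 u v = a0.
Proof. by rewrite /bl !scaler0 !addr0. Qed.

Lemma bl_conj a0 a1 a2 a3 (u v : R) :
  qconj (bl a0 a1 a2 a3 u v) = bl (qconj a0) (qconj a1) (qconj a2) (qconj a3) u v.
Proof. by rewrite /bl; apply: quatP; rewrite !qE; ring. Qed.

(** The values of Phi: the coefficients a_i and c_i are those of the conjugate
    polynomials. *)
Definition bl_fraction a0 a1 a2 a3 b0 b1 b2 b3 c0 c1 c2 c3 (u v : R) : quat R :=
  (bl a0 a1 a2 a3 u v)^-1 * bl b0 b1 b2 b3 u v * (bl c0 c1 c2 c3 u v)^-1.

Lemma fraction_classified_left S M tau Dp a0 b0 b1 b2 b3 c0 c1 c2 c3 :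
  chart S M tau (bl_fraction a0 0 0 0 b0 b1 b2 b3 c0 c1 c2 c3) Dp ->
  (forall u v, Dp u v -> bl c0 c1 c2 c3 u v != 0) -> classified S.
Proof.
move=> ch nz.
apply: (chart_right_fraction (n0 := a0^-1 * b0) (n1 := a0^-1 * b1) (n2 := a0^-1 * b2)
   (n3 := a0^-1 * b3) ch) => u v /nz cn; split; first exact: cn.
by rewrite /bl_fraction bl_const bl_mull.
Qed.

Lemma bl_fraction_conj a0 a1 a2 a3 b0 b1 b2 b3 c0 c1 c2 c3 (u v : R) :
  bl a0 a1 a2 a3 u v != 0 -> bl c0 c1 c2 c3 u v != 0 ->
  qconj (bl_fraction a0 a1 a2 a3 b0 b1 b2 b3 c0 c1 c2 c3 u v) =
  bl_fraction (qconj c0) (qconj c1) (qconj c2) (qconj c3) (qconj b0) (qconj b1) (qconj b2)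
     (qconj b3) (qconj a0) (qconj a1) (qconj a2) (qconj a3) u v.
Proof.
move=> an cn.
by rewrite /bl_fraction !qconjM !qconjV // !bl_conj mulrA.
Qed.

(** The conjugate of x has its constant factor on the left. *)
Lemma fraction_classified_right S M tau Dp a0 a1 a2 a3 b0 b1 b2 b3 c0 :
  chart S M tau (bl_fraction a0 a1 a2 a3 b0 b1 b2 b3 c0 0 0 0) Dp ->
  (forall u v, Dp u v -> bl a0 a1 a2 a3 u v != 0 /\ bl c0 0 0 0 u v != 0) -> classified S.
Proof.
move=> ch nz.
have E u v : Dp u v -> qconj (bl_fraction a0 a1 a2 a3 b0 b1 b2 b3 c0 0 0 0 u v) =
   bl_fraction (qconj c0) 0 0 0 (qconj b0) (qconj b1) (qconj b2)
     (qconj b3) (qconj a0) (qconj a1) (qconj a2) (qconj a3) u v.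
  by move=> /nz[an cn]; rewrite bl_fraction_conj // qconj0.
apply: (fraction_classified_left (chart_ext E (chart_conj ch))) => u v /nz[an _].
by rewrite -bl_conj -qnormsq_eq0 qnormsq_conj qnormsq_eq0.
Qed.

(** If a1 = 0 or c2 = 0, a factor is constant; otherwise a0 + u a1 = a1 (u +
    s) and c0 + v c2 = (v + t) c2. *)
Lemma fraction_classified_linear S M tau Dp a0 a1 b0 b1 b2 b3 c0 c2 :
  chart S M tau (bl_fraction a0 a1 0 0 b0 b1 b2 b3 c0 0 c2 0) Dp ->
  (forall u v, Dp u v -> bl a0 a1 0 0 u v != 0 /\ bl c0 0 c2 0 u v != 0) -> classified S.
Proof.
move=> ch nz; have [a10|a1n] := eqVneq a1 0.
  by rewrite a10 in ch nz; apply: (fraction_classified_left ch) => u v /nz[].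
have [c20|c2n] := eqVneq c2 0.
  by rewrite c20 in ch nz; apply: (fraction_classified_right ch).
have aE u v : bl a0 a1 0 0 u v = a1 * (qreal u + a1^-1 * a0).
  rewrite mulrDr qmul_real mulrA qmulV // mul1r /bl !scaler0 !addr0 addrC //.
have cE u v : bl c0 0 c2 0 u v = (qreal v + c0 * c2^-1) * c2.
  rewrite mulrDl qreal_mul -mulrA qVmul // mulr1 /bl !scaler0 !addr0 addrC //.
have nz' u v : Dp u v -> qreal u + a1^-1 * a0 != 0 /\ qreal v + c0 * c2^-1 != 0.
  by move=> /nz[]; rewrite aE cE !qmul_eq0 !negb_or => /andP[_ ?] /andP[? _].
have E u v : Dp u v -> bl_fraction a0 a1 0 0 b0 b1 b2 b3 c0 0 c2 0 u v =
   linear_quotient (a1^-1 * a0) (c0 * c2^-1) (a1^-1 * b0 * c2^-1) (a1^-1 * b1 * c2^-1)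
     (a1^-1 * b2 * c2^-1) (a1^-1 * b3 * c2^-1) u v.
  move=> /nz'[sn tn]; rewrite /bl_fraction /linear_quotient aE cE !qinvM //.
  by rewrite -bl_mulr -bl_mull !mulrA.
exact: (linear_quotient_classified (chart_ext E ch) nz').
Qed.

Theorem fraction_classified S M tau Dp a0 a1 a2 a3 b0 b1 b2 b3 c0 c1 c2 c3 :
  chart S M tau (bl_fraction a0 a1 a2 a3 b0 b1 b2 b3 c0 c1 c2 c3) Dp ->
  (forall u v, Dp u v -> bl a0 a1 a2 a3 u v != 0 /\ bl c0 c1 c2 c3 u v != 0) ->
  (a1 = 0 /\ a3 = 0) \/ (c1 = 0 /\ c3 = 0) ->
  (a2 = 0 /\ a3 = 0) \/ (c2 = 0 /\ c3 = 0) -> classified S.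
Proof.
move=> ch nz [[a10 a30]|[c10 c30]] [[a20 a30']|[c20 c30']].
- by rewrite a10 a20 a30 in ch nz; apply: (fraction_classified_left ch) => u v /nz[].
- rewrite a10 a30 c20 c30' in ch nz.
  have E u v : Dp u v -> bl_fraction a0 0 a2 0 b0 b1 b2 b3 c0 c1 0 0 u v =
     bl_fraction a0 a2 0 0 b0 b2 b1 b3 c0 0 c1 0 v u.
    by move=> _; rewrite /bl_fraction ![bl _ _ _ _ u v]bl_swap.
  apply: (fraction_classified_linear (chart_swap (chart_ext E ch))) => v u /nz.
  by rewrite ![bl _ _ _ _ u v]bl_swap.
- by rewrite a20 a30' c10 c30 in ch nz; apply: (fraction_classified_linear ch).
- by rewrite c10 c20 c30 in ch nz; apply: (fraction_classified_right ch).
Qed.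
End FactoredCharts.

(** * Polynomials of bidegree (1, 1) *)

Section BilinearPolynomials.
Variable R : realType.
Implicit Types (A B C : {poly {poly quat R}}).

Definition bilinear A : Prop := forall i j, (1 < i)%N || (1 < j)%N -> A`_i`_j = 0.

Lemma in_H11_bilinear A : in_Hmn 1 1 A -> bilinear A.
Proof.
move=> [su sv] i j; case: ltnP => [iA _|i1 /= j1].
  by rewrite (nth_default _ (leq_trans su iA)) coef0.
rewrite nth_default //; apply: leq_trans j1; apply: leq_trans sv.
exact: max_size_coefXY.
Qed.

Lemma pconj_coef A i j : (pconj A)`_i`_j = qconj A`_i`_j.
Proof.
by rewrite /pconj !coef_map_id0 ?qconj0 //; apply/polyP => k; rewrite coef_map_id0 ?coef0 qconj0.
Qed.

Lemma bilinear_pconj A : bilinear A -> bilinear (pconj A).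
Proof.
by move=> hA i j ij; rewrite pconj_coef hA // qconj0.
Qed.

Lemma qeval_bilinear A (w : 'rV[R]_2) : bilinear A ->
  qeval A w = bl A`_0`_0 A`_1`_0 A`_0`_1 A`_1`_1 (w 0 0) (w 0 1).
Proof.
move=> hA; have sA : (size A <= 2)%N.
  by apply/leq_sizeP => i i2; apply/polyP => j; rewrite hA ?i2 // coef0.
have sAi (i : nat) : (size (A`_i)%R <= 2)%N by apply/leq_sizeP => j j2; rewrite hA // j2 orbT.
have lin (p : {poly quat R}) (k : R) : (size p <= 2)%N -> p.[qreal k] = p`_0 + k *: p`_1.
  move=> sp; rewrite (horner_coef_wide _ sp) !big_ord_recr big_ord0 /= add0r.
  by rewrite expr0 mulr1 expr1 qmul_real.
rewrite /qeval (horner_coef_wide _ sA) !big_ord_recr big_ord0 /= add0r.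
rewrite expr0 mulr1 expr1 hornerD lin //.
have sAu : (size (A`_1 * (qreal (w 0 0))%:P)%R <= 2)%N.
  by apply/leq_sizeP => j j2; rewrite coefMC hA ?j2 ?orbT // mul0r.
rewrite lin // !coefMC !qmul_real /bl scalerA mulrC.
by move: A`_0`_0 A`_1`_0 A`_0`_1 A`_1`_1 => a0 a1 a2 a3; apply: quatP; rewrite !qE; ring.
Qed.

(** A product of two linear polynomials is again linear only if one factor is
    constant: the top coefficients of u^2, u^2 v and u^2 v^2 are those of a
    product of polynomials over a division ring. *)
Lemma linear_top (a1 a3 c1 c3 : quat R) :
  a1 * c1 = 0 -> a3 * c3 = 0 -> a1 * c3 + a3 * c1 = 0 ->
  (a1 = 0 /\ a3 = 0) \/ (c1 = 0 /\ c3 = 0).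
Proof.
have mul0 (a c : quat R) : a * c = 0 -> a = 0 \/ c = 0.
  by move/eqP; rewrite qmul_eq0 => /orP[]/eqP; [left|right].
move=> /mul0[->|->] /mul0[->|->]; rewrite ?mul0r ?mulr0 ?add0r ?addr0.
- by left.
- by move=> /mul0[->|->]; [left|right].
- by move=> /mul0[->|->]; [left|right].
- by right.
Qed.

Lemma mul_bilinear A C : bilinear A -> bilinear C -> bilinear (A * C) ->
  ((A`_1`_0 = 0 /\ A`_1`_1 = 0) \/ (C`_1`_0 = 0 /\ C`_1`_1 = 0)) /\
  ((A`_0`_1 = 0 /\ A`_1`_1 = 0) \/ (C`_0`_1 = 0 /\ C`_1`_1 = 0)).
Proof.
move=> hA hC hAC.
have A2 i : A`_2`_i = 0 by exact: hA.
have C2 i : C`_2`_i = 0 by exact: hC.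
have A2' i : A`_i`_2 = 0 by apply: hA; rewrite orbT.
have C2' i : C`_i`_2 = 0 by apply: hC; rewrite orbT.
have E := (coefM, coef_sum, big_ord_recr, big_ord0).
have e20 : (A * C)`_2`_0 = 0 by exact: hAC.
have e21 : (A * C)`_2`_1 = 0 by exact: hAC.
have e22 : (A * C)`_2`_2 = 0 by exact: hAC.
have e02 : (A * C)`_0`_2 = 0 by exact: hAC.
have e12 : (A * C)`_1`_2 = 0 by exact: hAC.
have z := (A2, C2, A2', C2', mul0r, mulr0, add0r, addr0).
move: e20 e21 e22 e02 e12; rewrite !(E, coefD) /= ?(E, coefD) /=.
rewrite !z => e20 e21 e22 e02 e12; split; exact: linear_top.
Qed.
End BilinearPolynomials.

Theorem theorem1p4 (R : realType) (S : set 'rV[R]_3)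
    (A B C : {poly {poly quat R}}) (D : set 'rV[R]_2)
    (M : Rinf R 4 -> Rinf R 4) :
  analytic_surface S ->
  in_Hmn 1 1 A -> in_Hmn 1 1 B -> in_Hmn 1 1 C ->
  in_Hmn 1 1 (A * C) -> A * C != 0 ->
  planar_domain D ->
  (forall w, D w -> qeval (pconj A) w != 0 /\ qeval (pconj C) w != 0) ->
  mobius M ->
  Some @` (@imq R @` S) = M @` (Some @` (Phi A B C @` D)) ->
  (* (E) *)
  (exists al be : set 'rV[R]_3,
     [/\ is_circle al, is_circle be &
         mobius_of_subset (Some @` S) (Some @` sum_set al be)])
  (* (C) *)
  \/ (exists al be : set 'rV[R]_3,
     [/\ is_circle al, is_circle be,
         al `<=` @unit_sphere R, be `<=` @unit_sphere R &
         mobius_of_subset (Some @` S) (cross_set al be)])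
  (* (D) *)
  \/ (exists Q : mpoly 4 R,
     [/\ mmeasure (@mdeg 4) Q = 2%N \/ mmeasure (@mdeg 4) Q = 3%N,
         cyclide Q <> [set: 'rV[R]_3] &
         mobius_of_subset (Some @` S) (Some @` cyclide Q)]).
Proof.
move=> _ /in_H11_bilinear hA /in_H11_bilinear hB /in_H11_bilinear hC /in_H11_bilinear hAC _.
move=> [oD _ [w0 Dw0]] nz mM SE.
have [dA dC] := mul_bilinear hA hC hAC.
pose pt u v : 'rV[R]_2 := \row_(j < 2) [:: u; v]`_j.
have ptE (w : 'rV[R]_2) : w = pt (w 0 0) (w 0 1).
  apply/rowP => j; rewrite mxE; case: j => -[|[|//]] /= j2; congr (w 0 _); exact: val_inj.
have pt0 u v : (pt u v) 0 0 = u by rewrite mxE.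
have pt1 u v : (pt u v) 0 1 = v by rewrite mxE.
have evE X u v : bilinear X -> qeval X (pt u v) = bl X`_0`_0 X`_1`_0 X`_0`_1 X`_1`_1 u v.
  by move=> hX; rewrite qeval_bilinear // pt0 pt1.
pose Dp u v := D (pt u v).
have fE u v : Phi A B C (pt u v) = bl_fraction
    (pconj A)`_0`_0 (pconj A)`_1`_0 (pconj A)`_0`_1 (pconj A)`_1`_1
    B`_0`_0 B`_1`_0 B`_0`_1 B`_1`_1
    (pconj C)`_0`_0 (pconj C)`_1`_0 (pconj C)`_0`_1 (pconj C)`_1`_1 u v.
  by rewrite /Phi !evE //; exact: bilinear_pconj.
have MS w : D w -> exists2 y, S y & M (Some (Phi A B C w)) = Some (imq y).
  move=> Dw; have : (Some @` (@imq R @` S)) (M (Some (Phi A B C w))).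
    by rewrite SE; exists (Some (Phi A B C w)) => //; exists (Phi A B C w) => //; exists w.
  by move=> [_ [y Sy <-] <-]; exists y.
have SM y : S y -> exists2 w, D w & M (Some (Phi A B C w)) = Some (imq y).
  move=> Sy; have : (M @` (Some @` (Phi A B C @` D))) (Some (imq y)).
    by rewrite -SE; exists (imq y) => //; exists y.
  by move=> [_ [_ [w Dw <-] <-] Mw]; exists w.
have ch : chart S M false (bl_fraction
    (pconj A)`_0`_0 (pconj A)`_1`_0 (pconj A)`_0`_1 (pconj A)`_1`_1
    B`_0`_0 B`_1`_0 B`_0`_1 B`_1`_1
    (pconj C)`_0`_0 (pconj C)`_1`_0 (pconj C)`_0`_1 (pconj C)`_1`_1) Dp.
  split=> //.
  - have /nbhs_ballP[e /= e0 he] : nbhs w0 D by exact: open_nbhs_nbhs.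
    exists (fun u => `|u - w0 0 0| < e), (fun v => `|v - w0 0 1| < e); split.
    + exact: rich_three e0 (fun _ h => h).
    + exact: rich_three e0 (fun _ h => h).
    + move=> u v hu hv; apply: he; split=> // i j; rewrite (ord1 i) mxE.
      case: j => -[|[|//]] /= j2; rewrite /ball /= distrC.
        by move: hu; congr (`|_ - w0 0 _| < _); exact: val_inj.
      by move: hv; congr (`|_ - w0 0 _| < _); exact: val_inj.
  - by have [y Sy _] := MS _ Dw0; exists y.
  - by move=> y /SM[w Dw Mw]; exists (w 0 0), (w 0 1); rewrite /Dp /= -fE -ptE.
  - by move=> u v /MS[y _ My]; exists y; rewrite /= -fE.
apply: (fraction_classified ch).
- by move=> u v /nz[]; rewrite !evE //; exact: bilinear_pconj.
- by rewrite !pconj_coef; case: dA => -[-> ->]; rewrite qconj0; [left|right].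
- by rewrite !pconj_coef; case: dC => -[-> ->]; rewrite qconj0; [left|right].
Qed.
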